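(* Let $K$ be a field. Each of the Lie superalgebra $\mathbf Q$, the associative algebra $\mathbf A$, and the Poisson superalgebra without unit $\mathbf P^o$ (and, when $\operatorname{char}K\ne2$, the Jordan superalgebras without unit $\mathbf J^o$ and $\mathbf K^o$) decomposes as a direct sum of two locally nilpotent subalgebras: $$\mathbf Q=\mathbf Q_+\oplus\mathbf Q_-,\quad\mathbf A=\mathbf A_+\oplus\mathbf A_-,\quad\mathbf P^o=\mathbf P_+\oplus\mathbf P_-,\quad\mathbf J^o=\mathbf J_+\oplus\mathbf J_-,\quad\mathbf K^o=\mathbf K_+\oplus\mathbf K_-,$$ and for each of these algebras there are continuum many different such decompositions.
   Context: $\Lambda$ is the Grassmann algebra over $K$ on odd $x_0,x_1,\dots$ ($x_i$ acting by left multiplication), $\partial_i$ the superderivation with $\partial_i(x_j)=\delta_{ij}$, $v_i=\sum_{k\ge0}\big(\prod_{n=0}^{k-1}x_{i+3n}x_{i+3n+1}\big)\partial_{i+3k}$. $\mathbf Q$ is the Lie subsuperalgebra of $(\operatorname{End}\Lambda)^{(-)}$ generated by $v_0,v_1,v_2$ (closed under squares of odd elements in characteristic $2$); $\mathbf A$ is the associative subalgebra of $\operatorname{End}\Lambda$ generated by $v_0,v_1,v_2$. $H_\infty=\Lambda(x_i,y_i\mid i\ge0)$ (odd generators) with Poisson bracket $\{y_i,x_j\}=\delta_{ij}$, $\{x_i,x_j\}=\{y_i,y_j\}=0$; $\widetilde H$ its completion by formal sums $c\cdot1+\sum\lambda_{\alpha,\beta}x^\alpha y^\beta$ over monomials with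 $\beta\ne0$ and (largest index in $\alpha$) $<$ (largest index in $\beta$); $V_i=\sum_{k\ge0}\big(\prod_{n=0}^{k-1}x_{i+3n}x_{i+3n+1}\big)y_{i+3k}$; $\mathbf P$ is the smallest unital subalgebra of $\widetilde H$ containing $V_0,V_1,V_2$ closed under product, bracket and (in characteristic $2$) the formal square of odd elements ($m^{[2]}=0$ for odd monomials, $(f+g)^{[2]}=f^{[2]}+\{f,g\}+g^{[2]}$); $\mathbf P^o$ is the span of its elements without constant term (its ideal without unit). $\mathbf J=\mathrm{Kan}(\mathbf P)=\mathbf P\oplus\bar{\mathbf P}$ with $|\bar a|=1-|a|$ and $a\bullet b=ab$, $\bar a\bullet b=(-1)^{|b|}\overline{ab}$, $a\bullet\bar b=\overline{ab}$, $\bar a\bullet\bar b=(-1)^{|b|}\{a,b\}$; $\mathbf J^o=\mathbf P^o\oplus\bar{\mathbf P}$. $\mathbf K=K1\oplus\mathbf Q\oplus K\bar1\oplus\bar{\mathbf Q}$ with only nonzero products (besides the unit $1$) $\bar x\bullet\bar y=[x,y]$, $x\bullet\bar1=(-1)^{|x|}\bar1\bullet x=\bar x$; $\mathbf K^o=\mathbf Q\oplus K\bar1\oplus\bar{\mathbf Q}$. An algebra is locally nilpotent if every finitely generated subalgebra is nilpotent. *)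

(* Defs.v *)
From HB Require Import structures.
From mathcomp Require Import all_boot all_algebra.
From mathcomp Require Import finmap.
From mathcomp.multinomials Require Import monalg.

Set Implicit Arguments.
Unset Strict Implicit.
Unset Printing Implicit Defensive.

Import GRing.Theory.
Local Open Scope ring_scope.

(* An ambient K-vector space [car] (given by its zero, sum and scalar     *)
(* multiplication), an even/odd decomposition [pe]/[po] (the projections *)
(* onto the even and odd parts), a list of bilinear products [ops] and a *)
(* squaring map [sq] (used on odd elements: it is the characteristic-2   *)
(* formal square; in characteristic <> 2 closure under it is automatic). *)
Record alg (K : fieldType) := Alg {
  car : Type;
  az : car;
  aadd : car -> car -> car;
  ascale : K -> car -> car;
  ape : car -> car;
  apo : car -> car;
  aops : seq (car -> car -> car);
  asq : car -> car
}.
Arguments car {K} a.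
Arguments az {K} a.
Arguments aadd {K} a _ _.
Arguments ascale {K} a _ _.
Arguments ape {K} a _.
Arguments apo {K} a _.
Arguments aops {K} a.
Arguments asq {K} a _.

Fixpoint InL (T : Type) (x : T) (s : seq T) : Prop :=
  if s is y :: s' then y = x \/ InL x s' else False.

Section Framework.
Variables (K : fieldType) (A : alg K).

Definition is_odd (x : car A) : Prop := apo A x = x.

Definition is_subalg (B : car A -> Prop) : Prop :=
  [/\ B (az A),
      (forall x y, B x -> B y -> B (aadd A x y)),
      (forall c x, B x -> B (ascale A c x)),
      (forall x, B x -> B (ape A x) /\ B (apo A x)) &
      (forall f x y, InL f (aops A) -> B x -> B y -> B (f x y)) /\
      (forall x, B x -> is_odd x -> B (asq A x))].

Inductive gen (S : seq (car A)) : car A -> Prop :=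
| gen_in x : InL x S -> gen S x
| gen_0 : gen S (az A)
| gen_add x y : gen S x -> gen S y -> gen S (aadd A x y)
| gen_scale c x : gen S x -> gen S (ascale A c x)
| gen_pe x : gen S x -> gen S (ape A x)
| gen_po x : gen S x -> gen S (apo A x)
| gen_op f x y : InL f (aops A) -> gen S x -> gen S y -> gen S (f x y)
| gen_sq x : gen S x -> is_odd x -> gen S (asq A x).

Inductive pw (B : car A -> Prop) : nat -> car A -> Prop :=
| pw_in x : B x -> pw B 1 x
| pw_0 n : pw B n (az A)
| pw_add n x y : pw B n x -> pw B n y -> pw B n (aadd A x y)
| pw_scale n c x : pw B n x -> pw B n (ascale A c x)
| pw_op f i j x y : InL f (aops A) -> pw B i x -> pw B j y ->
    pw B (i + j) (f x y)
| pw_sq i x : pw B i x -> is_odd x -> pw B (2 * i) (asq A x).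

Definition nilpotent (B : car A -> Prop) : Prop :=
  exists N : nat, forall n x, (N <= n)%N -> pw B n x -> x = az A.

Definition locally_nilpotent (B : car A -> Prop) : Prop :=
  forall S : seq (car A), (forall x, InL x S -> B x) -> nilpotent (gen S).

Definition ln_decomposition (X B1 B2 : car A -> Prop) : Prop :=
  [/\ is_subalg B1 /\ is_subalg B2,
      locally_nilpotent B1 /\ locally_nilpotent B2,
      (forall x, B1 x -> X x) /\ (forall x, B2 x -> X x),
      (forall x, X x -> exists a b, [/\ B1 a, B2 b & x = aadd A a b]) &
      (forall x, B1 x -> B2 x -> x = az A)].

Definition continuum_ln_decompositions (X : car A -> Prop) : Prop :=
  exists D : (nat -> bool) -> (car A -> Prop) * (car A -> Prop),
    (forall s, ln_decomposition X (D s).1 (D s).2) /\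
    (forall s t, s <> t ->
       ~ ((forall x, (D s).1 x <-> (D t).1 x) /\
          (forall x, (D s).2 x <-> (D t).2 x))).

End Framework.

Fixpoint subs (s : seq nat) : seq (seq nat) :=
  if s is x :: s' then [seq x :: p | p <- subs s'] ++ subs s' else [:: [::]].

(* number of inversions between two monomials: the sign of the product  *)
(* x^a x^b of two disjoint sorted monomials is (-1)^(inv a b) *)
Definition inv (a b : seq nat) : nat := \sum_(x <- a) count (fun y => y < x)%N b.

Definition maxl (s : seq nat) : nat := foldr maxn 0%N s.

Definition sgn (K : fieldType) (n : nat) : K := (-1) ^+ n.

(* coefficient of the monomial t in the product x^a * x^b *)
Definition pcoef (K : fieldType) (a b t : seq nat) : K :=
  if sorted ltn t && perm_eq t (a ++ b) then sgn K (inv a b) else 0.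

(* monomials x_{s_1} ... x_{s_k}, s_1 < ... < s_k *)
Definition mono := {s : seq nat | sorted ltn s}.

(* Lambda = Grassmann algebra over K on x_0, x_1, ...: finitely supported *)
(* K-linear combinations of monomials *)
Definition Lam (K : fieldType) := {malg K[mono]}.

Definition mk (K : fieldType) (t : seq nat) : Lam K :=
  if insub t is Some m then << m >> else 0.

Definition lmul (K : fieldType) (a b : seq nat) : Lam K :=
  if has (fun x => x \in b) a then 0 else sgn K (inv a b) *: mk K (sort leq (a ++ b)).

Definition blk (i k : nat) : seq nat :=
  flatten [seq [:: i + 3 * n; i + 3 * n + 1]%N | n <- iota 0 k].

(* v_i applied to a monomial x^s:                                        *)
(*   sum_k (x_i x_{i+1} ... x_{i+3(k-1)+1}) * d_{i+3k}(x^s),             *)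
(* d_j the (left) superderivation, d_j(x^s) = (-1)^(index j s) x^(s\j) *)
Definition vmono (K : fieldType) (i : nat) (s : seq nat) : Lam K :=
  \sum_(k <- iota 0 (maxl s).+1)
    (if (i + 3 * k)%N \in s then
       sgn K (index (i + 3 * k)%N s) *: lmul K (blk i k) (rem (i + 3 * k)%N s)
     else 0).

Definition v (K : fieldType) (i : nat) (f : Lam K) : Lam K :=
  \sum_(m <- msupp f) f@_m *: vmono K i (val m).

Definition lpe (K : fieldType) (f : Lam K) : Lam K :=
  \sum_(m <- msupp f | ~~ odd (size (val m))) f@_m *: << m >>.
Definition lpo (K : fieldType) (f : Lam K) : Lam K :=
  \sum_(m <- msupp f | odd (size (val m))) f@_m *: << m >>.

Definition End (K : fieldType) := Lam K -> Lam K.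
Definition ez (K : fieldType) : End K := fun _ => 0.
Definition eadd (K : fieldType) (M N : End K) : End K := fun f => M f + N f.
Definition escale (K : fieldType) (c : K) (M : End K) : End K := fun f => c *: M f.
Definition ecomp (K : fieldType) (M N : End K) : End K := fun f => M (N f).
Definition eopp (K : fieldType) (M : End K) : End K := fun f => - M f.
Definition epe (K : fieldType) (M : End K) : End K :=
  eadd (ecomp (@lpe K) (ecomp M (@lpe K))) (ecomp (@lpo K) (ecomp M (@lpo K))).
Definition epo (K : fieldType) (M : End K) : End K :=
  eadd (ecomp (@lpo K) (ecomp M (@lpe K))) (ecomp (@lpe K) (ecomp M (@lpo K))).
Definition eflip (K : fieldType) (M : End K) : End K := eadd (epe M) (eopp (epo M)).

(* supercommutator [M,N] = MN - (-1)^(|M||N|) NM, extended bilinearly *)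
Definition ebr (K : fieldType) (M N : End K) : End K :=
  let Me := epe M in let Mo := epo M in let Ne := epe N in let No := epo N in
  eadd (eadd (ecomp Me N) (eopp (ecomp N Me)))
  (eadd (eadd (ecomp Mo Ne) (eopp (ecomp Ne Mo)))
        (eadd (ecomp Mo No) (ecomp No Mo))).

Definition LieEnd (K : fieldType) : alg K :=
  @Alg K (End K) (@ez K) (@eadd K) (@escale K) (@epe K) (@epo K)
       [:: @ebr K] (fun M => ecomp M M).

Definition AssEnd (K : fieldType) : alg K :=
  @Alg K (End K) (@ez K) (@eadd K) (@escale K) id (fun _ => @ez K)
       [:: @ecomp K] (fun M => ecomp M M).

Definition Qalg (K : fieldType) : End K -> Prop :=
  gen (A := LieEnd K) [:: @v K 0; @v K 1; @v K 2].
Definition Aalg (K : fieldType) : End K -> Prop :=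
  gen (A := AssEnd K) [:: @v K 0; @v K 1; @v K 2].

(* Generators of H_infinity are encoded by naturals: x_i = 2i, y_i = 2i+1, *)
(* ordered by their codes; a monomial is a strictly increasing list of   *)
(* codes.  An element of the completion H~ is a formal (possibly         *)
(* infinite) sum, i.e. a coefficient function on monomials.              *)
Definition Hf (K : fieldType) := seq nat -> K.
Definition hz (K : fieldType) : Hf K := fun _ => 0.
Definition hadd (K : fieldType) (f g : Hf K) : Hf K := fun t => f t + g t.
Definition hscale (K : fieldType) (c : K) (f : Hf K) : Hf K := fun t => c * f t.
Definition hpe (K : fieldType) (f : Hf K) : Hf K := fun t => if odd (size t) then 0 else f t.
Definition hpo (K : fieldType) (f : Hf K) : Hf K := fun t => if odd (size t) then f t else 0.
Definition hflip (K : fieldType) (f : Hf K) : Hf K := fun t => sgn K (size t) * f t.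

(* the completion H~: c.1 + sum over monomials x^a y^b with b <> 0 and   *)
(* (largest index in a) < (largest index in b) *)
Definition xs (t : seq nat) : seq nat := [seq n./2 | n <- t & ~~ odd n].
Definition ys (t : seq nat) : seq nat := [seq n./2 | n <- t & odd n].
Definition Htilde (K : fieldType) (f : Hf K) : Prop :=
  forall t, f t != 0 -> sorted ltn t /\
    (t = [::] \/ (ys t != [::] /\ (xs t == [::] \/ (maxl (xs t) < maxl (ys t))%N))).

(* product (exact: finitely many terms) *)
Definition hmul (K : fieldType) (f g : Hf K) : Hf K := fun t =>
  \sum_(p <- undup (subs t))
     f p * g [seq y <- t | y \notin p] * pcoef K p [seq y <- t | y \notin p] t.

(* coefficient of t in the Poisson bracket {x^m1, x^m2} of two monomials:  *)
(* {f,g} = -(-1)^|f| sum_j (d_{y_j} f . d_{x_j} g + d_{x_j} f . d_{y_j} g) *)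
(* (the unique Poisson superbracket with {y_i,x_j} = delta_ij,            *)
(*  {x_i,x_j} = {y_i,y_j} = 0; d_z the left superderivations)            *)
Definition dterm (K : fieldType) (z1 z2 : nat) (m1 m2 t : seq nat) : K :=
  if (z1 \in m1) && (z2 \in m2) then
    sgn K (index z1 m1) * sgn K (index z2 m2) * pcoef K (rem z1 m1) (rem z2 m2) t
  else 0.
Definition mbr (K : fieldType) (m1 m2 t : seq nat) : K :=
  - sgn K (size m1) *
    \sum_(j <- iota 0 (maxl m1).+1)
       (dterm K (2 * j).+1 (2 * j) m1 m2 t + dterm K (2 * j) (2 * j).+1 m1 m2 t).

(* the (finitely many) pairs of monomials (m1,m2) that can contribute to  *)
(* the coefficient of t in {f,g} for f, g in H~ (the contracted index j   *)
(* is then < the largest index of a y in t) *)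
Definition candH (t : seq nat) : seq (seq nat * seq nat) :=
  undup (flatten [seq flatten
     [seq [seq (sort leq (zz.1 :: p), sort leq (zz.2 :: [seq y <- t | y \notin p]))
          | p <- subs t]
     | zz <- [:: ((2 * j).+1, 2 * j); (2 * j, (2 * j).+1)]]
   | j <- iota 0 (maxl t).+1]).

Definition hbr (K : fieldType) (f g : Hf K) : Hf K := fun t =>
  \sum_(pq <- candH t) f pq.1 * g pq.2 * mbr K pq.1 pq.2 t.

Fixpoint lexlt (a b : seq nat) : bool :=
  match a, b with
  | [::], [::] => false
  | [::], _ => true
  | _, [::] => false
  | x :: a', y :: b' => (x < y)%N || ((x == y) && lexlt a' b')
  end.

(* formal square of an odd element f = sum l_m m:                         *)
(* f^[2] = sum_{m < m'} l_m l_m' {m, m'}  (m^[2] = 0 for odd monomials)   *)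
Definition hsq (K : fieldType) (f : Hf K) : Hf K := fun t =>
  \sum_(pq <- candH t | lexlt pq.1 pq.2) f pq.1 * f pq.2 * mbr K pq.1 pq.2 t.

Definition Halg (K : fieldType) : alg K :=
  @Alg K (Hf K) (@hz K) (@hadd K) (@hscale K) (@hpe K) (@hpo K)
       [:: @hmul K; @hbr K] (@hsq K).

Definition hone (K : fieldType) : Hf K := fun t => if t == [::] then 1 else 0.

(* the monomial x_i x_{i+1} x_{i+3} x_{i+4} ... x_{i+3(k-1)+1} y_{i+3k} *)
Definition Lk (i k : nat) : seq nat :=
  [seq (2 * n)%N | n <- blk i k] ++ [:: (2 * (i + 3 * k)).+1].

(* V_i = sum_k (prod_{n<k} x_{i+3n} x_{i+3n+1}) y_{i+3k} *)
Definition VV (K : fieldType) (i : nat) : Hf K := fun t =>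
  if has (fun k => t == Lk i k) (iota 0 (size t).+1) then 1 else 0.

Definition Palg (K : fieldType) : Hf K -> Prop :=
  gen (A := Halg K) [:: hone K; VV K 0; VV K 1; VV K 2].
Definition Po (K : fieldType) : Hf K -> Prop := fun f => @Palg K f /\ f [::] = 0.

(* 4. Kantor double J = Kan(P) and K = K1 + Q + K1bar + Qbar             *)

(* (a, b) stands for a + bbar *)
Definition Jcar (K : fieldType) := (Hf K * Hf K)%type.
Definition jprod (K : fieldType) (u w : Jcar K) : Jcar K :=
  let: (a, b) := u in let: (c, d) := w in
  (hadd (hmul a c) (hbr b (hflip d)), hadd (hmul a d) (hmul b (hflip c))).

Definition Jalg (K : fieldType) : alg K :=
  @Alg K (Jcar K) (hz K, hz K)
       (fun u w => (hadd u.1 w.1, hadd u.2 w.2))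
       (fun c u => (hscale c u.1, hscale c u.2))
       (fun u => (hpe u.1, hpo u.2)) (fun u => (hpo u.1, hpe u.2))
       [:: @jprod K] (fun u => jprod u u).

Definition Jo (K : fieldType) : Jcar K -> Prop := fun u => @Po K u.1 /\ @Palg K u.2.

(* (l, x, m, y) stands for l.1 + x + m.1bar + ybar *)
Definition Kcar (K : fieldType) := (K * End K * K * End K)%type.
Definition kprod (K : fieldType) (u w : Kcar K) : Kcar K :=
  let: (l, x, m, y) := u in let: (l', x', m', y') := w in
  (l * l',
   eadd (eadd (escale l x') (escale l' x)) (ebr y y'),
   l * m' + l' * m,
   eadd (eadd (escale l y') (escale l' y)) (eadd (escale m' x) (escale m (eflip x')))).

Definition Kalg (K : fieldType) : alg K :=
  @Alg K (Kcar K) (0, @ez K, 0, @ez K)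
       (fun u w => let: (l, x, m, y) := u in let: (l', x', m', y') := w in
                   (l + l', eadd x x', m + m', eadd y y'))
       (fun c u => let: (l, x, m, y) := u in
                   (c * l, escale c x, c * m, escale c y))
       (fun u => let: (l, x, m, y) := u in (l, epe x, 0, epo y))
       (fun u => let: (l, x, m, y) := u in (0, epo x, m, epe y))
       [:: @kprod K] (fun u => kprod u u).

Definition Ko (K : fieldType) : Kcar K -> Prop := fun u =>
  let: (l, x, m, y) := u in [/\ l = 0, @Qalg K x & @Qalg K y].

Arguments Qalg K _ : clear implicits.
Arguments Aalg K _ : clear implicits.
Arguments Palg K _ : clear implicits.
Arguments Po K _ : clear implicits.
Arguments Jo K _ : clear implicits.
Arguments Ko K _ : clear implicits.

(* Main.v *)
From HB Require Import structures.
From mathcomp Require Import all_boot all_order all_algebra finmap zify ring lra.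
From mathcomp.multinomials Require Import monalg.
From mathcomp Require Import Rstruct complex boolp classical_sets reals topology.
From mathcomp Require Import normedtype sequences trigo.
Require Import Defs.

Set Implicit Arguments.
Unset Strict Implicit.
Unset Printing Implicit Defensive.

Import GRing.Theory Num.Theory Order.TTheory.
Import ComplexField.Normc numFieldNormedType.Exports.
Local Open Scope ring_scope.

(* Grade the algebras by Z[X]/(X^3 - X - 2), the letters x_j, y_j and d_j having the
   degrees -X^j, X^j and X^j; then v_n and V_n are homogeneous of degree X^n.  Expand
   the letters of a word in the v_j by v_j = d_j + x_j x_{j+1} v_{j+3} down to a
   monomial in the x_j and d_j, of degree f in Z[X]: counting the letters v_j met on
   the way one gets f = q (X^3 - X - 2) + r with q and r nonnegative and deg r <= 2,
   while the coefficients of f are -1, 0 or 1 because every x_j and d_j is odd.  As the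
   real root lam of X^3 - X - 2 exceeds the modulus of the complex root mu, the value
   f(mu) is then o(f(lam)).  A half-plane of C through 0 splits the degrees f(mu) into
   two additively closed parts, on either of which sums of finitely many degrees leave
   the origin linearly fast, so that long products vanish.  Rotating the half-plane
   gives continuum many decompositions, which the v_n tell apart since the arguments
   of the powers mu^n are dense. *)

(** * Subalgebras *)

Section Subalgebras.
Variables (K : fieldType) (A : alg K).
Implicit Types (S : seq (car A)) (Y : car A -> Prop).

Lemma gen_subalg S : is_subalg (gen S).
Proof.
split; first exact: gen_0.
- by move=> x y; apply: gen_add.
- by move=> c x; apply: gen_scale.
- by move=> x Hx; split; [apply: gen_pe | apply: gen_po].
- by split; [move=> f x y fA; apply: gen_op | move=> x; apply: gen_sq].
Qed.

Lemma gen_min S Y :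
  is_subalg Y -> (forall x, InL x S -> Y x) -> forall x, gen S x -> Y x.
Proof.
move=> [Y0 YD YZ Yp [Yop Ysq]] SY x.
elim=> {x} [x /SY | | x y _ Yx _ Yy | c x _ Yx | x _ Yx | x _ Yx
           | f x y fA _ Yx _ Yy | x _ Yx ox] //.
- exact: YD.
- exact: YZ.
- by have [] := Yp _ Yx.
- by have [] := Yp _ Yx.
- exact: Yop.
- exact: Ysq.
Qed.

End Subalgebras.

(** * Graded algebras *)

Section HalfSpaces.
Variables (G : zmodType) (adm : G -> Prop).
Implicit Types (P Q : pred G) (L s : seq G).

Definition escaping Q : Prop := forall L,
  (forall d, d \in L -> [/\ adm d, d != 0 & Q d]) ->
  exists N, forall s, {subset s <= L} -> (N <= size s)%N -> ~ adm (\sum_(d <- s) d).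

Definition half_space P : Prop :=
  [/\ ~~ P 0, (forall b d e, P d = b -> P e = b -> P (d + e) = b),
      escaping P & escaping (predC P)].

End HalfSpaces.

Section Supports.
Variables (K : fieldType) (A : alg K) (I : Type) (supp : car A -> I -> Prop).
Implicit Types (B X Y : car A -> Prop) (C : I -> I -> I -> Prop).

(* [C i1 i2 i] says that the product of components with indices [i1] and [i2]
   may have a component with index [i]. *)
Record graded X C : Prop := Graded {
  supp_zero : forall i, ~ supp (az A) i;
  supp_eq0 : forall x, X x -> (forall i, ~ supp x i) -> x = az A;
  supp_add : forall x y i, X x -> X y -> supp (aadd A x y) i -> supp x i \/ supp y i;
  supp_scale : forall c x i, X x -> supp (ascale A c x) i -> supp x i;
  supp_pe : forall x i, X x -> supp (ape A x) i -> supp x i;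
  supp_po : forall x i, X x -> supp (apo A x) i -> supp x i;
  supp_op : forall f x y i, InL f (aops A) -> X x -> X y -> supp (f x y) i ->
    exists i1 i2, [/\ supp x i1, supp y i2 & C i1 i2 i];
  supp_sq : forall x i, X x -> is_odd x -> supp (asq A x) i ->
    exists i1 i2, [/\ supp x i1, supp x i2 & C i1 i2 i]
}.

Lemma graded_sub X Y C C' :
    (forall x, Y x -> X x) -> (forall i1 i2 i, C i1 i2 i -> C' i1 i2 i) ->
  graded X C -> graded Y C'.
Proof.
move=> YX CC' [s0 s_eq0 s_add s_scale s_pe s_po s_op s_sq].
have weaken x y i : (exists i1 i2, [/\ supp x i1, supp y i2 & C i1 i2 i]) ->
    exists i1 i2, [/\ supp x i1, supp y i2 & C' i1 i2 i].
  by move=> [i1 [i2 [? ? /CC' ?]]]; exists i1, i2.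
split=> //.
- by move=> x /YX; apply: s_eq0.
- by move=> x y i /YX Xx /YX; apply: s_add.
- by move=> c x i /YX; apply: s_scale.
- by move=> x i /YX; apply: s_pe.
- by move=> x i /YX; apply: s_po.
- by move=> f x y i fA /YX Xx /YX Xy s; apply: weaken; apply: s_op s.
- by move=> x i /YX Xx ox s; apply: weaken; apply: s_sq s.
Qed.

Variables (X : car A -> Prop) (C : I -> I -> I -> Prop).
Hypotheses (gX : graded X C) (subX : is_subalg X).

Definition supported (Phi : I -> Prop) (x : car A) : Prop :=
  X x /\ forall i, supp x i -> Phi i.

Lemma supported_subalg (Phi : I -> Prop) :
    (forall i1 i2 i, C i1 i2 i -> Phi i1 -> Phi i2 -> Phi i) ->
  is_subalg (supported Phi).
Proof.
have [X0 XD XZ Xp [Xop Xsq]] := subX; move=> PhiC; split.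
- by split=> // i /(supp_zero gX).
- move=> x y [Xx Hx] [Xy Hy]; split; first exact: XD.
  by move=> i /(supp_add gX Xx Xy)[/Hx | /Hy].
- by move=> c x [Xx Hx]; split; [apply: XZ | move=> i /(supp_scale gX Xx)/Hx].
- move=> x [Xx Hx]; have [Xe Xo] := Xp _ Xx.
  by split; split=> // i; [move/(supp_pe gX Xx)/Hx | move/(supp_po gX Xx)/Hx].
- split.
    move=> f x y fA [Xx Hx] [Xy Hy]; split; first exact: Xop.
    by move=> i /(supp_op gX fA Xx Xy)[i1 [i2 [/Hx P1 /Hy P2 c]]]; apply: PhiC c P1 P2.
  move=> x [Xx Hx] ox; split; first exact: Xsq.
  by move=> i /(supp_sq gX Xx ox)[i1 [i2 [/Hx P1 /Hx P2 c]]]; apply: PhiC c P1 P2.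
Qed.

Lemma pw_supported B (Phi : nat -> I -> Prop) :
    (forall x, B x -> supported (Phi 1%N) x) ->
    (forall m n i1 i2 i, C i1 i2 i -> Phi m i1 -> Phi n i2 -> Phi (m + n)%N i) ->
  forall m x, pw B m x -> supported (Phi m) x.
Proof.
have [X0 XD XZ _ [Xop Xsq]] := subX; move=> BPhi PhiC m x.
elim=> {m x} [x /BPhi | m | m x y _ [Xx Hx] _ [Xy Hy] | m c x _ [Xx Hx]
             | f m n x y fA _ [Xx Hx] _ [Xy Hy] | m x _ [Xx Hx] ox] //.
- by split=> // i /(supp_zero gX).
- split; first exact: XD.
  by move=> i /(supp_add gX Xx Xy)[/Hx | /Hy].
- by split; [apply: XZ | move=> i /(supp_scale gX Xx)/Hx].
- split; first exact: Xop.
  by move=> i /(supp_op gX fA Xx Xy)[i1 [i2 [/Hx P1 /Hy P2 c]]]; apply: PhiC c P1 P2.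
- split; first exact: Xsq.
  rewrite mul2n -addnn => i /(supp_sq gX Xx ox)[i1 [i2 [/Hx P1 /Hx P2 c]]].
  exact: PhiC c P1 P2.
Qed.

End Supports.

Section HomogeneousSums.
Variables (K : fieldType) (A : alg K) (I : Type) (supp : car A -> I -> Prop).
Variables (G : zmodType) (deg : I -> G).
Implicit Types (X Y : car A -> Prop) (d : G) (Q : pred G).
Local Notation "x +' y" := (aadd A x y) (at level 50, left associativity).

Definition hom d x : Prop := forall i, supp x i -> deg i = d.

Inductive hom_sum Y : car A -> Prop :=
| hom_sum0 : hom_sum Y (az A)
| hom_sumD d x y : Y x -> hom d x -> hom_sum Y y -> hom_sum Y (x +' y).

Definition part X Q : car A -> Prop := supported supp X (fun i => Q (deg i)).

Lemma hom_sum_sub X Y : (forall x, X x -> Y x) -> forall x, hom_sum X x -> hom_sum Y x.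
Proof.
move=> XY x; elim=> {x} [|d x y Xx hx _ Yy]; first exact: hom_sum0.
by apply: hom_sumD hx Yy; apply: XY.
Qed.

Lemma hom_sum_mem X x : is_subalg X -> hom_sum X x -> X x.
Proof. by case=> X0 XD _ _ _; elim=> {x} [|d x y Xx _ _ Xy] //; apply: XD. Qed.

Lemma hom_sum_supp_finite X C x : graded supp X C -> is_subalg X -> hom_sum X x ->
  exists L : seq G, forall i, supp x i -> deg i \in L.
Proof.
move=> gX subX; elim=> {x} [|d x y Xx hx Sy [L HL]]; first by exists [::] => i /(supp_zero gX).
exists (d :: L) => i /(supp_add gX Xx (hom_sum_mem subX Sy))[/hx -> | /HL iL].
  exact: mem_head.
by rewrite inE iL orbT.
Qed.

Lemma hom_sum_part X C Q x :
  graded supp X C -> is_subalg X -> hom_sum (part X Q) x -> part X Q x.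
Proof.
move=> gX [X0 XD _ _ _]; elim=> {x} [|d x y [Xx Qx] _ _ [Xy Qy]].
  by split=> // i /(supp_zero gX).
by split; [apply: XD | move=> i /(supp_add gX Xx Xy)[/Qx | /Qy]].
Qed.

Lemma hom_part X Q d x : X x -> hom d x -> Q d -> part X Q x.
Proof. by move=> Xx hx Qd; split=> // i /hx ->. Qed.

Hypotheses (addA : forall x y z : car A, x +' (y +' z) = x +' y +' z)
           (addC : forall x y : car A, x +' y = y +' x)
           (add0 : forall x, az A +' x = x).

Lemma hom_sum1 Y d x : Y x -> hom d x -> hom_sum Y x.
Proof.
by move=> Yx hx; rewrite -(add0 x) addC; apply: hom_sumD hx (hom_sum0 Y).
Qed.

Lemma hom_sum_add Y x y : hom_sum Y x -> hom_sum Y y -> hom_sum Y (x +' y).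
Proof.
move=> Sx Sy; elim: Sx => {x} [|d x z Yx hx _ IH]; first by rewrite add0.
by rewrite -addA; apply: hom_sumD hx IH.
Qed.

Lemma hom_sum_split X Q x : hom_sum X x -> exists y z,
  [/\ hom_sum (part X Q) y, hom_sum (part X (predC Q)) z & x = y +' z].
Proof.
elim=> {x} [|d x _ Xx hx _ [y [z [Sy Sz ->]]]].
  by exists (az A), (az A); rewrite add0; split=> //; apply: hom_sum0.
have [Qd | nQd] := boolP (Q d).
  exists (x +' y), z; rewrite addA; split=> //.
  exact: hom_sumD (hom_part Xx hx Qd) hx Sy.
exists y, (x +' z); split=> //; last by rewrite !addA (addC x).
exact: hom_sumD (hom_part Xx hx nQd) hx Sz.
Qed.

End HomogeneousSums.

Lemma hom_sum_map (K : fieldType) (A A' : alg K) (I I' : Type) (G : zmodType)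
    (supp : car A -> I -> Prop) (supp' : car A' -> I' -> Prop)
    (deg : I -> G) (deg' : I' -> G) (X : car A -> Prop) (X' : car A' -> Prop)
    (phi : car A -> car A') :
    phi (az A) = az A' -> (forall x y, phi (aadd A x y) = aadd A' (phi x) (phi y)) ->
    (forall x, X x -> X' (phi x)) ->
    (forall x i', supp' (phi x) i' -> exists2 i, supp x i & deg' i' = deg i) ->
  forall x, hom_sum supp deg X x -> hom_sum supp' deg' X' (phi x).
Proof.
move=> phi0 phiD XX' supp_phi x.
elim=> {x} [|d x y Xx hx _ IH]; first by rewrite phi0; apply: hom_sum0.
rewrite phiD; apply: (hom_sumD (d := d) (XX' _ Xx)) IH => i' /supp_phi[i si ->].
exact: hx.
Qed.

Section LinearOperations.
Variables (K : fieldType) (A : alg K) (X : car A -> Prop).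
Local Notation "x +' y" := (aadd A x y) (at level 50, left associativity).

Definition additive_on (f : car A -> car A) : Prop :=
  forall x y, X x -> X y -> f (x +' y) = f x +' f y.

Record linear_operations : Prop := LinearOperations {
  aaddA : forall x y z : car A, x +' (y +' z) = x +' y +' z;
  aaddC : forall x y : car A, x +' y = y +' x;
  aadd0 : forall x, az A +' x = x;
  aaddxx_eq0 : forall x : car A, x +' x = x -> x = az A;
  ascale_additive : forall c, additive_on (ascale A c);
  ape_additive : additive_on (ape A);
  apo_additive : additive_on (apo A);
  apo_idem : forall x, X x -> apo A (apo A x) = apo A x;
  aop_additivel : forall f y, InL f (aops A) -> X y -> additive_on (fun x => f x y);
  aop_additiver : forall f x, InL f (aops A) -> X x -> additive_on (f x);
  asqD : exists2 f, InL f (aops A) & forall x y, X x -> X y -> is_odd x -> is_odd y ->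
    asq A (x +' y) = asq A x +' asq A y +' f x y
}.

Hypotheses (linX : linear_operations) (subX : is_subalg X).

Lemma additive_on0 f : additive_on f -> f (az A) = az A.
Proof.
have [X0 _ _ _ _] := subX.
by move=> fD; apply: (aaddxx_eq0 linX); rewrite -fD // (aadd0 linX).
Qed.

Lemma asq0 : asq A (az A) = az A.
Proof.
have [X0 _ _ _ _] := subX; have [f fA sqD] := asqD linX.
have odd0 : is_odd (az A) by apply: additive_on0; apply: apo_additive.
have f00 : f (az A) (az A) = az A by apply: (additive_on0 (aop_additiver linX fA X0)).
have := sqD _ _ X0 X0 odd0 odd0.
by rewrite f00 !(aaddC linX _ (az A)) !(aadd0 linX) => /esym/(aaddxx_eq0 linX).
Qed.

Variables (I : Type) (supp : car A -> I -> Prop) (G : zmodType) (deg : I -> G).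
Variable C : I -> I -> I -> Prop.
Hypotheses (gX : graded supp X C)
           (degC : forall i1 i2 i, C i1 i2 i -> deg i = deg i1 + deg i2).
Variable S : seq (car A).
Hypotheses (SX : forall x, InL x S -> X x)
           (Shom : forall x, InL x S -> exists d, hom supp deg d x).
Local Notation hom := (hom supp deg).
Local Notation hsum := (hom_sum supp deg (gen S)).

Lemma gen_ambient x : gen S x -> X x.
Proof. exact: gen_min subX SX x. Qed.

Lemma hom_op d e f x y : InL f (aops A) -> X x -> X y ->
  hom d x -> hom e y -> hom (d + e) (f x y).
Proof.
by move=> fA Xx Xy hx hy i /(supp_op gX fA Xx Xy)[i1 [i2 [/hx <- /hy <- /degC]]].
Qed.

Lemma hom_sq d x : X x -> is_odd x -> hom d x -> hom (d + d) (asq A x).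
Proof.
move=> Xx ox hx i /(supp_sq gX Xx ox)[i1 [i2 [s1 s2 /degC ->]]].
by rewrite (hx _ s1) (hx _ s2).
Qed.

Let hsum1 d x : gen S x -> hom d x -> hsum x.
Proof. exact: (hom_sum1 (aaddC linX) (aadd0 linX)). Qed.

Let hsum_add x y : hsum x -> hsum y -> hsum (x +' y).
Proof. exact: (hom_sum_add (aaddA linX) (aadd0 linX)). Qed.

Let hsumX x : hsum x -> X x.
Proof. by move=> /(hom_sum_mem (gen_subalg S))/gen_ambient. Qed.

Lemma hom_sum_additive f : additive_on f ->
    (forall d x, gen S x -> hom d x -> hsum (f x)) ->
  forall x, hsum x -> hsum (f x).
Proof.
move=> fD fh x; elim=> {x} [|d x y gx hx Sy IH].
  by rewrite additive_on0 //; apply: hom_sum0.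
rewrite fD; [| exact: gen_ambient | exact: hsumX].
by apply: hsum_add IH; apply: fh hx.
Qed.

Lemma hom_sum_po x : hsum x -> hsum (apo A x).
Proof.
apply: hom_sum_additive; first exact: apo_additive.
move=> d y gy hy; apply: (hsum1 (d := d)); first exact: gen_po.
by move=> i /(supp_po gX (gen_ambient gy))/hy.
Qed.

Lemma hom_sum_op f x y : InL f (aops A) -> hsum x -> hsum y -> hsum (f x y).
Proof.
move=> fA Sx Sy; move: Sx; apply: (hom_sum_additive (f := f^~ y)).
  exact: aop_additivel (hsumX Sy).
move=> d a ga ha; move: Sy; apply: (hom_sum_additive (f := f a)).
  exact: aop_additiver (gen_ambient ga).
move=> e b gb hb; apply: (hsum1 (d := d + e)); first exact: gen_op.
exact: hom_op fA (gen_ambient ga) (gen_ambient gb) ha hb.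
Qed.

Lemma hom_sum_sq x : hsum x -> hsum (asq A (apo A x)).
Proof.
have [f fA sqD] := asqD linX.
have [_ _ _ Xp _] := subX; have Xpo z : X z -> X (apo A z) by case/Xp.
elim=> {x} [|d x y gx hx Sy IH].
  by rewrite (additive_on0 (apo_additive linX)) asq0; apply: hom_sum0.
have [Xx Xy] := (gen_ambient gx, hsumX Sy).
have odd_po z : X z -> is_odd (apo A z) by apply: apo_idem.
have hpx : hom d (apo A x) by move=> i /(supp_po gX Xx)/hx.
rewrite apo_additive // sqD; try by [exact: Xpo | exact: odd_po].
apply: hsum_add.
  apply: hsum_add IH; apply: (hsum1 (d := d + d)).
    by apply: gen_sq (odd_po _ Xx); apply: gen_po.
  exact: hom_sq (Xpo _ Xx) (odd_po _ Xx) hpx.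
apply: hom_sum_op fA _ (hom_sum_po Sy).
by apply: hsum1 hpx; apply: gen_po.
Qed.

Lemma gen_hom_sum x : gen S x -> hsum x.
Proof.
elim=> {x} [x xS | | x y _ Sx _ Sy | c x _ Sx | x _ Sx | x _ Sx
           | f x y fA _ Sx _ Sy | x _ Sx ox].
- by have [d hx] := Shom xS; apply: hsum1 hx; apply: gen_in.
- exact: hom_sum0.
- exact: hsum_add.
- move: Sx; apply: hom_sum_additive; first exact: ascale_additive.
  move=> d y gy hy; apply: (hsum1 (d := d)); first exact: gen_scale.
  by move=> i /(supp_scale gX (gen_ambient gy))/hy.
- move: Sx; apply: hom_sum_additive; first exact: ape_additive.
  move=> d y gy hy; apply: (hsum1 (d := d)); first exact: gen_pe.
  by move=> i /(supp_pe gX (gen_ambient gy))/hy.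
- exact: hom_sum_po.
- exact: hom_sum_op.
- by rewrite -ox; apply: hom_sum_sq.
Qed.

End LinearOperations.

(** * Decompositions along half-spaces *)

Section Decomposition.
Variables (K : fieldType) (A : alg K) (X : car A -> Prop) (I : Type).
Variables (supp : car A -> I -> Prop) (G : zmodType) (adm : G -> Prop).
Variables (deg : I -> G) (bar : I -> bool).
Local Notation part := (part supp deg X).

(* For a Kantor double, [bar] singles out the barred components; the multiples
   of 1bar are the only components of degree zero, and a product of two barred
   elements is a bracket, to which constants do not contribute. *)
Definition kantor_comp (i1 i2 i : I) : Prop :=
  [/\ deg i = deg i1 + deg i2, bar i = bar i1 (+) bar i2 &
      bar i1 -> bar i2 -> deg i1 != 0 /\ deg i2 != 0].

Hypotheses (gX : graded supp X kantor_comp) (subX : is_subalg X).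
Hypothesis supp_adm : forall x i, X x -> supp x i -> adm (deg i).
Hypothesis deg0_bar : forall x i, X x -> supp x i -> deg i = 0 -> bar i.
Hypothesis X_hom_sum : forall x, X x -> hom_sum supp deg X x.

Section OnePart.
Variable Q : pred G.
Hypotheses (QD : forall d e, Q d -> Q e -> Q (d + e)) (escQ : escaping adm Q).

Lemma part_subalg : is_subalg (part Q).
Proof.
by apply: (supported_subalg gX subX) => i1 i2 i [-> _ _]; apply: QD.
Qed.

(* In a nonzero product of [m] factors whose nonzero degrees lie in [L]: 1bar
   leaves degrees unchanged but turns unbarred elements into barred ones, and it
   takes two barred elements of nonzero degree to get back, so at least about a
   third of the factors have nonzero degree. *)
Definition sparse_degree (L : seq G) (m : nat) (i : I) : Prop :=
  ([/\ deg i = 0, bar i & (m <= 1)%N]) \/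
  exists s : seq G, [/\ {subset s <= L}, deg i = \sum_(d <- s) d &
    (m + (if bar i then 1 else 2) <= 3 * size s)%N].

Lemma sparse_degree_comp L m n i1 i2 i : kantor_comp i1 i2 i ->
  sparse_degree L m i1 -> sparse_degree L n i2 -> sparse_degree L (m + n) i.
Proof.
move=> [di bi nz]; rewrite /sparse_degree {}di {}bi.
case=> [[d1 b1 m1] | [s1 [sL1 d1 r1]]]; case=> [[d2 b2 n1] | [s2 [sL2 d2 r2]]].
- by have [] := nz b1 b2; rewrite d1 eqxx.
- right; exists s2; rewrite d1 add0r d2; split=> //; move: nz r2; rewrite b1.
  case: (bar i2) => /= [/(_ isT isT)[] | _]; [by rewrite d1 eqxx | by lia].
- right; exists s1; rewrite d2 addr0 d1; split=> //; move: nz r1; rewrite b2.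
  case: (bar i1) => /= [/(_ isT isT)[_] | _]; [by rewrite d2 eqxx | by lia].
- right; exists (s1 ++ s2); split.
  + by move=> d; rewrite mem_cat => /orP[/sL1 | /sL2].
  + by rewrite d1 d2 big_cat.
  + by rewrite size_cat; move: r1 r2; case: (bar i1); case: (bar i2) => /=; lia.
Qed.

Lemma sparse_degreeW L m n i : (n <= m)%N -> sparse_degree L m i -> sparse_degree L n i.
Proof.
move=> nm [[d0 bi m1] | [s [sL ds sm]]]; first by left; split=> //; apply: leq_trans m1.
by right; exists s; split=> //; apply: leq_trans sm; rewrite leq_add2r.
Qed.

Lemma part_degrees_finite (S : seq (car A)) : (forall x, InL x S -> part Q x) ->
  exists L : seq G, (forall d, d \in L -> [/\ adm d, d != 0 & Q d]) /\
    forall x i, InL x S -> supp x i -> deg i != 0 -> deg i \in L.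
Proof.
move=> SQ.
have [L0 SL0] : exists L0 : seq G, forall x i, InL x S -> supp x i -> deg i \in L0.
  elim: S SQ => [|y S IHS] SQ; first by exists [::].
  have [|L SL] := IHS; first by move=> x xS; apply: SQ; right.
  have [Xy _] : part Q y by apply: SQ; left.
  have [Ly yL] := hom_sum_supp_finite gX subX (X_hom_sum Xy).
  exists (Ly ++ L) => x i /= [<- | xS] si; rewrite mem_cat; first by rewrite yL.
  by rewrite (SL x) ?orbT.
exists [seq d <- L0 | [&& `[< adm d >], d != 0 & Q d]]; split=> [d | x i xS si d0].
  by rewrite mem_filter => /andP[/and3P[/asboolP]].
have [Xx Qx] := SQ _ xS; rewrite mem_filter d0 (Qx _ si) (SL0 x) // !andbT.
by apply/asboolP; apply: supp_adm si.
Qed.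

Lemma gen_sparse_degree S L : (forall x, InL x S -> X x) ->
    (forall x i, InL x S -> supp x i -> deg i != 0 -> deg i \in L) ->
  forall x, gen S x -> supported supp X (sparse_degree L 1) x.
Proof.
move=> SX SL; apply: gen_min => [|x xS].
  apply: (supported_subalg gX subX) => i1 i2 i c s1 s2.
  by apply: (sparse_degreeW (m := 2)) => //; apply: sparse_degree_comp c s1 s2.
split=> [|i si]; first exact: SX.
have [d0 | d0] := eqVneq (deg i) 0.
  by left; split=> //; apply: deg0_bar si d0; apply: SX.
right; exists [:: deg i]; split; last by case: (bar i).
- by move=> d; rewrite inE => /eqP ->; apply: SL si d0.
- by rewrite big_seq1.
Qed.

Lemma part_locally_nilpotent : locally_nilpotent (part Q).
Proof.
move=> S SQ; have [L [LQ SL]] := part_degrees_finite SQ; have [N HN] := escQ LQ.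
have SX x : InL x S -> X x by case/SQ.
exists (3 * N + 2)%N => m x Nm gx.
have [Xx Hx] := pw_supported gX subX (gen_sparse_degree SX SL)
  (@sparse_degree_comp L) gx.
apply: (supp_eq0 gX Xx) => i si.
have [[_ _] | [s [sL ds sm]]] := Hx i si; first by lia.
apply: (HN s sL); first by move: sm; case: (bar i); lia.
by rewrite -ds; apply: supp_adm si.
Qed.

End OnePart.

Hypotheses (addA : forall x y z, aadd A x (aadd A y z) = aadd A (aadd A x y) z)
           (addC : forall x y, aadd A x y = aadd A y x)
           (add0 : forall x, aadd A (az A) x = x).

Lemma half_space_decomposition P :
  half_space adm P -> ln_decomposition X (part P) (part (predC P)).
Proof.
move=> [P0 PD escP escC].
have PD1 d e : P d -> P e -> P (d + e) by apply: PD.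
have PD0 d e : predC P d -> predC P e -> predC P (d + e).
  by move=> /= /negbTE nd /negbTE ne; apply/negbT/PD.
split.
- by split; apply: part_subalg.
- by split; apply: part_locally_nilpotent.
- by split=> x [].
- move=> x /X_hom_sum Sx.
  have [y [z [Sy Sz ->]]] := hom_sum_split addA addC add0 P Sx.
  by exists y, z; split=> //; apply: hom_sum_part gX subX _.
- move=> x [Xx Px] [_ nPx]; apply: (supp_eq0 gX Xx) => i si.
  by have := nPx i si; rewrite /= Px.
Qed.

Theorem half_spaces_continuum (P : (nat -> bool) -> pred G) (g : nat -> G) :
    (forall s, half_space adm (P s)) ->
    (forall s t, s <> t -> exists n, P s (g n) != P t (g n)) ->
    (forall n, exists x i, [/\ X x, supp x i & hom supp deg (g n) x]) ->
  continuum_ln_decompositions X.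
Proof.
move=> halfP sepP Xg; exists (fun s => (part (P s), part (predC (P s)))).
split=> [s | s t /sepP[n /eqP Pn] [/= eq_part _]]; first exact: half_space_decomposition.
have [x [i [Xx si hx]]] := Xg n.
have partP Q : part Q x <-> Q (g n).
  by split=> [[_ /(_ i si)] | Qg]; [rewrite (hx _ si) | split=> // j /hx ->].
by apply: Pn; apply/idP/idP => /partP/eq_part/partP.
Qed.

End Decomposition.

(** * Multiples modulo 1 and ternary series *)

Section Kronecker.
Variable R : archiRealFieldType.
Implicit Types x p q e : R.

Lemma small_multiple_mod1 x e : 0 < e ->
  exists n : nat, exists z : int, (0 < n)%N /\ `|n%:R * x - z%:~R| < e.
Proof.
move=> e0; pose N := Num.bound e^-1.
have eN : e^-1 < N%:R by apply: archi_boundP; rewrite invr_ge0 ltW.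
have N0 : 0 < N%:R :> R by apply: lt_trans eN; rewrite invr_gt0.
pose frac (k : nat) := k%:R * x - (Num.floor (k%:R * x))%:~R.
have fracP k : 0 <= frac k * N%:R < N%:R.
  have /andP[f0 f1] : 0 <= frac k < 1.
    by have := floor_itv (k%:R * x); rewrite intrD /frac; lra.
  by rewrite -[X in _ < X]mul1r ltr_pM2r // f1 mulr_ge0 // ltW.
have box_lt (k : 'I_N.+1) : (Num.truncn (frac k * N%:R) < N)%N.
  by have /andP[? ?] := fracP k; rewrite truncn_lt_nat.
pose box k := Ordinal (box_lt k).
have /injectivePn[i [j ij /(f_equal val) /= boxE]] : ~~ injectiveb box.
  by apply/injectiveP => /leq_card; rewrite !card_ord ltnn.
wlog lt_ij : i j ij boxE / (i < j)%N.
  move=> IH; move: ij; rewrite neq_lt => /orP[lt | lt].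
    by apply: (IH i j) => //; rewrite neq_lt lt.
  by apply: (IH j i) => //; rewrite neq_lt lt.
exists (j - i)%N, (Num.floor (j%:R * x) - Num.floor (i%:R * x)).
rewrite subn_gt0; split=> //; rewrite natrB ?(ltnW lt_ij) // intrB.
have -> : (j%:R - i%:R) * x - ((Num.floor (j%:R * x))%:~R - (Num.floor (i%:R * x))%:~R) =
    (frac j * N%:R - frac i * N%:R) / N%:R by rewrite /frac; field; rewrite gt_eqF.
rewrite normrM normfV (gtr0_norm N0) ltr_pdivrMr //.
apply: (@lt_trans _ _ 1); last by rewrite mulrC -ltr_pdivrMr // div1r.
have /andP[i0 _] := fracP i; have /andP[j0 _] := fracP j.
have := truncn_itv i0; have := truncn_itv j0; rewrite -boxE -natr1 ltr_norml.
by move=> /andP[? ?] /andP[? ?]; apply/andP; split; lra.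
Qed.

Lemma multiples_reach p q e : 0 < e < q - p ->
  exists n : nat, exists m : nat, p < n%:R * e - m%:R < q.
Proof.
move=> /andP[e0 eq]; pose m := Num.bound `|p|.
have pm : 0 <= p + m%:R.
  by have := archi_boundP (normr_ge0 p); have := ler_norm (- p); rewrite normrN -/m; lra.
exists (Num.truncn ((p + m%:R) / e)).+1, m.
have := truncn_itv (divr_ge0 pm (ltW e0)).
by rewrite ler_pdivlMr // ltr_pdivrMr // -natr1; lra.
Qed.

Theorem multiples_dense_mod1 x p q :
    (forall (n : nat) (z : int), (0 < n)%N -> n%:R * x != z%:~R) -> p < q ->
  exists n : nat, exists z : int, p < n%:R * x - z%:~R < q.
Proof.
move=> irr pq; have pq0 : 0 < q - p by rewrite subr_gt0.
have [k [z [k0 small]]] := small_multiple_mod1 x pq0.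
wlog pos : x p q pq pq0 irr z small / 0 < k%:R * x - z%:~R.
  move=> IH; have [neg | pos | ] := ltrgt0P (k%:R * x - z%:~R); last 1 first.
  - by move/eqP; rewrite subr_eq0 (negbTE (irr k z k0)).
  - exact: (IH x p q pq pq0 irr z small).
  have kN : k%:R * - x - (- z)%:~R = - (k%:R * x - z%:~R) by rewrite rmorphN /=; ring.
  have irrN (n : nat) (y : int) : (0 < n)%N -> n%:R * - x != y%:~R.
    by move=> n0; rewrite mulrN eqr_oppLR -rmorphN irr.
  have [n [y ny]] : exists n : nat, exists y : int, - q < n%:R * - x - y%:~R < - p.
    by apply: (IH _ _ _ _ _ irrN (- z)); rewrite ?kN ?normrN ?opprK; lra.
  by exists n, (- y); move: ny; rewrite rmorphN; lra.
have [n [m nm]] : exists n : nat, exists m : nat, p < n%:R * (k%:R * x - z%:~R) - m%:R < q.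
  by apply: multiples_reach; rewrite pos -(gtr0_norm pos).
exists (n * k)%N, (n%:Z * z + m%:Z).
by move: nm; rewrite natrM intrD intrM -!pmulrn opprD addrA mulrBr !mulrA.
Qed.

End Kronecker.

Section Ternary.
Variable R : realType.
Implicit Types s t : nat -> bool.

Definition ternary_term s (n : nat) : R := (s n)%:R / 3 ^+ n.
Definition ternary s : R := limn (series (ternary_term s)).

Lemma ternary_term_ge0 s n : 0 <= ternary_term s n.
Proof. by rewrite divr_ge0 ?exprn_ge0. Qed.

Lemma ternary_term_le s n : ternary_term s n <= geometric 1 3^-1 n.
Proof.
by rewrite /geometric /ternary_term /= mul1r exprVn ler_piMl ?invr_ge0 ?exprn_ge0 // lern1 leq_b1.
Qed.

Lemma cvg_geometric_third : (series (geometric 1 3^-1 : R ^nat) @ \oo --> (3 / 2 : R))%classic.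
Proof.
have -> : 3 / 2 = 1 * (1 - 3^-1)^-1 :> R by field.
by apply: cvg_geometric_series; rewrite ger0_norm ?invr_ge0 // invf_lt1 // ltr1n.
Qed.

Lemma ternary_cvg s : cvgn (series (ternary_term s)).
Proof.
apply: series_le_cvg (ternary_term_ge0 s) _ (ternary_term_le s) _ => [n|].
  by rewrite geometric_ge0 ?invr_ge0.
exact: cvgP cvg_geometric_third.
Qed.

Lemma ternary_itv s : 0 <= ternary s <= 3 / 2.
Proof.
apply/andP; split.
  apply: limr_ge; first exact: ternary_cvg.
  by apply: nearW => n; apply: sumr_ge0 => k _; apply: ternary_term_ge0.
rewrite -(cvg_lim _ cvg_geometric_third) //; apply: lim_series_le => [||n].
- exact: ternary_cvg.
- exact: cvgP cvg_geometric_third.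
- exact: ternary_term_le.
Qed.

Lemma ternary_rec s : ternary s = (s 0%N)%:R + ternary (fun n => s n.+1) / 3.
Proof.
apply: cvg_lim => //; rewrite -cvg_shiftS.
have -> : (fun n => series (ternary_term s) n.+1) =
    (fun n => (s 0%N)%:R + series (ternary_term (fun n => s n.+1)) n / 3).
  apply/funext => n; rewrite /series /= big_nat_recl // mulr_suml; congr (_ + _).
    by rewrite /ternary_term expr0 divr1.
  by apply: eq_bigr => k _; rewrite /ternary_term exprSr invfM mulrA.
by apply: cvgD; [apply: cvg_cst | apply: cvgM; [apply: ternary_cvg | apply: cvg_cst]].
Qed.

Lemma ternary_inj s t : ternary s = ternary t -> s = t.
Proof.
move=> E; apply/funext => n; elim: n s t E => [|n IHn] s t.
all: rewrite (ternary_rec s) (ternary_rec t).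
all: have := ternary_itv (fun n => s n.+1); have := ternary_itv (fun n => t n.+1).
  by case: (s 0%N); case: (t 0%N) => //=; lra.
move=> ? ? E; apply: (IHn (fun n => s n.+1) (fun n => t n.+1)).
by move: E; case: (s 0%N); case: (t 0%N) => /=; lra.
Qed.

End Ternary.

(** * Degrees *)

Definition chi : {poly int} := 'X^3 - 'X - 2%:P.

Definition coef_ge0 (q : {poly int}) : Prop := forall j, 0 <= q`_j.

Definition effective (f : {poly int}) : Prop := exists q r : {poly int},
  [/\ f = q * chi + r, coef_ge0 q, coef_ge0 r & (size r <= 3)%N].

Definition admissible (f : {poly int}) : Prop :=
  effective f /\ forall j, `|f`_j| <= 1.

Lemma effectiveD f g : effective f -> effective g -> effective (f + g).
Proof.
move=> [q [r [-> q0 r0 r3]]] [q' [r' [-> q'0 r'0 r'3]]].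
exists (q + q'), (r + r'); split.
- by rewrite mulrDl addrACA.
- by move=> j; rewrite coefD addr_ge0.
- by move=> j; rewrite coefD addr_ge0.
- by rewrite (leq_trans (size_polyD _ _)) // geq_max r3.
Qed.

Lemma effective_mul_chi q : coef_ge0 q -> effective (q * chi).
Proof.
by move=> q0; exists q, 0; rewrite addr0 size_poly0; split=> // j; rewrite coef0.
Qed.

Lemma coef_ge0Xn n : coef_ge0 'X^n.
Proof. by move=> j; rewrite coefXn. Qed.

Lemma effectiveXn n : effective 'X^n.
Proof.
elim/ltn_ind: n => n IHn; have [n3 | ] := leqP n 2.
  exists 0, 'X^n; rewrite mul0r add0r size_polyXn.
  by split=> //; [move=> j; rewrite coef0 | apply: coef_ge0Xn].
case: n IHn => [|[|[|n]]] // IHn _.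
have -> : 'X^(n.+3) = 'X^n * chi + 'X^(n.+1) + 'X^n + 'X^n :> {poly int}.
  rewrite /chi !exprS -[2]/(1 + 1) rmorphD; ring.
have [e0 e1] : effective 'X^n /\ effective 'X^(n.+1) by split; apply: IHn; lia.
have e := effective_mul_chi (coef_ge0Xn n).
exact: (effectiveD (effectiveD (effectiveD e e1) e0) e0).
Qed.

Section Evaluation.
Variables (A : comNzRingType) (z : A).
Implicit Types f g q r : {poly int}.

Definition ieval f : A := (map_poly intr f).[z].

Lemma ievalD f g : ieval (f + g) = ieval f + ieval g.
Proof. by rewrite /ieval rmorphD hornerD. Qed.

Lemma ieval0 : ieval 0 = 0.
Proof. by rewrite /ieval rmorph0 horner0. Qed.

Lemma ievalC c : ieval c%:P = c%:~R.
Proof. by rewrite /ieval map_polyC hornerC. Qed.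

Lemma ievalXn n : ieval 'X^n = z ^+ n.
Proof. by rewrite /ieval rmorphXn /= map_polyX hornerXn. Qed.

Lemma ieval_coef f n : (size f <= n)%N -> ieval f = \sum_(j < n) (f`_j)%:~R * z ^+ j.
Proof.
move=> fn; rewrite /ieval (horner_coef_wide _ (leq_trans (size_poly _ _) fn)).
by apply: eq_bigr => j _; rewrite coef_map.
Qed.

Lemma ieval_chi : ieval chi = z ^+ 3 - z - 2%:R.
Proof. by rewrite /ieval /chi !rmorphB /= map_polyXn map_polyX map_polyC /= !hornerE. Qed.

Hypothesis z_root : z ^+ 3 = z + 2%:R.

Lemma ieval_mul_chi q r : ieval (q * chi + r) = ieval r.
Proof.
rewrite ievalD {1}/ieval rmorphM hornerM -/(ieval chi) ieval_chi z_root (addrC z) addrK subrr.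
by rewrite mulr0 add0r.
Qed.

(* The coefficients of [q] and [r] as in the Euclidean division by X^3 - X - 2
   determine the tails of the values of [q * chi + r]. *)
Lemma ieval_tail q r N : (size r <= 3)%N -> let f := q * chi + r in
  ieval f = \sum_(j < N + 3) (f`_j)%:~R * z ^+ j +
    z ^+ (N + 3) * ((q`_N)%:~R + (q`_N.+1)%:~R * z + (q`_N.+2)%:~R * (z ^+ 2 - 1)).
Proof.
move=> r3 f; have fE j : f`_j =
    (if (j < 3)%N then 0 else q`_(j - 3)) - (if j == 0%N then 0 else q`_j.-1) - 2 * q`_j + r`_j.
  by rewrite coefD /chi !mulrDr !mulrN !coefB coefMXn coefMX coefMC mulrC.
elim: N => [|N IHN].
  rewrite ieval_mul_chi (ieval_coef r3) !big_ord_recr !big_ord0 /= !fE /=.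
  rewrite !rmorphD !rmorphN !rmorphM /= z_root; ring: z_root.
have rN : r`_(N.+3) = 0 by rewrite nth_default // (leq_trans r3).
rewrite IHN addSn big_ord_recr /= fE addnK !addn3 /= rN.
have -> : z ^+ N.+3 = z ^+ N * (z + 2%:R) by rewrite -z_root -exprD addn3.
have -> : z ^+ N.+4 = z ^+ N * (z * (z + 2%:R)) by rewrite -z_root -exprS -exprD addn4.
rewrite !rmorphD !rmorphN !rmorphM /=; ring: z_root.
Qed.

End Evaluation.

Lemma coef_ge0_ieval_ge0 (R : realDomainType) (x : R) (r : {poly int}) :
  0 <= x -> coef_ge0 r -> 0 <= ieval x r.
Proof.
move=> x0 r0; rewrite (ieval_coef x (leqnn _)); apply: sumr_ge0 => j _.
by rewrite mulr_ge0 ?exprn_ge0 // ler0z.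
Qed.

Lemma coef_ge0_ieval_eq0 (R : realDomainType) (x : R) (r : {poly int}) :
  0 < x -> coef_ge0 r -> ieval x r = 0 -> r = 0.
Proof.
move=> x0 r0; rewrite (ieval_coef x (leqnn _)) => /psumr_eq0P r_eq0.
have r0R j : 0 <= (r`_j)%:~R :> R by rewrite ler0z.
have xj_gt0 j : 0 < x ^+ j by rewrite exprn_gt0.
apply/polyP => j; rewrite coef0; have [jr | ] := ltnP j (size r); last exact: nth_default.
have /eqP := r_eq0 (fun j _ => mulr_ge0 (r0R j) (ltW (xj_gt0 j))) (Ordinal jr) isT.
by rewrite mulf_eq0 (gt_eqF (xj_gt0 _)) orbF intr_eq0 => /eqP.
Qed.

Lemma cubic_no_rational_root (x : rat) : x ^+ 3 != x + 2%:R.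
Proof.
apply/eqP => E; have := coprime_num_den x.
have {E} : numq x ^+ 3 = denq x * (denq x * numq x + 2 * denq x ^+ 2).
  apply: (@intr_inj rat); rewrite !(rmorphD, rmorphM, rmorphXn) /=.
  have dx : (denq x)%:~R != 0 :> rat by rewrite intr_eq0.
  have nx : (numq x)%:~R = x * (denq x)%:~R by rewrite -{2}(divq_num_den x) divfK.
  rewrite nx; ring: E.
move: (numq x) (denq x) (denq_gt0 x) => n d d_gt0 E cop.
have d1 : d = 1.
  have : (d %| n ^+ 3)%Z by rewrite E dvdz_mulr.
  rewrite -(mulr1 (n ^+ 3)) Gauss_dvdzr; last by rewrite coprimezXr // coprimez_sym.
  by rewrite dvdz1; lia.
have {E} : n * (n * n) = n + 2 by move: E; rewrite d1 !exprS; lia.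
have [n_ge2 | [n_le1 | n_mid]] : 2 <= n \/ n <= -2 \/ (n == -1) || (n == 0) || (n == 1) by lia.
- have : 4 <= n * n by nia.
  nia.
- have : 4 <= n * n by nia.
  nia.
- by move: n_mid => /orP[/orP[]|] /eqP ->.
Qed.

Lemma cubic_irrational (F : numFieldType) (x : F) (b c : int) :
  x ^+ 3 = x + 2%:R -> b%:~R = c%:~R * x -> b = 0 /\ c = 0.
Proof.
move=> x_root bcx; have [c0 | c0] := eqVneq c 0.
  by move: bcx; rewrite c0 mul0r => /eqP; rewrite intr_eq0 => /eqP.
have xE : x = ratr (b%:~R / c%:~R).
  by rewrite fmorph_div !rmorph_int bcx mulrC mulKf // intr_eq0.
case/eqP: (cubic_no_rational_root (b%:~R / c%:~R)).
by apply: (fmorph_inj (ratr : rat -> F)); rewrite rmorphXn rmorphD rmorph_nat /= -xE.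
Qed.

(** * Half-planes *)

Section HalfPlanes.
Local Open Scope complex_scope.
Variable R : realType.
Local Notation Re := (@complex.Re R).
Local Notation Im := (@complex.Im R).

Lemma chi_real_root : {x : R | 3 / 2 <= x <= 8 / 5 & x ^+ 3 = x + 2}.
Proof.
apply: sig2_eqW; pose p : {poly R} := map_poly intr chi.
have [||x x_itv px0] := @poly_ivt R p (3 / 2) (8 / 5); first by lra.
  by rewrite -/(ieval (3 / 2) chi) -/(ieval (8 / 5) chi) !ieval_chi; lra.
exists x => //; move: px0; rewrite /root -/(ieval x chi) ieval_chi => /eqP; lra.
Qed.

Definition lam : R := s2val chi_real_root.

Lemma lam_itv : 3 / 2 <= lam <= 8 / 5.
Proof. exact: (s2valP chi_real_root). Qed.

Lemma lam_root : lam ^+ 3 = lam + 2.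
Proof. exact: (s2valP' chi_real_root). Qed.

Lemma lam_gt0 : 0 < lam.
Proof. by have := lam_itv; lra. Qed.

(* Besides [lam], the roots of X^3 - X - 2 are those of X^2 + lam X + lam^2 - 1. *)
Definition mu : R[i] := (- lam / 2) +i* Num.sqrt (3 / 4 * lam ^+ 2 - 1).

Lemma Im_mu_gt0 : 0 < Im mu.
Proof. by rewrite /= sqrtr_gt0; have := lam_itv; nra. Qed.

Lemma Im_mu_sq : Im mu ^+ 2 = 3 / 4 * lam ^+ 2 - 1.
Proof. by rewrite /= sqr_sqrtr //; have := lam_itv; nra. Qed.

Lemma mu_quadratic : mu ^+ 2 = - (lam%:C * mu) - (lam%:C ^+ 2 - 1).
Proof.
have := Im_mu_sq; case E : mu => [a b] /= b2; have a2 : a = - lam / 2 by case: E.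
apply/eqP; rewrite eq_complex /=; simpc; rewrite /= -!expr2; apply/andP; split; apply/eqP.
  rewrite b2 a2; lra.
rewrite a2; lra.
Qed.

Lemma mu_root : mu ^+ 3 = mu + 2.
Proof.
have lamC_root : lam%:C ^+ 3 = lam%:C + 2 by rewrite -rmorphXn lam_root rmorphD rmorph_nat.
move: mu_quadratic => mu2; ring: mu2 lamC_root.
Qed.

Definition rho : R := normc mu.

Lemma rho_sq : rho ^+ 2 = lam ^+ 2 - 1.
Proof.
have := Im_mu_sq; rewrite /rho /normc; case E : mu => [a b] /= b2.
rewrite sqr_sqrtr ?addr_ge0 ?sqr_ge0 // b2.
have -> : a = - lam / 2 by case: E.
lra.
Qed.

Lemma rho_gt0 : 0 < rho.
Proof.
have : 0 <= rho by rewrite /rho /normc; case: mu => *; apply: sqrtr_ge0.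
by have := rho_sq; have := lam_itv; nra.
Qed.

Lemma rho_lt_lam : rho < lam.
Proof. by have := rho_gt0; have := rho_sq; have := lam_itv; nra. Qed.

Lemma normc_ge0 (z : R[i]) : 0 <= normc z.
Proof. by case: z => a b; apply: sqrtr_ge0. Qed.

Lemma Re_le_normc (z : R[i]) : Re z <= normc z.
Proof.
case: z => a b /=; apply: le_trans (ler_norm a) _.
by rewrite -sqrtr_sqr ler_wsqrtr // lerDl sqr_ge0.
Qed.

Lemma normc_int (c : int) : normc (c%:~R : R[i]) = `|c|%:~R.
Proof.
by rewrite -(rmorph_int (real_complex R)) /= expr0n addr0 sqrtr_sqr intr_norm.
Qed.

Lemma normcX (z : R[i]) n : normc (z ^+ n) = normc z ^+ n.
Proof. by elim: n => [|n IHn]; rewrite ?expr0 ?normc1 // !exprS normcM IHn. Qed.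

Lemma normc_sum (T : Type) (s : seq T) (F : T -> R[i]) :
  normc (\sum_(x <- s) F x) <= \sum_(x <- s) normc (F x).
Proof.
elim/big_rec2: _ => [|x r z _ le_z]; first by rewrite normc0.
by apply: le_trans (le_normcD _ _) _; rewrite lerD2l.
Qed.

Lemma Im_ieval_mu_eq0 (r : {poly int}) : (size r <= 3)%N -> Im (ieval mu r) = 0 ->
  exists c, r = c%:P.
Proof.
move=> r3; have muE (a b c : int) : a%:~R + b%:~R * mu + c%:~R * mu ^+ 2 =
    (a%:~R - c%:~R * (lam ^+ 2 - 1))%:C + (b%:~R - c%:~R * lam)%:C * mu.
  by rewrite mu_quadratic !(rmorphB, rmorphM, rmorphXn) /= !rmorph_int rmorph1; ring.
rewrite (ieval_coef mu r3) !big_ord_recr big_ord0 /= add0r expr0 mulr1 expr1 muE.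
have ImE (a b : R) (z : R[i]) : Im (a%:C + b%:C * z) = b * Im z.
  by case: z => x y; simpc.
rewrite ImE => /eqP; rewrite mulf_eq0 (gt_eqF Im_mu_gt0) orbF subr_eq0 => /eqP r12.
have [r1_0 r2_0] := cubic_irrational lam_root r12.
exists r`_0; apply/polyP => -[|[|[|j]]]; rewrite coefC //.
by rewrite nth_default // (leq_trans r3).
Qed.

Lemma exprn_small (x e : R) : 0 <= x < 1 -> 0 < e ->
  exists N, forall n, (N <= n)%N -> x ^+ n < e.
Proof.
move=> /andP[x0 x1] e0.
have : (x ^+ n @[n --> \oo] --> 0)%classic by apply: cvg_expr; rewrite ger0_norm.
move=> /cvgrPdist_lt/(_ e e0)[N _ HN]; exists N => n /HN.
by rewrite /= sub0r normrN ger0_norm // exprn_ge0.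
Qed.

Lemma head_bounds (f : {poly int}) n : (forall j, `|f`_j| <= 1) ->
  normc (\sum_(j < n) (f`_j)%:~R * mu ^+ j) <= \sum_(j < n) rho ^+ j /\
  - \sum_(j < n) lam ^+ j <= \sum_(j < n) (f`_j)%:~R * lam ^+ j.
Proof.
move=> f1; have f1R j : `|f`_j|%:~R <= 1 :> R by rewrite (ler_int _ _ 1).
split.
  apply: le_trans (normc_sum _ _) _; apply: ler_sum => j _.
  by rewrite normcM normcX normc_int ler_piMl // exprn_ge0 // ltW // rho_gt0.
rewrite -sumrN; apply: ler_sum => j _; rewrite -mulN1r ler_wpM2r //.
  by rewrite exprn_ge0 // ltW // lam_gt0.
by have := f1R j; rewrite intr_norm ler_norml => /andP[].
Qed.

Lemma tail_bounds (a b c : int) : 0 <= a -> 0 <= b -> 0 <= c ->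
  normc (a%:~R + b%:~R * mu + c%:~R * (mu ^+ 2 - 1)) <= 3 * (a + b + c)%:~R /\
  (a + b + c)%:~R <= a%:~R + b%:~R * lam + c%:~R * (lam ^+ 2 - 1).
Proof.
rewrite -!(ler0z R) !intrD => a0 b0 c0; split; last first.
  by rewrite !lerD // ler_peMr //; have := lam_itv; nra.
have rho3 : rho <= 3 by have := rho_lt_lam; have := lam_itv; lra.
have mu1 : normc (mu ^+ 2 - 1) <= 3.
  apply: le_trans (le_normcD _ _) _; rewrite normcN normc1 normcX -/rho rho_sq.
  by have := lam_itv; nra.
have normcz (d : int) (z : R[i]) : 0 <= d%:~R :> R -> normc z <= 3 ->
    normc (d%:~R * z) <= d%:~R * 3.
  by move=> d0 z3; rewrite normcM normc_int ger0_norm -?(ler0z R) // ler_wpM2l.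
rewrite (mulrC 3) !mulrDl -[a%:~R in X in X <= _]mulr1.
do 2 (apply: le_trans (le_normcD _ _) _; rewrite lerD ?normcz //).
by rewrite normc1 ler1n.
Qed.

(* As rho < lam, for large N the tail of the value at [mu] is small compared with
   the tail of the value at [lam]. *)
Lemma admissible_sublinear (e : R) : 0 < e ->
  exists C, forall f, admissible f -> normc (ieval mu f) <= C + e * ieval lam f.
Proof.
move=> e0; have [lam0 rho0] := (lam_gt0, rho_gt0).
have [N rho_small] : exists N, 3 * rho ^+ (N + 3) <= e * lam ^+ (N + 3).
  have [||N HN] := @exprn_small (rho / lam) (e / 3).
  - by rewrite divr_ge0 ?ltW //= ltr_pdivrMr // mul1r rho_lt_lam.
  - by lra.
  exists N; have := HN _ (leq_addr 3 N).
  by rewrite expr_div_n ltr_pdivrMr ?exprn_gt0 //; lra.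
exists (\sum_(j < N + 3) rho ^+ j + e * \sum_(j < N + 3) lam ^+ j).
move=> f [[q [r [-> q0 r0 r3]]] /(head_bounds (N + 3))[head_mu head_lam]].
rewrite (ieval_tail mu_root q N r3) (ieval_tail lam_root q N r3).
set hmu := \sum_(j < _) _ * mu ^+ j in head_mu *.
set hlam := \sum_(j < _) _ * lam ^+ j in head_lam *.
have [tail_mu tail_lam] := tail_bounds (q0 N) (q0 N.+1) (q0 N.+2).
set s : R := (_ + _)%:~R in tail_mu tail_lam.
have s0 : 0 <= s by rewrite ler0z !addr_ge0.
apply: le_trans (le_normcD _ _) _; rewrite normcM normcX -/rho.
have le_mu : rho ^+ (N + 3) * (3 * s) <= e * (lam ^+ (N + 3) * s).
  by rewrite mulrA mulrA (mulrC _ 3) ler_wpM2r.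
have := ler_wpM2l (exprn_ge0 (N + 3) (ltW rho0)) tail_mu.
have := ler_wpM2l (ltW e0) (ler_wpM2l (exprn_ge0 (N + 3) (ltW lam0)) tail_lam).
have := ler_wpM2l (ltW e0) head_lam; lra.
Qed.

Definition degree (f : {poly int}) : R * R[i] := (ieval lam f, ieval mu f).

Definition admissible_degree (d : R * R[i]) : Prop :=
  exists2 f, admissible f & d = degree f.

Lemma degreeD f g : degree (f + g) = degree f + degree g.
Proof. by rewrite /degree !ievalD. Qed.

Lemma degree_mul_chi q f : degree (q * chi + f) = degree f.
Proof. by rewrite /degree (ieval_mul_chi lam_root) (ieval_mul_chi mu_root). Qed.

Lemma degreeXn n : degree 'X^n = (lam ^+ n, mu ^+ n).
Proof. by rewrite /degree !ievalXn. Qed.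

Lemma degreeXn_neq0 n : degree 'X^n != 0.
Proof. by rewrite degreeXn; apply/eqP => -[/eqP]; rewrite expf_eq0 gt_eqF ?lam_gt0 ?andbF. Qed.

Lemma effective_degree_ge0 f : effective f -> 0 <= (degree f).1.
Proof.
move=> [q [r [-> _ r0 _]]]; rewrite degree_mul_chi.
by apply: coef_ge0_ieval_ge0 r0; rewrite ltW ?lam_gt0.
Qed.

Lemma effective_degree_eq0 f : effective f -> (degree f).1 = 0 -> degree f = 0.
Proof.
move=> [q [r [-> _ r0 _]]]; rewrite degree_mul_chi => /= /coef_ge0_ieval_eq0 -> //.
  by rewrite /degree !ieval0.
exact: lam_gt0.
Qed.

Lemma effective_degreeD_eq0 f g : effective f -> effective g ->
  degree (f + g) = 0 -> degree f = 0 /\ degree g = 0.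
Proof.
move=> ef eg; rewrite degreeD => /(f_equal fst)/eqP /=.
have [f0 g0] := (effective_degree_ge0 ef, effective_degree_ge0 eg).
by rewrite paddr_eq0 // => /andP[/eqP ? /eqP ?]; split; apply: effective_degree_eq0.
Qed.

Lemma admissible_degree_eq0 d : admissible_degree d -> d.2 = 0 -> d = 0.
Proof.
move=> [_ [[q [r [-> _ _ r3]]] _] ->]; rewrite degree_mul_chi /= => mu0.
have [|c rE] := Im_ieval_mu_eq0 r3; first by rewrite mu0.
move: mu0; rewrite rE /degree !ievalC => c0; congr (_, _) => //.
by apply/eqP; rewrite intr_eq0 -(intr_eq0 R[i]) c0.
Qed.

Lemma Im_muXn_neq0 n : (0 < n)%N -> Im (mu ^+ n) != 0.
Proof.
move=> n0; apply/eqP => Im0; have [q [r [XnE _ _ r3]]] := effectiveXn n.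
have muE : mu ^+ n = ieval mu r by rewrite -ievalXn XnE ieval_mul_chi // mu_root.
have lamE : lam ^+ n = ieval lam r by rewrite -ievalXn XnE ieval_mul_chi // lam_root.
have [|c rE] := Im_ieval_mu_eq0 r3; first by rewrite -muE.
rewrite rE !ievalC in muE lamE.
have : rho ^+ n = lam ^+ n.
  rewrite -normcX muE normc_int intr_norm -lamE ger0_norm // exprn_ge0 // ltW //.
  exact: lam_gt0.
by apply/eqP; rewrite lt_eqF // ltrXn2r ?rho_lt_lam ?nnegrE ?ltW ?rho_gt0 ?lam_gt0 -?lt0n.
Qed.

Definition half_plane (w z : R[i]) : bool :=
  (0 < Re (z * w^*)) || (Re (z * w^*) == 0) && (0 < Im (z * w^*)).

Lemma half_plane0 w : half_plane w 0 = false.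
Proof. by rewrite /half_plane mul0r ltxx eqxx. Qed.

Lemma half_planeD w b z1 z2 :
  half_plane w z1 = b -> half_plane w z2 = b -> half_plane w (z1 + z2) = b.
Proof.
rewrite /half_plane mulrDl; case: (z1 * _) => x1 y1; case: (z2 * _) => x2 y2 /=.
by case: b; (case: (ltrgt0P x1) => x1_0; case: (ltrgt0P x2) => x2_0 //= Hy1 Hy2;
  case: (ltrgt0P (x1 + x2)) => //= ?); lra.
Qed.

Lemma half_planeN w z : w != 0 -> z != 0 -> half_plane w (- z) = ~~ half_plane w z.
Proof.
move=> w0 z0; rewrite /half_plane mulNr.
have: z * w^* != 0 by rewrite mulf_neq0 // conjc_eq0.
case: (z * _) => x y; rewrite eq_complex /= oppr_gt0 oppr_eq0 oppr_gt0.
by case: (ltrgt0P x) => //= _; case: (ltrgt0P y).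
Qed.

Lemma normc_conj (z : R[i]) : normc z^* = normc z.
Proof. by case: z => x y /=; rewrite sqrrN. Qed.

Lemma finite_upper_bound (T : eqType) (L : seq T) (F : T -> R) :
  exists2 M, 0 < M & forall x, x \in L -> F x <= M.
Proof.
elim: L => [|x L [M M0 HM]]; first by exists 1.
exists (Num.max M (F x)); first by rewrite lt_max M0.
by move=> y; rewrite inE => /predU1P[-> | /HM My]; rewrite le_max ?lexx ?My ?orbT.
Qed.

Lemma half_plane_linearize w (L : seq R[i]) :
  (forall z, z \in L -> half_plane w z) -> exists w', forall z, z \in L -> 0 < Re (z * w'^*).
Proof.
move=> Lw; have [M M0 HM] := finite_upper_bound L (fun z => - Im (z * w^*) / Re (z * w^*)).
exists (w * ((M + 1) +i* 1)) => z zL; rewrite rmorphM mulrA.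
have := HM z zL; have := Lw z zL; rewrite /half_plane.
case: (z * _) => x y /= /orP[x0 | /andP[/eqP -> y0] _]; last by rewrite mul0r; lra.
by rewrite ler_pdivrMr //; lra.
Qed.

Lemma sum_le_size (G : zmodType) (F : G -> R) M (s : seq G) :
    {morph F : x y / x - y} -> (forall x, x \in s -> F x <= M) ->
  F (\sum_(x <- s) x) <= M * (size s)%:R.
Proof.
move=> FB; have F0 : F 0 = 0 by rewrite -(subrr 0) FB subrr.
have FD x y : F (x + y) = F x + F y by rewrite -{1}(opprK y) FB -(sub0r y) FB F0 sub0r opprK.
elim: s => [|x s IHs] Fs; first by rewrite big_nil mulr0 F0.
rewrite big_cons FD -natr1 mulrDr mulr1 addrC lerD ?Fs ?mem_head //.
by apply: IHs => y ys; apply: Fs; rewrite inE ys orbT.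
Qed.

(* Sums of many elements of [L] are far away in the direction [w], while by
   sublinearity the second component of an admissible degree is small compared
   with the first, which is at most linear in the number of summands. *)
Lemma escaping_of_linear (Q : pred (R * R[i])) :
    (forall L : seq (R * R[i]),
       (forall d, d \in L -> [/\ admissible_degree d, d != 0 & Q d]) ->
       exists w, forall d, d \in L -> 0 < Re (d.2 * w^*)) ->
  escaping admissible_degree Q.
Proof.
move=> Qlin L LQ; have [w Lw] := Qlin L LQ.
have [M M0 HM] := finite_upper_bound L fst.
have [B B0 HB] := finite_upper_bound L (fun d => (Re (d.2 * w^*))^-1).
pose W := normc w + 1; have W0 : 0 < W by have := normc_ge0 w; rewrite /W; lra.
pose e := (2 * W * M * B)^-1; have e0 : 0 < e by rewrite invr_gt0 !mulr_gt0.
have [C HC] := admissible_sublinear e0.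
exists (Num.bound (2 * W * `|C| * B)) => s sL Ns [f fA sf].
have sum_fst : (\sum_(d <- s) d).1 <= M * (size s)%:R.
  by apply: sum_le_size => // d /sL/HM.
have sum_Re : - Re ((\sum_(d <- s) d).2 * w^*) <= - B^-1 * (size s)%:R.
  apply: (sum_le_size (F := fun d => - Re (d.2 * w^*))) => [d d' | d /sL dL].
    by rewrite mulrBl raddfB opprB opprK addrC.
  by rewrite lerN2 -[leRHS]invrK lef_pV2 ?posrE ?invr_gt0 ?Lw ?HB.
rewrite sf /= mulNr lerN2 ler_pdivrMl // in sum_fst sum_Re.
have Re_le : Re (ieval mu f * w^*) <= W * normc (ieval mu f).
  apply: le_trans (Re_le_normc _) _; rewrite normcM normc_conj mulrC ler_wpM2r ?normc_ge0 //.
  by rewrite lerDl.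
have : (size s)%:R <= B * (W * (C + e * (M * (size s)%:R))).
  apply: le_trans sum_Re _; rewrite ler_pM2l //; apply: le_trans Re_le _.
  by rewrite ler_pM2l //; apply: le_trans (HC f fA) _; rewrite lerD2l ler_pM2l.
have -> : B * (W * (C + e * (M * (size s)%:R))) = B * W * C + (size s)%:R / 2.
  by rewrite /e; field; rewrite ?gt_eqF.
have : 2 * W * `|C| * B < (size s)%:R.
  by apply: lt_le_trans (archi_boundP _) _; rewrite ?ler_nat // !mulr_ge0 // ltW.
have : B * W * C <= B * W * `|C| by rewrite ler_wpM2l ?ler_norm // mulr_ge0 // ltW.
lra.
Qed.

Theorem half_plane_half_space w : w != 0 ->
  half_space admissible_degree (fun d => half_plane w d.2).
Proof.
move=> w0; split.
- by rewrite half_plane0.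
- by move=> b d e; apply: half_planeD.
- apply: escaping_of_linear => L LQ.
  have [|w' Hw'] := @half_plane_linearize w (map snd L).
    by move=> _ /mapP[d /LQ[_ _ dQ] ->].
  by exists w' => d dL; apply/Hw'/map_f.
- apply: escaping_of_linear => L LQ.
  have [|w' Hw'] := @half_plane_linearize w (map (fun d => - d.2) L).
    move=> _ /mapP[d /LQ[dA d0 dQ] ->]; rewrite half_planeN //.
    by apply: contra d0 => /eqP/(admissible_degree_eq0 dA) ->.
  exists (- w') => d dL; rewrite rmorphN mulrN -mulNr.
  exact/Hw'/(map_f (fun d => - d.2)).
Qed.

Definition expi (x : R) : R[i] := cos x +i* sin x.

Lemma expiD x y : expi (x + y) = expi x * expi y.
Proof. by rewrite /expi cosD sinD; simpc; congr (_ +i* _); rewrite addrC. Qed.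

Lemma expi_neq0 x : expi x != 0.
Proof.
apply/eqP => -[c0 s0]; have := cos2Dsin2 x; rewrite c0 s0 expr0n addr0.
by move/esym/eqP; rewrite oner_eq0.
Qed.

Lemma Re_expiM_conj x y : Re (expi x * (expi y)^*) = cos (x - y).
Proof. by rewrite cosB /= mulrN opprK. Qed.

Lemma expi_int_period x (z : int) : expi (x + z%:~R * (pi *+ 2)) = expi x.
Proof.
have nat_period n y : expi (y + n%:R * (pi *+ 2)) = expi y.
  by rewrite mulr_natl /expi (periodicn (@cosD2pi R)) (periodicn (@sinD2pi R)).
case: z => n; first exact: nat_period.
by rewrite NegzE mulrNz mulNr -[in RHS](subrK (n.+1%:R * (pi *+ 2)) x) nat_period.
Qed.

Definition arg_mu : R := acos (Re mu / rho).

Lemma mu_polar : mu = rho%:C * expi arg_mu.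
Proof.
have rho0 := rho_gt0; have Im0 := Im_mu_gt0.
have sq : Re mu ^+ 2 + Im mu ^+ 2 = rho ^+ 2.
  by rewrite Im_mu_sq rho_sq /= ; lra.
have cos_itv : -1 <= Re mu / rho <= 1.
  by rewrite ler_pdivlMr // ler_pdivrMr //; apply/andP; split; nra.
have sqrtE : Num.sqrt (1 - (Re mu / rho) ^+ 2) = Im mu / rho.
  rewrite -[RHS](@ger0_norm R) ?divr_ge0 ?ltW // -sqrtr_sqr; congr Num.sqrt.
  have -> : (Im mu / rho) ^+ 2 = (rho ^+ 2 - Re mu ^+ 2) / rho ^+ 2.
    by rewrite expr_div_n; congr (_ / _); lra.
  by field; rewrite gt_eqF.
rewrite /expi /arg_mu acosK ?in_itv //= sin_acos // sqrtE.
suff scaleE (z : R[i]) : z = rho%:C * ((Re z / rho) +i* (Im z / rho)) by apply: scaleE.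
by case: z => a b; simpc; rewrite /= !(mulrC rho) !divfK // gt_eqF.
Qed.

Lemma muXn_polar n : mu ^+ n = (rho ^+ n)%:C * expi (n%:R * arg_mu).
Proof.
rewrite {1}mu_polar exprMn -rmorphXn; congr (_ * _).
elim: n => [|n IHn]; first by rewrite /expi mul0r cos0 sin0.
by rewrite exprS IHn -expiD -natr1 mulrDl mul1r addrC.
Qed.

Lemma arg_mu_irrational n (z : int) : (0 < n)%N -> n%:R * (arg_mu / (pi *+ 2)) != z%:~R.
Proof.
move=> n0; apply: contra (Im_muXn_neq0 n0) => /eqP E.
have arg_muE : n%:R * arg_mu = 0 + z%:~R * (pi *+ 2).
  by rewrite add0r -E -mulrA divfK // mulrn_eq0 /= gt_eqF // pi_gt0.
by rewrite muXn_polar arg_muE expi_int_period /expi cos0 sin0; simpc.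
Qed.

Definition direction_cone (s : nat -> bool) (d : R * R[i]) : bool :=
  half_plane (expi (ternary R s)) d.2.

Lemma direction_cone_half_space s : half_space admissible_degree (direction_cone s).
Proof. exact: half_plane_half_space (expi_neq0 _). Qed.

Lemma ReMl (a : R) (z : R[i]) : Re (a%:C * z) = a * Re z.
Proof. by case: z => x y; simpc. Qed.

Lemma half_plane_muXn psi n (z : int) : let th := n%:R * arg_mu - z%:~R * (pi *+ 2) - psi in
  (0 < cos th -> half_plane (expi psi) (mu ^+ n)) /\
  (cos th < 0 -> ~~ half_plane (expi psi) (mu ^+ n)).
Proof.
move=> th; rewrite /half_plane; have -> : Re (mu ^+ n * (expi psi)^*) = rho ^+ n * cos th.
  rewrite muXn_polar -(expi_int_period _ (- z)) -mulrA.
  have -> : n%:R * arg_mu + (- z)%:~R * (pi *+ 2) = th + psi by rewrite /th rmorphN; ring.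
  rewrite -[in RHS](addrK psi th) -Re_expiM_conj.
  by rewrite ReMl.
have rho_n : 0 < rho ^+ n by rewrite exprn_gt0 // rho_gt0.
split=> cos_th; first by rewrite pmulr_rgt0 // cos_th.
by rewrite pmulr_rgt0 // mulf_eq0 (gt_eqF rho_n) (lt_eqF cos_th) /= orbF -leNgt ltW.
Qed.

Lemma direction_cone_separated s t : s <> t ->
  exists n, direction_cone s (degree 'X^n) != direction_cone t (degree 'X^n).
Proof.
wlog lt_st : s t / ternary R s < ternary R t.
  move=> IH st; case: (ltrgtP (ternary R s) (ternary R t)) => [lt | lt | /ternary_inj //].
    exact: IH lt st.
  by have [n] := IH t s lt (nesym st); exists n; rewrite eq_sym.
move=> _; have pi0 := pi_gt0 R; have T0 : 0 < pi *+ 2 :> R by rewrite pmulrn_lgt0.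
pose p := (pi / 2 + ternary R s) / (pi *+ 2); pose q := (pi / 2 + ternary R t) / (pi *+ 2).
have [|n [z]] := multiples_dense_mod1 arg_mu_irrational (p := p) (q := q).
  by rewrite ltr_pM2r ?invr_gt0 //; lra.
rewrite ltr_pdivrMr // ltr_pdivlMr // mulrBl -mulrA divfK ?gt_eqF // => psi_itv.
pose th psi := n%:R * arg_mu - z%:~R * (pi *+ 2) - psi.
have [s_itv t_itv pi2] := And3 (ternary_itv R s) (ternary_itv R t) (pi_ge2 R).
have cos_s : cos (th (ternary R s)) < 0.
  rewrite -[th _](subrK pi) cosDpi oppr_lt0 cos_gt0_pihalf // /th; lra.
have cos_t : 0 < cos (th (ternary R t)) by rewrite cos_gt0_pihalf // /th; lra.
exists n; rewrite degreeXn /direction_cone /=.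
have [_ /(_ cos_s)/negbTE ->] := half_plane_muXn (ternary R s) n z.
by have [/(_ cos_t) -> _] := half_plane_muXn (ternary R t) n z.
Qed.

End HalfPlanes.

(** * Monomials *)

Lemma sum_neq0 (V : nmodType) (T : eqType) (s : seq T) (P : pred T) (F : T -> V) :
  \sum_(x <- s | P x) F x != 0 -> exists x, [/\ x \in s, P x & F x != 0].
Proof.
move=> sum0.
have [/hasP[x xs /andP[Px Fx]] | /hasPn F0] := boolP (has (fun x => P x && (F x != 0)) s).
  by exists x.
case/eqP: sum0; rewrite big_seq_cond big1 // => x /andP[xs Px].
by apply/eqP; have := F0 x xs; rewrite /= Px /= negbK.
Qed.

Lemma sorted_ltn_uniq s : sorted ltn s -> uniq s.
Proof. exact: (sorted_uniq ltn_trans ltnn). Qed.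

Lemma sorted_ltn_eq s t : sorted ltn s -> sorted ltn t -> s =i t -> s = t.
Proof. exact: (irr_sorted_eq ltn_trans ltnn). Qed.

Lemma sort_leq_sorted_ltn s : uniq s -> sorted ltn (sort leq s).
Proof. by move=> us; rewrite ltn_sorted_uniq_leq sort_uniq us (sort_sorted leq_total). Qed.

Lemma sorted_ltn_sort s : sorted ltn s -> sort leq s = s.
Proof.
by move=> ss; apply: sorted_sort; [exact: leq_trans | apply: sub_sorted ss => x y /ltnW].
Qed.

Lemma leq_maxl_mem (s : seq nat) x : x \in s -> (x <= maxl s)%N.
Proof.
elim: s => //= y s IHs; rewrite inE => /predU1P[-> | /IHs xs]; first exact: leq_maxl.
exact: leq_trans xs (leq_maxr _ _).
Qed.

Section Signs.
Variable K : fieldType.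

Lemma sgnD m n : sgn K (m + n) = sgn K m * sgn K n.
Proof. exact: exprD. Qed.

Lemma sgn_odd n : sgn K n = if odd n then -1 else 1.
Proof. by rewrite /sgn -signr_odd; case: odd; rewrite ?expr1. Qed.

Lemma inv_cons x a b : inv (x :: a) b = (count (fun y => y < x) b + inv a b)%N.
Proof. by rewrite /inv big_cons. Qed.

Lemma inv_sym (a b : seq nat) : uniq (a ++ b) -> (inv a b + inv b a = size a * size b)%N.
Proof.
elim: a => [|x a IHa] /=.
  rewrite /inv big_nil mul0n add0n; elim: b => [|y b]; first by rewrite big_nil.
  by rewrite big_cons add0n => IHb /andP[_ /IHb].
case/andP=> xab /IHa {}IHa; rewrite inv_cons mulSn -IHa.
have -> : inv b (x :: a) = (count (fun y => x < y) b + inv b a)%N.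
  elim: b {xab IHa} => [|y b IHb]; first by rewrite /inv !big_nil.
  by rewrite !inv_cons IHb /=; lia.
rewrite addnACA; congr (_ + _)%N.
move: xab; rewrite mem_cat negb_or => /andP[_].
elim: b {IHa} => //= y b IHb; rewrite inE negb_or => /andP[xy /IHb].
by case: ltngtP xy; lia.
Qed.

Lemma pcoef_neq0 (a b t : seq nat) : pcoef K a b t != 0 -> sorted ltn t /\ perm_eq t (a ++ b).
Proof. by rewrite /pcoef; case: andP => // _; rewrite eqxx. Qed.

Lemma pcoef_sym (a b t : seq nat) : ~~ odd (size a) -> pcoef K a b t = pcoef K b a t.
Proof.
move=> ea; rewrite /pcoef perm_sym perm_catC perm_sym; case: andP => // -[st pt].
have u : uniq (b ++ a) by rewrite -(perm_uniq pt) sorted_ltn_uniq.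
rewrite !sgn_odd; have : odd (inv b a + inv a b) = false.
  by rewrite inv_sym // oddM (negbTE ea) andbF.
by rewrite oddD; case: odd; case: odd.
Qed.

End Signs.

Definition dual_letters (z1 z2 : nat) : bool := (z1./2 == z2./2) && (z1 != z2).

Definition contracted (p q t : seq nat) : Prop := exists z1 z2,
  [/\ dual_letters z1 z2, z1 \in p, z2 \in q, sorted ltn t & perm_eq t (rem z1 p ++ rem z2 q)].

Lemma contracted_neq_nil p q t : contracted p q t -> p != [::] /\ q != [::].
Proof. by move=> [z1 [z2 [_ z1p z2q _ _]]]; split; [case: p z1p | case: q z2q]. Qed.

Lemma contracted_diag (p t : seq nat) : odd (size p) -> ~ contracted p p t.
Proof.
move=> op [z1 [z2 [/andP[_ z12] z1p z2p st pt]]].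
have p_perm := perm_to_rem z1p.
have z2r : z2 \in rem z1 p.
  by move: z2p; rewrite (perm_mem p_perm) inE eq_sym (negbTE z12).
have r_perm := perm_to_rem z2r.
case E: (rem z2 (rem z1 p)) r_perm => [|w s] r_perm.
  by move: op; rewrite (perm_size p_perm) /= (perm_size r_perm).
have w1 : w \in rem z1 p by rewrite (perm_mem r_perm) !inE eqxx orbT.
have w2 : w \in rem z2 p.
  have : perm_eq (z2 :: rem z2 p) (z2 :: z1 :: w :: s).
    rewrite -(permPl (perm_to_rem z2p)) (permPl p_perm) perm_sym.
    by rewrite (perm_catCA [:: z2] [:: z1]) /= perm_cons perm_sym.
  by rewrite perm_cons => /perm_mem ->; rewrite !inE eqxx orbT.
have := sorted_ltn_uniq st; rewrite (perm_uniq pt) cat_uniq => /and3P[_ /hasPn/(_ w w2)].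
by rewrite /= w1.
Qed.

Section Brackets.
Variable K : fieldType.
Implicit Types (p q t : seq nat).

Lemma dterm_neq0 z1 z2 p q t : dterm K z1 z2 p q t != 0 ->
  [/\ z1 \in p, z2 \in q, sorted ltn t & perm_eq t (rem z1 p ++ rem z2 q)].
Proof.
rewrite /dterm; case: andP => [[zp zq]|]; last by rewrite eqxx.
by rewrite mulf_eq0 negb_or => /andP[_ /pcoef_neq0[]].
Qed.

Lemma mbr_neq0 p q t : mbr K p q t != 0 -> contracted p q t.
Proof.
rewrite /mbr mulf_eq0 negb_or => /andP[_ /sum_neq0[j [_ _ dterms]]].
have : (dterm K (2 * j).+1 (2 * j) p q t != 0) || (dterm K (2 * j) (2 * j).+1 p q t != 0).
  by apply: contraNT dterms; rewrite negb_or !negbK => /andP[/eqP -> /eqP ->]; rewrite addr0.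
by case/orP => /dterm_neq0[z1p z2q st pt]; do 2 eexists; split; try eassumption;
  rewrite /dual_letters; lia.
Qed.

Lemma mbr_widen B p q t : (maxl p < B)%N -> mbr K p q t = - sgn K (size p) *
  \sum_(j <- iota 0 B)
    (dterm K (2 * j).+1 (2 * j) p q t + dterm K (2 * j) (2 * j).+1 p q t).
Proof.
move=> /subnKC <-; rewrite /mbr iotaD big_cat /=.
rewrite [X in _ = _ * (_ + X)]big_seq [X in _ + X]big1 ?addr0 // => j.
rewrite mem_iota add0n => /andP[pj _].
have notin_p z : (j <= z)%N -> (z \in p) = false.
  by move=> jz; apply/negP => /leq_maxl_mem; lia.
by rewrite /dterm !notin_p ?addr0 //; lia.
Qed.

Lemma mbr_sym p q t : odd (size p) -> odd (size q) -> mbr K p q t = mbr K q p t.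
Proof.
move=> op oq; have dterm_sym z1 z2 : dterm K z1 z2 p q t = dterm K z2 z1 q p t.
  rewrite /dterm andbC; case: andP => // -[zq zp]; rewrite (mulrC (sgn _ _)).
  by rewrite pcoef_sym // size_rem //; case: (size p) op => //= ? ->.
rewrite !(@mbr_widen (maxl p + maxl q).+1) ?ltnS ?leq_addr ?leq_addl // !sgn_odd op oq.
by congr (_ * _); apply: eq_bigr => j _; rewrite addrC !dterm_sym.
Qed.

Lemma mem_subs p t : (p \in subs t) = subseq p t.
Proof.
elim: t p => [|x t IHt] p /=; first by rewrite inE.
rewrite mem_cat IHt; apply/orP/idP => [[/mapP[q qs ->] | pt] | ].
- by rewrite /= eqxx -IHt.
- exact: subseq_trans pt (subseq_cons _ _).
- case: p => [|y p]; first by right; rewrite sub0seq.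
  by case: eqP => [-> pt | _ pt]; [left; rewrite map_f // IHt | right].
Qed.

Lemma candHP t pq : reflect
  (exists j z1 z2 p, [/\ (j <= maxl t)%N,
    (z1, z2) \in [:: ((2 * j).+1, (2 * j)%N); ((2 * j)%N, (2 * j).+1)], subseq p t &
    pq = (sort leq (z1 :: p), sort leq (z2 :: [seq y <- t | y \notin p]))])
  (pq \in candH t).
Proof.
rewrite /candH mem_undup; apply: (iffP flatten_mapP) => [[j jt] | [j [z1 [z2 [p [jt zz pt ->]]]]]].
  move=> /flatten_mapP[zz zzj /mapP[p]]; rewrite mem_subs => pt ->.
  by exists j, zz.1, zz.2, p; rewrite -surjective_pairing; rewrite mem_iota ltnS in jt.
exists j; first by rewrite mem_iota ltnS.
by apply/flatten_mapP; exists (z1, z2) => //; apply/mapP; exists p; rewrite ?mem_subs.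
Qed.

Definition swap (pq : seq nat * seq nat) := (pq.2, pq.1).

Lemma candH_swap t : sorted ltn t -> perm_eq (map swap (candH t)) (candH t).
Proof.
move=> st; have swapK : involutive swap by case.
have swap_candH pq : pq \in candH t -> swap pq \in candH t.
  move=> /candHP[j [z1 [z2 [p [jt zz pt ->]]]]]; apply/candHP.
  exists j, z2, z1, [seq y <- t | y \notin p]; split=> //.
  - by move: zz; rewrite !inE !xpair_eqE; lia.
  - exact: filter_subseq.
  rewrite /swap /=; congr (_, sort leq (z1 :: _)).
  rewrite [LHS](subseq_uniqP (sorted_ltn_uniq st) pt); apply: eq_in_filter => y yt.
  by rewrite mem_filter yt andbT negbK.
apply: uniq_perm; rewrite ?(map_inj_uniq (inv_inj swapK)) ?undup_uniq // => pq.
apply/mapP/idP => [[pq' ? ->] | ?]; first exact: swap_candH.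
by exists (swap pq); rewrite ?swapK ?swap_candH.
Qed.

Lemma lexlt_total p q : (lexlt p q + lexlt q p + (p == q) = 1)%N.
Proof.
elim: p q => [|x p IHp] [|y q] //=; rewrite eqseq_cons.
by have := IHp q; case: (ltngtP x y) => //= [xy|xy|->] _.
Qed.

End Brackets.

Lemma blkS i k : blk i k.+1 = i :: i.+1 :: blk (i + 3) k.
Proof.
rewrite /blk /= muln0 addn0 addn1 (iotaDl 1 0 k) -map_comp; congr [:: _, _ & flatten _].
by apply: eq_map => n /=; congr [:: _; _]; lia.
Qed.

Lemma blk_sorted i k : sorted ltn (blk i k).
Proof.
elim: k i => [|k IHk] i //; rewrite blkS /= ltnSn /=.
have /= := IHk (i + 3)%N; case: k {IHk} => // k; rewrite blkS /= => ->.
by rewrite andbT; lia.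
Qed.

Lemma size_blk i k : size (blk i k) = (2 * k)%N.
Proof. by elim: k i => // k IHk i; rewrite blkS /= IHk; lia. Qed.

(* The degree of x_i x_{i+1} x_{i+3} ... d_{i+3k} is that of d_i. *)
Lemma blk_weight i k : 'X^(i + 3 * k) - \sum_(j <- blk i k) 'X^j =
  (\sum_(l < k) 'X^(i + 3 * l)) * chi + 'X^i :> {poly int}.
Proof.
elim: k i => [|k IHk] i; first by rewrite big_nil big_ord0 muln0 addn0 subr0 mul0r add0r.
rewrite blkS !big_cons big_ord_recl muln0 addn0 mulrDl.
have -> : (i + 3 * k.+1 = i + 3 + 3 * k)%N by lia.
have -> : \sum_(l < k) 'X^(i + 3 * lift ord0 l) = \sum_(l < k) 'X^(i + 3 + 3 * l) :> {poly int}.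
  by apply: eq_bigr => l _; congr 'X^_; rewrite /= /bump; lia.
have := IHk (i + 3)%N; set S := \sum_(j <- _) _; set S' := \sum_(l < k) _ => IH.
have regroup (a b c d : {poly int}) : a - (b + (c + d)) = a - d - b - c by ring.
rewrite regroup IH.
rewrite /chi exprD !exprS -[2]/(1 + 1) rmorphD; ring.
Qed.

Lemma effective_blk_weight i k : effective ('X^(i + 3 * k) - \sum_(j <- blk i k) 'X^j).
Proof.
rewrite blk_weight; apply: effectiveD (effectiveXn i); apply: effective_mul_chi => j.
by rewrite coef_sum; apply: sumr_ge0 => l _; apply: coef_ge0Xn.
Qed.

Definition letter_weight (z : nat) : {poly int} := if odd z then 'X^(z./2) else - 'X^(z./2).
Definition weight (t : seq nat) : {poly int} := \sum_(z <- t) letter_weight z.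

Lemma weight_nil : weight [::] = 0.
Proof. exact: big_nil. Qed.

Lemma weight_perm s t : perm_eq s t -> weight s = weight t.
Proof. exact: perm_big. Qed.

Lemma weight_cat s t : weight (s ++ t) = weight s + weight t.
Proof. exact: big_cat. Qed.

Lemma weight_rem z s : z \in s -> weight (rem z s) = weight s - letter_weight z.
Proof. by move=> /perm_to_rem/weight_perm ->; rewrite /weight big_cons addrC addKr. Qed.

Lemma letter_weight_dual z1 z2 : dual_letters z1 z2 -> letter_weight z1 + letter_weight z2 = 0.
Proof.
case/andP => /eqP h12 z12; rewrite /letter_weight h12.
have : odd z1 != odd z2 by lia.
by case: odd; case: odd => //; rewrite ?subrr ?addNr.
Qed.

Lemma weight_coef t j :
  (weight t)`_j = (count_mem (2 * j).+1 t)%:Z - (count_mem (2 * j)%N t)%:Z.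
Proof.
elim: t => [|z t IHt]; first by rewrite weight_nil coef0.
rewrite /weight big_cons coefD -/(weight t) IHt /= !PoszD opprD addrACA; congr (_ + _).
rewrite /letter_weight; case: (boolP (odd z)) => oz; rewrite ?coefN coefXn; lia.
Qed.

Lemma weight_coef_le1 t j : sorted ltn t -> `|(weight t)`_j| <= 1.
Proof.
by move=> /sorted_ltn_uniq ut; rewrite weight_coef !count_uniq_mem //; lia.
Qed.

Lemma weight_Lk i k : weight (Lk i k) = 'X^(i + 3 * k) - \sum_(j <- blk i k) 'X^j.
Proof.
rewrite /Lk weight_cat [X in _ + X]big_seq1 addrC /weight big_map -sumrN; congr (_ + _).
  by rewrite /letter_weight /= mul2n odd_double /= uphalf_double.
by apply: eq_bigr => j _; rewrite /letter_weight mul2n odd_double doubleK.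
Qed.

(** * The Poisson superalgebra *)

(* What a monomial [t] of the product or bracket of two monomials [p] and [q]
   retains of them. *)
Definition composes (p q t : seq nat) : Prop :=
  [/\ sorted ltn t, weight t = weight p + weight q & p = [::] -> q = [::] -> t = [::]].

Lemma cat_composes p q t : sorted ltn t -> perm_eq t (p ++ q) -> composes p q t.
Proof.
move=> st pt; split=> //; first by rewrite (weight_perm pt) weight_cat.
by move=> p0 q0; move: pt; rewrite p0 q0 => /perm_nilP.
Qed.

Lemma contracted_composes p q t : contracted p q t -> composes p q t.
Proof.
move=> c; have [p0 q0] := contracted_neq_nil c.
case: c => z1 [z2 [z12 z1p z2q st pt]]; split=> //; last by move/eqP; rewrite (negbTE p0).
rewrite (weight_perm pt) weight_cat !weight_rem // addrACA -opprD.
by rewrite letter_weight_dual // subr0.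
Qed.

Section PoissonSupport.
Variable K : fieldType.
Implicit Types (f g : Hf K) (p q t : seq nat) (c : K).

Definition hsupp f t : Prop := f t != 0.

Lemma mul3_neq0 (a b c : K) : a * b * c != 0 -> [/\ a != 0, b != 0 & c != 0].
Proof. by rewrite !mulf_eq0 !negb_or => /andP[/andP[]]. Qed.

Lemma hmul_supp f g t : hsupp (hmul f g) t ->
  exists p q, [/\ hsupp f p, hsupp g q & composes p q t].
Proof.
case/sum_neq0 => p [_ _ /mul3_neq0[fp gq /pcoef_neq0[st pt]]].
by do 2 eexists; split; [exact: fp | exact: gq | apply: cat_composes].
Qed.

Lemma hbr_supp f g t : hsupp (hbr f g) t ->
  exists p q, [/\ hsupp f p, hsupp g q & contracted p q t].
Proof.
by case/sum_neq0 => -[p q] [_ _ /= /mul3_neq0[fp gq /mbr_neq0 c]]; exists p, q.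
Qed.

Lemma hsq_supp f t : hsupp (hsq f) t ->
  exists p q, [/\ hsupp f p, hsupp f q & contracted p q t].
Proof.
by case/sum_neq0 => -[p q] [_ _ /= /mul3_neq0[fp gq /mbr_neq0 c]]; exists p, q.
Qed.

Lemma hadd_supp f g t : hsupp (hadd f g) t -> hsupp f t \/ hsupp g t.
Proof.
rewrite /hsupp /hadd; have [-> | _] := eqVneq (f t) 0; last by left.
by rewrite add0r; right.
Qed.

Lemma hscale_supp c f t : hsupp (hscale c f) t -> hsupp f t.
Proof. by rewrite /hsupp /hscale mulf_eq0 negb_or => /andP[]. Qed.

Lemma hpe_supp f t : hsupp (hpe f) t -> hsupp f t.
Proof. by rewrite /hsupp /hpe; case: odd; rewrite ?eqxx. Qed.

Lemma hpo_supp f t : hsupp (hpo f) t -> hsupp f t.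
Proof. by rewrite /hsupp /hpo; case: odd; rewrite ?eqxx. Qed.

Lemma Halg_graded : graded (A := Halg K) hsupp (fun _ => True) composes.
Proof.
split.
- by move=> t; rewrite /hsupp eqxx.
- by move=> f _ f0; apply/funext => t; apply/eqP/negPn/negP/f0.
- by move=> f g t _ _; apply: hadd_supp.
- by move=> c f t _; apply: hscale_supp.
- by move=> f t _; apply: hpe_supp.
- by move=> f t _; apply: hpo_supp.
- move=> op f g t opA _ _; case: opA => [<- | [<- | //]]; first exact: hmul_supp.
  by move=> /hbr_supp[p [q [fp gq /contracted_composes c]]]; exists p, q.
- by move=> f t _ _ /hsq_supp[p [q [fp fq /contracted_composes c]]]; exists p, q.
Qed.

Lemma is_odd_supp f t : is_odd (A := Halg K) f -> f t != 0 -> odd (size t).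
Proof. by move=> /= Of; rewrite -{1}Of /= /hpo; case: ifP => //; rewrite eqxx. Qed.

Lemma hbr_lexlt f g t : sorted ltn t ->
    is_odd (A := Halg K) f -> is_odd (A := Halg K) g ->
  hbr f g t = \sum_(pq <- candH t | lexlt pq.1 pq.2)
    (f pq.1 * g pq.2 + g pq.1 * f pq.2) * mbr K pq.1 pq.2 t.
Proof.
move=> st Of Og; rewrite /hbr (bigID (fun pq => lexlt pq.1 pq.2)) /=.
have -> : \sum_(pq <- candH t | ~~ lexlt pq.1 pq.2) f pq.1 * g pq.2 * mbr K pq.1 pq.2 t =
    \sum_(pq <- candH t | lexlt pq.2 pq.1) f pq.1 * g pq.2 * mbr K pq.1 pq.2 t.
  rewrite [LHS]big_mkcond [RHS]big_mkcond; apply: eq_bigr => -[p q] _ /=.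
  have := lexlt_total p q; case: (lexlt p q); case: (lexlt q p) => //=.
  case: eqP => // -> _; have [-> | fq] := eqVneq (f q) 0; first by rewrite !mul0r.
  have [-> | /mbr_neq0/contracted_diag] := eqVneq (mbr K q q t) 0; first by rewrite mulr0.
  by rewrite (is_odd_supp Of fq) => /(_ isT).
rewrite -[X in _ + X](perm_big _ (candH_swap st)) big_map /= -big_split /=.
apply: eq_bigr => -[p q] _ /=; rewrite mulrDl; congr (_ + _).
have [-> | fq] := eqVneq (f q) 0; first by rewrite mul0r mulr0 !mul0r.
have [-> | gp] := eqVneq (g p) 0; first by rewrite mulr0 !mul0r.
by rewrite (mulrC (g p)) mbr_sym // ?(is_odd_supp Of fq) ?(is_odd_supp Og gp).
Qed.

Lemma hsqD f g : is_odd (A := Halg K) f -> is_odd (A := Halg K) g ->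
  hsq (hadd f g) = hadd (hadd (hsq f) (hsq g)) (hbr f g).
Proof.
move=> Of Og; apply/funext => t; rewrite /hadd.
have [st | nst] := boolP (sorted ltn t); last first.
  have supp_sorted h : (hsupp h t -> sorted ltn t) -> h t = 0.
    by move=> ht; apply/eqP/negPn/negP => /ht; rewrite (negbTE nst).
  rewrite !supp_sorted ?addr0 // => [/hbr_supp | /hsq_supp | /hsq_supp | /hsq_supp];
    by move=> [p [q [_ _ [z1 [z2 []]]]]].
rewrite hbr_lexlt // /hsq -!big_split; apply: eq_bigr => -[p q] _ /=.
by ring.
Qed.

Lemma Halg_linear : linear_operations (A := Halg K) (fun _ => True).
Proof.
split.
- by move=> f g h; apply/funext => t; apply: addrA.
- by move=> f g; apply/funext => t; apply: addrC.
- by move=> f; apply/funext => t; apply: add0r.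
- by move=> f ff; apply/funext => t; apply: (addrI (f t)); rewrite addr0 -[RHS](f_equal (@^~ t) ff).
- by move=> c f g _ _; apply/funext => t; apply: mulrDr.
- by move=> f g _ _; apply/funext => t; rewrite /= /hadd /hpe; case: odd; rewrite ?addr0.
- by move=> f g _ _; apply/funext => t; rewrite /= /hadd /hpo; case: odd; rewrite ?addr0.
- by move=> f _; apply/funext => t; rewrite /= /hpo; case: odd.
- move=> op g opA _ f f' _ _; apply/funext => t.
  by case: opA => [<- | [<- | //]]; rewrite /= /hadd -big_split /=;
    apply: eq_bigr => pq _; rewrite !mulrDl.
- move=> op f opA _ g g' _ _; apply/funext => t.
  by case: opA => [<- | [<- | //]]; rewrite /= /hadd -big_split /=;
    apply: eq_bigr => pq _; rewrite !mulrDr !mulrDl.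
- exists (@hbr K); first by right; left.
  by move=> f g _ _; apply: hsqD.
Qed.

End PoissonSupport.

Section PoissonGenerators.
Variable K : fieldType.
Implicit Types (f : Hf K) (p t : seq nat).

Lemma VV_supp i t : hsupp (VV K i) t -> exists k, t = Lk i k.
Proof.
rewrite /hsupp /VV; case: hasP => [[k _ /eqP] | _]; last by rewrite eqxx.
by exists k.
Qed.

Lemma size_Lk i k : size (Lk i k) = (2 * k).+1.
Proof. by rewrite /Lk size_cat size_map size_blk addn1. Qed.

Lemma VV_Lk i k : VV K i (Lk i k) = 1.
Proof.
rewrite /VV; case: hasP => // -[]; exists k; rewrite ?mem_iota ?size_Lk //; lia.
Qed.

Lemma Lk0 i : Lk i 0 = [:: (2 * i).+1].
Proof. by rewrite /Lk /= muln0 addn0. Qed.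

Lemma LkS i k : Lk i k.+1 = (2 * i)%N :: (2 * i.+1)%N :: Lk (i + 3) k.
Proof. by rewrite /Lk blkS /=; congr [:: _, _ & _ ++ [:: _.+1]]; lia. Qed.

Lemma Lk_path x i k : (x < 2 * i)%N -> path ltn x (Lk i k).
Proof.
elim: k x i => [|k IHk] x i xi; first by rewrite Lk0 /= andbT; lia.
by rewrite LkS /= xi IHk ?andbT; lia.
Qed.

Lemma Lk_sorted i k : sorted ltn (Lk i k).
Proof. by case: k => [|k]; [rewrite Lk0 | rewrite LkS /= Lk_path ?andbT; lia]. Qed.

Lemma mem_Lk_odd i k j : (2 * j).+1 \in Lk i k -> j = (i + 3 * k)%N.
Proof. by rewrite /Lk mem_cat inE => /orP[/mapP[y _] | /eqP]; lia. Qed.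

Lemma VV_cons i t : VV K i [:: (2 * i)%N, (2 * i.+1)%N & t] = VV K (i + 3) t.
Proof.
have [Vt0 | /VV_supp[k ->]] := eqVneq (VV K (i + 3) t) 0; last by rewrite -LkS !VV_Lk.
rewrite Vt0; apply/eqP/negPn/negP => /VV_supp[[|k]]; first by rewrite Lk0.
by rewrite LkS => -[tE]; move/eqP: Vt0; rewrite tE VV_Lk oner_eq0.
Qed.

Lemma VV_odd i : is_odd (A := Halg K) (VV K i).
Proof.
apply/funext => t; rewrite /= /hpo; case: (boolP (odd _)) => // ot.
apply/esym/eqP/negPn/negP => /VV_supp[k tE].
by move: ot; rewrite tE size_Lk /= oddM.
Qed.

(* A monomial x_j p without y_j has a nonzero bracket with at most one of the
   monomials of V_j, namely y_j. *)
Lemma contracted_Lk j p l t : (2 * j).+1 \notin p -> sorted ltn ((2 * j)%N :: p) ->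
  contracted ((2 * j)%N :: p) (Lk j l) t -> l = 0%N /\ t = p.
Proof.
move=> yp sp [z1 [z2 [/andP[/eqP z12 ne_z] z1p z2q st pt]]].
case: l z2q pt => [|l] z2q pt.
  rewrite Lk0 inE in z2q; split=> //.
  have z1E : z1 = (2 * j)%N by lia.
  apply: sorted_ltn_eq st (path_sorted sp) (perm_mem _).
  by move: pt; rewrite z1E Lk0 (eqP z2q) /= !eqxx cats0.
have x_z1 : (2 * j)%N != z1.
  apply/eqP => z1E; have z2E : z2 = (2 * j).+1 by lia.
  by move: z2q; rewrite z2E => /mem_Lk_odd; lia.
have x_z2 : (2 * j)%N != z2.
  apply/eqP => z2E; have z1E : z1 = (2 * j).+1 by lia.
  by move: z1p; rewrite z1E inE (negbTE yp) orbF => /eqP; lia.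
have x1 : (2 * j)%N \in rem z1 ((2 * j)%N :: p).
  by rewrite (rem_mem x_z1) ?mem_head.
have x2 : (2 * j)%N \in rem z2 (Lk j l.+1) by rewrite (rem_mem x_z2) // LkS mem_head.
have := sorted_ltn_uniq st; rewrite (perm_uniq pt) cat_uniq => /and3P[_ /hasPn/(_ _ x2)].
by rewrite /= x1.
Qed.

Lemma mbr_cons_singleton j p t : sorted ltn ((2 * j)%N :: p) ->
  mbr K ((2 * j)%N :: p) [:: (2 * j).+1] t = if t == p then sgn K (size p) else 0.
Proof.
move=> sp; have j_iota : j \in iota 0 (maxl ((2 * j)%N :: p)).+1.
  by rewrite mem_iota add0n ltnS (leq_trans _ (leq_maxl _ _)) //; lia.
rewrite /mbr (bigD1_seq j) ?iota_uniq //= big1 ?addr0 => [|i ij]; last first.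
  rewrite /dterm !inE (_ : (2 * i == (2 * j).+1)%N = false) ?andbF ?add0r; last by lia.
  by rewrite (_ : ((2 * i).+1 == (2 * j).+1)%N = false) ?andbF //; lia.
rewrite /dterm !inE (_ : (2 * j == (2 * j).+1)%N = false) ?andbF ?add0r; last by lia.
rewrite !eqxx /= !eqxx /= -[sgn K 0]/1 !mul1r /pcoef cats0.
have -> : inv p [::] = 0%N by rewrite /inv; apply: big1.
rewrite -[sgn K 0]/1 {1}/sgn exprS mulN1r opprK -/(sgn K _).
have [-> | tp] := eqVneq t p; first by rewrite (path_sorted sp) perm_refl mulr1.
case: andP => [[st /perm_mem tE] | _]; last by rewrite mulr0.
by case/eqP: tp; apply: sorted_ltn_eq st (path_sorted sp) tE.
Qed.

Lemma candH_cons_singleton j p : sorted ltn ((2 * j)%N :: p) -> p != [::] ->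
  ((2 * j)%N :: p, [:: (2 * j).+1]) \in candH p.
Proof.
move=> sp p0; apply/candHP; exists j, (2 * j)%N, (2 * j).+1, p; split.
- case: p sp p0 => // x p /= /andP[jx _] _.
  by apply: leq_trans (leq_maxl _ _); lia.
- by rewrite !inE eqxx orbT.
- exact: subseq_refl.
rewrite sorted_ltn_sort // (eq_in_filter (a2 := pred0)) ?filter_pred0 // => y ->.
by [].
Qed.

Lemma sum_mbr_VV (P : rel (seq nat)) f j t :
    (forall p l, hsupp f p -> P p (Lk j l) -> exists p',
      [/\ p = (2 * j)%N :: p', sorted ltn p, (2 * j).+1 \notin p' & p' != [::]]) ->
    (forall p, P ((2 * j)%N :: p) [:: (2 * j).+1]) ->
  \sum_(pq <- candH t | P pq.1 pq.2) f pq.1 * VV K j pq.2 * mbr K pq.1 pq.2 t =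
    sgn K (size t) * f ((2 * j)%N :: t).
Proof.
move=> f_supp Pjt.
have unique_term p q : P p q -> f p * VV K j q * mbr K p q t != 0 ->
    [/\ p = (2 * j)%N :: t, q = [:: (2 * j).+1] & hsupp f ((2 * j)%N :: t)].
  move=> Ppq /mul3_neq0[fp /VV_supp[l qE] /mbr_neq0 c]; rewrite qE in Ppq c *.
  have [p' [pE sp yp' _]] := f_supp _ _ fp Ppq; rewrite pE in sp c fp *.
  by have [-> ->] := contracted_Lk yp' sp c; rewrite Lk0.
have [ft0 | ft] := eqVneq (f ((2 * j)%N :: t)) 0.
  rewrite ft0 mulr0; apply: big1 => -[p q] Ppq; apply/eqP/negPn/negP.
  by move=> /(unique_term _ _ Ppq)[_ _]; rewrite /hsupp ft0 eqxx.
have := Pjt t; rewrite -{1}(Lk0 j) => /(f_supp _ _ ft)[_ [[<-] st _ t0]].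
rewrite -big_filter (bigD1_seq ((2 * j)%N :: t, [:: (2 * j).+1])) /=; first last.
- by rewrite filter_uniq // undup_uniq.
- by rewrite mem_filter candH_cons_singleton //= Pjt.
rewrite mbr_cons_singleton // eqxx -{1}(Lk0 j) VV_Lk mulr1 mulrC big_seq_cond.
rewrite big1 ?addr0 // => -[p q]; rewrite mem_filter /= => /andP[/andP[Ppq _]].
move=> ne; apply/eqP/negPn/negP => /(unique_term _ _ Ppq)[pE qE _].
by rewrite pE qE eqxx in ne.
Qed.

Lemma hsq_VV i t : hsq (VV K i) t = VV K i ((2 * i)%N :: t).
Proof.
rewrite /hsq (@sum_mbr_VV lexlt) => [|p l /VV_supp[k ->]|p]; last by rewrite /= ltnSn.
  have [-> | /VV_supp[[|k]]] := eqVneq (VV K i ((2 * i)%N :: t)) 0; first by rewrite mulr0.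
    by rewrite Lk0 => -[]; lia.
  by rewrite LkS => -[->] /=; rewrite size_Lk sgn_odd /= oddM mul1r.
case: k => [|k].
  case: l => [|l]; first by rewrite Lk0 /= ltnn eqxx.
  by rewrite Lk0 LkS /= => /orP[|/andP[/eqP]]; lia.
exists ((2 * i.+1)%N :: Lk (i + 3) k); rewrite -LkS; split=> //; first exact: Lk_sorted.
by rewrite inE; apply/norP; split; [lia | apply/negP => /mem_Lk_odd; lia].
Qed.

Lemma hbr_hsq_VV i : hbr (hsq (VV K i)) (VV K i.+1) = hscale (-1) (VV K (i + 3)).
Proof.
apply/funext => t; rewrite /hbr (@sum_mbr_VV (fun _ _ => true)) //.
  rewrite hsq_VV VV_cons /hscale.
  have [-> | /VV_supp[k ->]] := eqVneq (VV K (i + 3) t) 0; first by rewrite !mulr0.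
  by rewrite size_Lk sgn_odd /= oddM.
move=> p l; rewrite /hsupp hsq_VV => /VV_supp[[|k]]; first by rewrite Lk0 => -[]; lia.
rewrite LkS => -[->] _; exists (Lk (i + 3) k); split=> //.
- by rewrite /= Lk_path //; lia.
- by apply/negP => /mem_Lk_odd; lia.
- by rewrite -size_eq0 size_Lk.
Qed.

Lemma VV_Palg n : Palg K (VV K n).
Proof.
elim/ltn_ind: n => -[|[|[|n]]] IHn; try by apply: gen_in; rewrite /=; tauto.
have [P0 P1] : Palg K (VV K n) /\ Palg K (VV K n.+1) by split; apply: IHn; lia.
have -> : VV K n.+3 = hscale (-1) (hbr (hsq (VV K n)) (VV K n.+1)).
  by rewrite hbr_hsq_VV addn3; apply/funext => t; rewrite /hscale !mulN1r opprK.
apply: (gen_scale (A := Halg K)); apply: (gen_op (A := Halg K)) P1; first by right; left.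
by apply: (gen_sq (A := Halg K)) P0 (VV_odd n).
Qed.

Lemma VV_Po n : Po K (VV K n).
Proof.
split; first exact: VV_Palg.
by apply/eqP/negPn/negP => /VV_supp[k /(f_equal size)]; rewrite size_Lk.
Qed.

End PoissonGenerators.

Section PoissonDegrees.
Variables (K : fieldType) (R : realType).
Implicit Types (f g : Hf K) (p q t : seq nat).

Definition hdeg t : R * R[i] := degree R (weight t).
Local Notation hhom := (hom (A := Halg K) (@hsupp K) hdeg).
Local Notation hhom_sum := (hom_sum (A := Halg K) (@hsupp K) hdeg).

Definition proper t : Prop :=
  [/\ sorted ltn t, effective (weight t) & hdeg t = 0 -> t = [::]].

Lemma proper_admissible t : proper t -> admissible_degree (hdeg t).
Proof.
by move=> [st et _]; exists (weight t) => //; split=> // j; apply: weight_coef_le1.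
Qed.

Lemma hdeg_nil : hdeg [::] = 0.
Proof. by rewrite /hdeg weight_nil /degree !ieval0. Qed.

Lemma hdegM p q t : composes p q t -> hdeg t = hdeg p + hdeg q.
Proof. by move=> [_ tE _]; rewrite /hdeg tE degreeD. Qed.

Lemma proper_composes p q t : composes p q t -> proper p -> proper q -> proper t.
Proof.
move=> c [_ ep p0] [_ eq q0]; have [st tE t0] := c; split=> //.
  by rewrite tE; apply: effectiveD.
by rewrite (hdegM c) -degreeD => /(effective_degreeD_eq0 ep eq)[/p0 ? /q0 ?]; apply: t0.
Qed.

Lemma proper_nil : proper [::].
Proof.
split=> //; rewrite weight_nil -(mul0r chi); apply: effective_mul_chi => j.
by rewrite coef0.
Qed.

Lemma hdeg_Lk i k : hdeg (Lk i k) = degree R 'X^i.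
Proof. by rewrite /hdeg weight_Lk blk_weight degree_mul_chi. Qed.

Lemma proper_Lk i k : proper (Lk i k).
Proof.
split; first exact: Lk_sorted; first by rewrite weight_Lk; apply: effective_blk_weight.
by rewrite hdeg_Lk => /eqP; rewrite (negbTE (degreeXn_neq0 R i)).
Qed.

Lemma Palg_gens x : InL x [:: hone K; VV K 0; VV K 1; VV K 2] ->
  x = hone K \/ exists i, x = VV K i.
Proof. by case=> [<- | [<- | [<- | [<- | //]]]]; [left | right; eexists..]. Qed.

Lemma hone_supp t : hsupp (hone K) t -> t = [::].
Proof. by rewrite /hsupp /hone; have [// | _] := eqVneq t [::]; rewrite eqxx. Qed.

Lemma Palg_proper f t : Palg K f -> hsupp f t -> proper t.
Proof.
move=> Pf; suff [_ /(_ t)] : supported (A := Halg K) (@hsupp K) (fun _ => True) proper f by [].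
move: Pf; apply: gen_min => [|g /Palg_gens[-> | [i ->]]].
- by apply: (supported_subalg (@Halg_graded K)) => //; apply: proper_composes.
- by split=> // s /hone_supp ->; apply: proper_nil.
- by split=> // s /VV_supp[k ->]; apply: proper_Lk.
Qed.

Lemma VV_hom i : hhom (degree R 'X^i) (VV K i).
Proof. by move=> t /VV_supp[k ->]; apply: hdeg_Lk. Qed.

Lemma Palg_hom_sum f : Palg K f -> hhom_sum (Palg K) f.
Proof.
apply: (gen_hom_sum (@Halg_linear K) _ (@Halg_graded K) hdegM) => // x.
case/Palg_gens => [-> | [i ->]]; last by exists (degree R 'X^i); apply: VV_hom.
by exists 0 => t /hone_supp ->; apply: hdeg_nil.
Qed.

Lemma Palg_graded : graded (A := Halg K) (@hsupp K) (Palg K) composes.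
Proof. exact: graded_sub (@Halg_graded K). Qed.

Lemma hmul_const f g : f [::] = 0 -> hmul f g [::] = 0.
Proof. by move=> f0; rewrite /hmul /= big_seq1 f0 !mul0r. Qed.

(* A bracket with nonzero constant term would come from a contraction of
   monomials of degree zero. *)
Lemma contracted_proper p q : proper p -> proper q -> ~ contracted p q [::].
Proof.
move=> [_ ep p0] [_ eq _] c; have [/eqP pn _] := contracted_neq_nil c.
have := hdegM (contracted_composes c); rewrite hdeg_nil -degreeD => /esym.
by move=> /(effective_degreeD_eq0 ep eq)[/p0].
Qed.

Lemma hbr_const f g : Palg K f -> Palg K g -> hbr f g [::] = 0.
Proof.
move=> Pf Pg; apply/eqP/negPn/negP => /hbr_supp[p [q [fp gq]]].
by apply: contracted_proper; [apply: Palg_proper fp | apply: Palg_proper gq].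
Qed.

Lemma hsq_const f : Palg K f -> hsq f [::] = 0.
Proof.
move=> Pf; apply/eqP/negPn/negP => /hsq_supp[p [q [fp fq]]].
by apply: contracted_proper; [apply: Palg_proper fp | apply: Palg_proper fq].
Qed.

Lemma Po_subalg : is_subalg (A := Halg K) (Po K).
Proof.
split.
- by split; first exact: gen_0.
- by move=> f g [Pf f0] [Pg g0]; split; [apply: gen_add | rewrite /= /hadd f0 g0 addr0].
- by move=> c f [Pf f0]; split; [apply: gen_scale | rewrite /= /hscale f0 mulr0].
- by move=> f [Pf f0]; split; split; [exact: gen_pe | | exact: gen_po |].
- split.
    move=> op f g opA [Pf f0] [Pg g0]; split; first exact: gen_op.
    by case: opA => [<- | [<- | //]]; [apply: hmul_const | apply: hbr_const].
  by move=> f [Pf f0] Of; split; [apply: gen_sq | apply: hsq_const].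
Qed.

Lemma Po_hdeg_neq0 f t : Po K f -> hsupp f t -> hdeg t != 0.
Proof.
move=> [Pf f0] ft; have [_ _ t0] := Palg_proper Pf ft.
by apply/eqP => /t0 tE; move: ft; rewrite /hsupp tE f0 eqxx.
Qed.

Lemma Po_hom_sum f : Po K f -> hhom_sum (Po K) f.
Proof.
move=> [Pf f0]; have linH := Halg_linear K.
have [a [b [Sa Sb fE]]] := hom_sum_split (aaddA linH) (aaddC linH) (aadd0 linH)
  (fun d => d != 0) (Palg_hom_sum Pf).
have part_const (g : car (Halg K)) :
    part (A := Halg K) (@hsupp K) hdeg (Palg K) (fun d => d != 0) g -> Po K g.
  move=> [Pg gn0]; split=> //; apply/eqP/negPn/negP => /gn0.
  by rewrite hdeg_nil eqxx.
have [_ a0] := part_const _ (hom_sum_part Palg_graded (gen_subalg _) Sa).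
have [Pb b_deg] := hom_sum_part Palg_graded (gen_subalg _) Sb.
suff b0 : b = hz K.
  by rewrite fE b0 (aaddC linH) (aadd0 linH); apply: hom_sum_sub Sa.
apply/funext => t; apply/eqP/negPn/negP => bt; have [_ _ t0] := Palg_proper Pb bt.
have /negPn/eqP/t0 tE := b_deg t bt; move: bt; rewrite tE.
by move: f0; rewrite fE /= /hadd a0 add0r => ->; rewrite eqxx.
Qed.

Theorem Po_continuum : continuum_ln_decompositions (A := Halg K) (Po K).
Proof.
have linH := Halg_linear K.
apply: (half_spaces_continuum (bar := fun _ => false) (adm := @admissible_degree R)
  _ Po_subalg _ _ Po_hom_sum (aaddA linH) (aaddC linH) (aadd0 linH)
  (@direction_cone_half_space R) (@direction_cone_separated R)).
- apply: graded_sub (@Halg_graded K) => // p q t c; split=> //; exact: hdegM.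
- by move=> f t [Pf _] /(Palg_proper Pf)/proper_admissible.
- by move=> f t Pf ft d0; have := Po_hdeg_neq0 Pf ft; rewrite d0 eqxx.
move=> n; exists (VV K n), (Lk n 0); split; [exact: VV_Po | | exact: VV_hom].
by rewrite /hsupp VV_Lk oner_neq0.
Qed.

End PoissonDegrees.

(** * Linear maps of free modules *)

Lemma linear_bundle (K : fieldType) (U V : lmodType K) (M : U -> V) :
  linear M -> exists M' : {linear U -> V}, M = M'.
Proof.
move=> lM; pose M' : {linear U -> V} := HB.pack M (GRing.isLinear.Build _ _ _ _ M lM).
by exists M'.
Qed.

Section FreeModule.
Variables (K : fieldType) (T : choiceType) (V : lmodType K).
Local Notation L := {malg K[T]}.
Implicit Types (f : L) (m : T).

Definition linear_ext (h : T -> V) (f : L) : V := \sum_(m <- msupp f) f@_m *: h m.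

Lemma linear_ext_wide h f (D : {fset T}) : (msupp f `<=` D)%fset ->
  linear_ext h f = \sum_(m <- D) f@_m *: h m.
Proof.
by move=> fD; apply: big_fset_incl => // m _ nm; rewrite mcoeff_outdom ?scale0r.
Qed.

Lemma linear_ext_is_linear h : linear (linear_ext h).
Proof.
move=> c f g; pose D := (msupp f `|` msupp g)%fset.
have fgD : (msupp (c *: f + g) `<=` D)%fset.
  by apply: fsubset_trans (msuppD_le _ _) _; apply/fsetSU/msuppZ_le.
rewrite (linear_ext_wide h fgD) !(@linear_ext_wide h _ D) ?fsubsetUr ?fsubsetUl //.
rewrite scaler_sumr -big_split; apply: eq_bigr => m _ /=.
by rewrite mcoeffD mcoeffZ scalerDl scalerA.
Qed.

HB.instance Definition _ h := GRing.isLinear.Build K L V _ (linear_ext h) (linear_ext_is_linear h).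

Lemma linear_ext_basis h m : linear_ext h << m >> = h m.
Proof. by rewrite /linear_ext msuppU oner_eq0 big_seq_fset1 mcoeffUU scale1r. Qed.

Lemma linear_expand (M : L -> V) f :
  linear M -> M f = \sum_(m <- msupp f) f@_m *: M << m >>.
Proof.
case/linear_bundle=> {}M ->; rewrite {1}(monalgE f) linear_sum; apply: eq_bigr => m _.
rewrite -linearZ; congr (M _); apply/malgP => k.
by rewrite mcoeffZ !mcoeffU mulrnAr mulr1.
Qed.

Lemma linear_eq (M N : L -> V) :
  linear M -> linear N -> (forall m, M << m >> = N << m >>) -> M = N.
Proof.
move=> lM lN MN; apply/funext => f; rewrite (linear_expand f lM) (linear_expand f lN).
by apply: eq_bigr => m _; rewrite MN.
Qed.

End FreeModule.

Section Restrictions.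
Variables (K : fieldType) (T : choiceType).
Local Notation L := {malg K[T]}.
Implicit Types (f : L) (m : T) (P Q : pred T).

Definition restrict P f : L := \sum_(m <- msupp f | P m) f@_m *: << m >>.

Lemma restrictE P : restrict P = linear_ext (fun m => if P m then << m >> else 0).
Proof.
apply/funext => f; rewrite /restrict big_mkcond; apply: eq_bigr => m _.
by case: (P m); rewrite ?scaler0.
Qed.

Lemma restrict_is_linear P : linear (restrict P).
Proof. by rewrite restrictE; apply: linearP. Qed.

Lemma restrict_basis P m : restrict P << m >> = if P m then << m >> else 0.
Proof. by rewrite restrictE linear_ext_basis. Qed.

Lemma mcoeff_restrict P f m : (restrict P f)@_m = if P m then f@_m else 0.
Proof.
pose coefL g : K^o := (restrict P g)@_m; pose coefR g : K^o := if P m then g@_m else 0.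
suff E : coefL = coefR by exact: (congr1 (@^~ f) E).
apply: linear_eq => [c g h | c g h | k]; rewrite /coefL /coefR.
- by rewrite restrict_is_linear mcoeffD mcoeffZ.
- by case: (P m); rewrite ?scaler0 ?addr0 // mcoeffD mcoeffZ.
- rewrite restrict_basis; have [-> | km] := eqVneq k m; first by case: (P m); rewrite ?mcoeff0.
  by case: (P k); rewrite ?mcoeff0 mcoeffU (negbTE km) if_same.
Qed.

Lemma sum_of_blocks_entry (M : L -> L) P Q P' Q' m m' : linear M ->
  (restrict P (M (restrict Q << m >>)) + restrict P' (M (restrict Q' << m >>)))@_m' =
  ((P m' && Q m) + (P' m' && Q' m))%:R * (M << m >>)@_m'.
Proof.
case/linear_bundle=> {}M ->; rewrite mcoeffD !mcoeff_restrict !restrict_basis.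
by case: (P m'); case: (Q m); case: (P' m'); case: (Q' m);
  rewrite /= ?linear0 ?mcoeff0 ?addr0 ?add0r ?mul0r ?mul1r // mulr2n mulrDl mul1r.
Qed.

End Restrictions.

(** * Linear operators on the Grassmann algebra *)

Section Operators.
Variable K : fieldType.
Implicit Types (M N : End K) (m : mono) (e : mono * mono).

Definition mpar m : bool := odd (size (val m)).

Fact lpe_is_linear : linear (@lpe K).
Proof. exact: (restrict_is_linear (predC mpar)). Qed.

Fact lpo_is_linear : linear (@lpo K).
Proof. exact: (restrict_is_linear mpar). Qed.

Fact v_is_linear i : linear (@v K i).
Proof. exact: linear_ext_is_linear. Qed.

HB.instance Definition _ := GRing.isLinear.Build K (Lam K) (Lam K) _ (@lpe K) lpe_is_linear.
HB.instance Definition _ := GRing.isLinear.Build K (Lam K) (Lam K) _ (@lpo K) lpo_is_linear.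
HB.instance Definition _ i := GRing.isLinear.Build K (Lam K) (Lam K) _ (@v K i) (v_is_linear i).

Lemma linear_ez : linear (@ez K).
Proof. by move=> c f g; rewrite /ez scaler0 addr0. Qed.

Lemma linear_eadd M N : linear M -> linear N -> linear (eadd M N).
Proof. by move=> lM lN c f g; rewrite /eadd lM lN scalerDr addrACA. Qed.

Lemma linear_escale c M : linear M -> linear (escale c M).
Proof. by move=> lM d f g; rewrite /escale lM scalerDr !scalerA (mulrC c). Qed.

Lemma linear_eopp M : linear M -> linear (eopp M).
Proof. by move=> lM c f g; rewrite /eopp lM opprD scalerN. Qed.

Lemma linear_ecomp M N : linear M -> linear N -> linear (ecomp M N).
Proof. by move=> lM lN c f g; rewrite /ecomp lN lM. Qed.

Lemma linear_epe M : linear M -> linear (epe M).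
Proof.
have [lpeP lpoP] := (lpe_is_linear, lpo_is_linear).
by move=> lM; apply: linear_eadd; do 2!apply: linear_ecomp => //.
Qed.

Lemma linear_epo M : linear M -> linear (epo M).
Proof.
have [lpeP lpoP] := (lpe_is_linear, lpo_is_linear).
by move=> lM; apply: linear_eadd; do 2!apply: linear_ecomp => //.
Qed.

Lemma linear_ebr M N : linear M -> linear N -> linear (ebr M N).
Proof.
move=> lM lN; have := (linear_epe lM, linear_epo lM, linear_epe lN, linear_epo lN).
rewrite /ebr; move: (epe M) (epo M) (epe N) (epo N) => Me Mo Ne No [[[lMe lMo] lNe] lNo].
by do 2!apply: linear_eadd; do ?apply: linear_eadd; do ?apply: linear_eopp;
  apply: linear_ecomp.
Qed.

Lemma epe_entry M m m' : linear M ->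
  (epe M << m >>)@_m' = (mpar m == mpar m')%:R * (M << m >>)@_m'.
Proof.
move=> lM; rewrite [LHS](sum_of_blocks_entry (predC mpar) (predC mpar) mpar mpar _ _ lM) /=.
by case: (mpar m); case: (mpar m').
Qed.

Lemma epo_entry M m m' : linear M ->
  (epo M << m >>)@_m' = (mpar m != mpar m')%:R * (M << m >>)@_m'.
Proof.
move=> lM; rewrite [LHS](sum_of_blocks_entry mpar (predC mpar) (predC mpar) mpar _ _ lM) /=.
by case: (mpar m); case: (mpar m').
Qed.

Lemma entries_eq M N : linear M -> linear N ->
  (forall m m', (M << m >>)@_m' = (N << m >>)@_m') -> M = N.
Proof. by move=> lM lN MN; apply: linear_eq => // m; apply/malgP. Qed.

Lemma epo_idem M : linear M -> epo (epo M) = epo M.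
Proof.
move=> lM; have lo := linear_epo lM; apply: (entries_eq (linear_epo lo) lo) => m m'.
apply: etrans (epo_entry m m' lo) _; rewrite (epo_entry m m' lM).
by rewrite mulrA -natrM mulnb andbb.
Qed.

Definition esupp M e : Prop := (M << e.1 >>)@_e.2 != 0.

Lemma esupp_eq0 M : linear M -> (forall e, ~ esupp M e) -> M = @ez K.
Proof.
move=> lM M0; apply: (entries_eq lM linear_ez) => m m'.
by rewrite [RHS]mcoeff0; apply/eqP/negPn/negP; apply: (M0 (m, m')).
Qed.

Lemma epo_odd M : linear M -> (forall e, esupp M e -> mpar e.1 != mpar e.2) -> epo M = M.
Proof.
move=> lM oM; apply: (entries_eq (linear_epo lM) lM) => m m'; rewrite (epo_entry _ _ lM).
have [-> | /eqP/(oM (m, m')) ->] := (M << m >>)@_m' =P 0; first by rewrite mulr0.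
by rewrite mul1r.
Qed.

Lemma epe_even M : linear M -> (forall e, esupp M e -> mpar e.1 = mpar e.2) ->
  epe M = M /\ epo M = @ez K.
Proof.
move=> lM eM; have pm m m' : (M << m >>)@_m' = 0 \/ mpar m = mpar m'.
  by have [|/eqP/(eM (m, m'))] := (M << m >>)@_m' =P 0; [left | right].
split.
  apply: (entries_eq (linear_epe lM) lM) => m m'; rewrite (epe_entry _ _ lM).
  by case: (pm m m') => ->; rewrite ?mulr0 // eqxx mul1r.
apply: (entries_eq (linear_epo lM) linear_ez) => m m'; rewrite (epo_entry _ _ lM) [RHS]mcoeff0.
by case: (pm m m') => ->; rewrite ?mulr0 // eqxx mul0r.
Qed.

Lemma ez_supp e : ~ esupp (@ez K) e.
Proof. by rewrite /esupp /ez mcoeff0 eqxx. Qed.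

Lemma eadd_supp M N e : esupp (eadd M N) e -> esupp M e \/ esupp N e.
Proof.
rewrite /esupp /eadd mcoeffD; have [-> | _] := eqVneq ((M << e.1 >>)@_e.2) 0; last by left.
by rewrite add0r; right.
Qed.

Lemma eopp_supp M e : esupp (eopp M) e -> esupp M e.
Proof. by rewrite /esupp /eopp mcoeffN oppr_eq0. Qed.

Lemma escale_supp c M e : esupp (escale c M) e -> c != 0 /\ esupp M e.
Proof. by rewrite /esupp /escale mcoeffZ mulf_eq0 negb_or => /andP. Qed.

Lemma epe_supp M e : linear M -> esupp (epe M) e -> esupp M e.
Proof. by case: e => m m' lM; rewrite /esupp (epe_entry _ _ lM) mulf_eq0 negb_or => /andP[]. Qed.

Lemma epo_supp M e : linear M -> esupp (epo M) e -> esupp M e.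
Proof. by case: e => m m' lM; rewrite /esupp (epo_entry _ _ lM) mulf_eq0 negb_or => /andP[]. Qed.

Lemma eflip_supp M e : linear M -> esupp (eflip M) e -> esupp M e.
Proof.
by move=> lM /eadd_supp[/(epe_supp lM) | /eopp_supp/(epo_supp lM)].
Qed.

Lemma ecomp_supp M N m m' : linear M -> esupp (ecomp M N) (m, m') ->
  exists m1, esupp N (m, m1) /\ esupp M (m1, m').
Proof.
move=> lM; rewrite /esupp /ecomp (linear_expand _ lM) raddf_sum => /sum_neq0[m1 [_ _ /=]].
by rewrite mcoeffZ mulf_eq0 negb_or => /andP[]; exists m1.
Qed.

(* The operator x^p |-> x^q has the weight of x^q d^p. *)
Definition mono_weight m : {poly int} := \sum_(j <- val m) 'X^j.
Definition eweight e : {poly int} := mono_weight e.1 - mono_weight e.2.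
Definition eweight_add e1 e2 e : Prop := eweight e = eweight e1 + eweight e2.

Lemma ecomp_weight M N e : linear M -> esupp (ecomp M N) e ->
  exists e1 e2, [/\ esupp M e1, esupp N e2 & eweight_add e1 e2 e].
Proof.
case: e => m m' lM /(ecomp_supp lM)[m1 [Ns Ms]]; exists (m1, m'), (m, m1); split=> //.
by rewrite /eweight_add /eweight /= [RHS]addrC addrA subrK.
Qed.

Lemma ebr_weight M N e : linear M -> linear N -> esupp (ebr M N) e ->
  exists e1 e2, [/\ esupp M e1, esupp N e2 & eweight_add e1 e2 e].
Proof.
move=> lM lN; have comp M' N' : linear M' -> (forall e', esupp M' e' -> esupp M e') ->
    (forall e', esupp N' e' -> esupp N e') -> esupp (ecomp M' N') e ->
    exists e1 e2, [/\ esupp M e1, esupp N e2 & eweight_add e1 e2 e].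
  by move=> lM' sM sN /(ecomp_weight lM')[e1 [e2 [/sM s1 /sN s2 w]]]; exists e1, e2.
have comp' M' N' : linear N' -> (forall e', esupp M' e' -> esupp M e') ->
    (forall e', esupp N' e' -> esupp N e') -> esupp (ecomp N' M') e ->
    exists e1 e2, [/\ esupp M e1, esupp N e2 & eweight_add e1 e2 e].
  move=> lN' sM sN /(ecomp_weight lN')[e1 [e2 [/sN s1 /sM s2 w]]]; exists e2, e1.
  by split=> //; rewrite /eweight_add addrC.
have [lMe lMo lNe lNo] : [/\ linear (epe M), linear (epo M), linear (epe N) & linear (epo N)].
  by split; by [apply: linear_epe | apply: linear_epo].
have [sMe sMo] := (fun e' => @epe_supp M e' lM, fun e' => @epo_supp M e' lM).
have [sNe sNo] := (fun e' => @epe_supp N e' lN, fun e' => @epo_supp N e' lN).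
case/eadd_supp => [|/eadd_supp[]] /eadd_supp[].
- exact: comp.
- by move/eopp_supp; apply: comp'.
- exact: comp.
- by move/eopp_supp; apply: comp'.
- exact: comp.
- exact: comp'.
Qed.

Lemma linear_LieEnd_subalg : is_subalg (A := LieEnd K) (fun M => linear M).
Proof.
split.
- exact: linear_ez.
- exact: linear_eadd.
- exact: linear_escale.
- by move=> M lM; split; [apply: linear_epe | apply: linear_epo].
- by split=> [f M N [<- | //] | M lM _]; [apply: linear_ebr | apply: linear_ecomp].
Qed.

Lemma linear_AssEnd_subalg : is_subalg (A := AssEnd K) (fun M => linear M).
Proof.
split.
- exact: linear_ez.
- exact: linear_eadd.
- exact: linear_escale.
- by move=> M lM; split; last exact: linear_ez.
- by split=> [f M N [<- | //] | M lM _]; apply: linear_ecomp.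
Qed.

Lemma LieEnd_graded : graded (A := LieEnd K) esupp (fun M => linear M) eweight_add.
Proof.
split.
- exact: ez_supp.
- exact: esupp_eq0.
- by move=> M N e _ _; apply: eadd_supp.
- by move=> c M e _ /escale_supp[].
- by move=> M e; apply: epe_supp.
- by move=> M e; apply: epo_supp.
- by move=> f M N e [<- | //]; apply: ebr_weight.
- by move=> M e lM _; apply: ecomp_weight.
Qed.

Lemma AssEnd_graded : graded (A := AssEnd K) esupp (fun M => linear M) eweight_add.
Proof.
split.
- exact: ez_supp.
- exact: esupp_eq0.
- by move=> M N e _ _; apply: eadd_supp.
- by move=> c M e _ /escale_supp[].
- by [].
- by move=> M e _ /ez_supp.
- by move=> f M N e [<- | //] lM _; apply: ecomp_weight.
- by move=> M e lM _; apply: ecomp_weight.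
Qed.

End Operators.

Section LinearOperations.
Variable K : fieldType.
Implicit Types (M N P : End K).

Lemma epe_epo M : linear M -> epe (epo M) = @ez K.
Proof.
move=> lM; have lo := linear_epo lM; apply: (entries_eq (linear_epe lo) (@linear_ez K)) => m m'.
apply: etrans (epe_entry m m' lo) _; rewrite (epo_entry m m' lM) [RHS]mcoeff0.
by rewrite mulrA -natrM mulnb andbN mul0r.
Qed.

Lemma epeD M N : epe (eadd M N) = eadd (epe M) (epe N).
Proof.
apply/funext => f; rewrite /epe /eadd /ecomp.
have [E ->] := linear_bundle (@lpe_is_linear K).
have [O ->] := linear_bundle (@lpo_is_linear K).
by rewrite !linearD addrACA.
Qed.

Lemma epoD M N : epo (eadd M N) = eadd (epo M) (epo N).
Proof.
apply/funext => f; rewrite /epo /eadd /ecomp.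
have [E ->] := linear_bundle (@lpe_is_linear K).
have [O ->] := linear_bundle (@lpo_is_linear K).
by rewrite !linearD addrACA.
Qed.

Lemma ebrDl M N P : linear P -> ebr (eadd M N) P = eadd (ebr M P) (ebr N P).
Proof.
move=> lP; have := (linear_epe lP, linear_epo lP); rewrite /ebr epeD epoD.
move: (epe M) (epe N) (epo M) (epo N) (epe P) (epo P) => Me Ne Mo No Pe Po [].
case/linear_bundle: lP => {}P ->; case/linear_bundle=> {}Pe ->; case/linear_bundle=> {}Po ->.
apply/funext => f; rewrite /eadd /eopp /ecomp !linearD.
by rewrite (AC ((2*2)*((2*2)*(2*2))) (((1*3)*((5*7)*(9*11)))*((2*4)*((6*8)*(10*12))))).
Qed.

Lemma ebrDr M N P : linear P -> ebr P (eadd M N) = eadd (ebr P M) (ebr P N).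
Proof.
move=> lP; have := (linear_epe lP, linear_epo lP); rewrite /ebr epeD epoD.
move: (epe M) (epe N) (epo M) (epo N) (epe P) (epo P) => Me Ne Mo No Pe Po [].
case/linear_bundle=> {}Pe ->; case/linear_bundle=> {}Po ->.
apply/funext => f; rewrite /eadd /eopp /ecomp !linearD.
by rewrite (AC ((2*2)*((2*2)*(2*2))) (((1*3)*((5*7)*(9*11)))*((2*4)*((6*8)*(10*12))))).
Qed.

Lemma ebr_odd M N : linear M -> linear N -> epo M = M -> epo N = N ->
  ebr M N = eadd (ecomp M N) (ecomp N M).
Proof.
move=> lM lN oM oN.
have [eM eN] : epe M = @ez K /\ epe N = @ez K.
  by split; [rewrite -oM | rewrite -oN]; apply: epe_epo.
rewrite /ebr oM oN eM eN.
case/linear_bundle: lM => {oM eM}M ->; case/linear_bundle: lN => {oN eN}N ->.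
by apply/funext => f; rewrite /eadd /eopp /ecomp /ez !linear0 !addr0 !add0r.
Qed.

Lemma ebr_even M N : linear N -> epe M = M -> epo M = @ez K ->
  ebr M N = eadd (ecomp M N) (eopp (ecomp N M)).
Proof.
move=> lN eM oM; have := (linear_epe lN, linear_epo lN); rewrite /ebr eM oM.
move: (epe N) (epo N) => Ne No [/linear_bundle[{}Ne ->] /linear_bundle[{}No ->]].
by apply/funext => f; rewrite /eadd /eopp /ecomp /ez !linear0 !addr0.
Qed.

Lemma eaddA M N P : eadd M (eadd N P) = eadd (eadd M N) P.
Proof. by apply/funext => f; apply: addrA. Qed.

Lemma eaddC M N : eadd M N = eadd N M.
Proof. by apply/funext => f; apply: addrC. Qed.

Lemma eadd0 M : eadd (@ez K) M = M.
Proof. by apply/funext => f; apply: add0r. Qed.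

Lemma eaddxx_eq0 M : eadd M M = M -> M = @ez K.
Proof.
by move=> MM; apply/funext => f; have /(congr1 (@^~ f)) := MM; rewrite -[RHS]addr0 => /addrI.
Qed.

Lemma escaleD c M N : escale c (eadd M N) = eadd (escale c M) (escale c N).
Proof. by apply/funext => f; apply: scalerDr. Qed.

Lemma LieEnd_linear : linear_operations (A := LieEnd K) (fun M => linear M).
Proof.
split.
- exact: eaddA.
- exact: eaddC.
- exact: eadd0.
- exact: eaddxx_eq0.
- by move=> c M N _ _; apply: escaleD.
- by move=> M N _ _; apply: epeD.
- by move=> M N _ _; apply: epoD.
- exact: epo_idem.
- by move=> f P [<- | //] lP M N _ _; apply: ebrDl.
- by move=> f P [<- | //] lP M N _ _; apply: ebrDr.
- exists (@ebr K); first by left.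
  move=> M N lM lN oM oN; rewrite (ebr_odd lM lN oM oN); apply/funext => f.
  case/linear_bundle: lM => {oM}M ->; case/linear_bundle: lN => {oN}N ->.
  by rewrite /= /eadd /ecomp !linearD (AC (2*2) ((1*4)*(2*3))).
Qed.

Lemma AssEnd_linear : linear_operations (A := AssEnd K) (fun M => linear M).
Proof.
split.
- exact: eaddA.
- exact: eaddC.
- exact: eadd0.
- exact: eaddxx_eq0.
- by move=> c M N _ _; apply: escaleD.
- by [].
- by move=> M N _ _; rewrite /= eadd0.
- by [].
- by move=> f P [<- | //] lP M N _ _.
- move=> f P [<- | //] /linear_bundle[{}P ->] M N _ _.
  by apply/funext => h; apply: linearD.
- exists (@ecomp K); first by left.
  by move=> M N _ _ <- <-; rewrite /= !eadd0.
Qed.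

End LinearOperations.

(** * Creation and annihilation operators *)

Definition toggle j (s : seq nat) : seq nat :=
  [seq x <- iota 0 (maxn j (maxl s)).+1 | (x == j) (+) (x \in s)].

Lemma toggle_sorted j s : sorted ltn (toggle j s).
Proof. by apply: sorted_filter; [apply: ltn_trans | apply: iota_ltn_sorted]. Qed.

Lemma mem_toggle i j s : (i \in toggle j s) = (i == j) (+) (i \in s).
Proof.
rewrite mem_filter mem_iota /= andb_idr // ltnS leq_max.
have [-> _ | _ /= /leq_maxl_mem ->] := eqVneq i j; first by rewrite leqnn.
by rewrite orbT.
Qed.

Lemma perm_toggle j s : sorted ltn s ->
  if j \in s then perm_eq s (j :: toggle j s) else perm_eq (toggle j s) (j :: s).
Proof.
move=> /sorted_ltn_uniq us; have ut := sorted_ltn_uniq (toggle_sorted j s).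
case: ifP => js; apply: uniq_perm; rewrite //= ?mem_toggle ?eqxx ?js // => i.
  by rewrite inE mem_toggle; case: eqP => [-> | ] //=; rewrite js.
by rewrite inE mem_toggle; case: eqP => [-> | ] //=; rewrite js.
Qed.

Definition count_below j (s : seq nat) : nat := count (fun x => x < j)%N s.

Lemma index_sorted_ltn j s : sorted ltn s -> j \in s -> index j s = count_below j s.
Proof.
elim: s => //= x s IHs xs; rewrite inE eq_sym; case: eqP => [<- _ | _ /= js].
  rewrite ltnn /=; apply/esym/eqP; rewrite -leqn0 leqNgt -has_count; apply/hasPn => y ys.
  by have := allP (order_path_min ltn_trans xs) y ys; rewrite /= -leqNgt => /ltnW.
rewrite (IHs (path_sorted xs) js).
by have /= -> := allP (order_path_min ltn_trans xs) j js.
Qed.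

Lemma odd_count_below_toggle i j s : sorted ltn s ->
  odd (count_below i (toggle j s)) = (j < i)%N (+) odd (count_below i s).
Proof.
rewrite /count_below => ss; have := perm_toggle j ss.
by case: ifP => _ /permP -> /=; rewrite oddD oddb // addbA addbb.
Qed.

Definition mtoggle j (m : mono) : mono := exist _ (toggle j (val m)) (toggle_sorted j (val m)).

Lemma mtoggleC i j m : mtoggle i (mtoggle j m) = mtoggle j (mtoggle i m).
Proof.
apply/val_inj/sorted_ltn_eq; try exact: toggle_sorted.
by move=> x; rewrite !mem_toggle addbCA.
Qed.

Lemma mtoggleK j : involutive (mtoggle j).
Proof.
move=> m; apply/val_inj/sorted_ltn_eq; first exact: toggle_sorted; first exact: valP.
by move=> x; rewrite !mem_toggle addbA addbb.
Qed.

Lemma mpar_toggle j m : mpar (mtoggle j m) = ~~ mpar m.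
Proof.
have := perm_toggle j (valP m); rewrite /mpar.
by case: ifP => _ /perm_size -> //=; rewrite negbK.
Qed.

Section Fermions.
Variable K : fieldType.
Implicit Types (b c : bool) (i j : nat) (m : mono) (f : Lam K).

Definition fermion_coef b j m : K :=
  if (j \in val m) == b then sgn K (count_below j (val m)) else 0.

(* The derivation d_j for [b = true], the multiplication by x_j for [b = false]. *)
Definition fermion b j : End K := linear_ext (fun m => fermion_coef b j m *: << mtoggle j m >>).

HB.instance Definition _ b j := GRing.Linear.on (fermion b j).

Lemma fermion_basis b j m : fermion b j << m >> = fermion_coef b j m *: << mtoggle j m >>.
Proof. exact: linear_ext_basis. Qed.

Lemma fermion_coef_toggle b i j m : i != j ->
  fermion_coef b i (mtoggle j m) = sgn K (j < i)%N * fermion_coef b i m.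
Proof.
move=> /negbTE ij; rewrite /fermion_coef mem_toggle ij /=; case: ifP; rewrite ?mulr0 // => _.
by rewrite -sgnD !sgn_odd oddD oddb odd_count_below_toggle ?valP.
Qed.

Lemma fermion_coef_toggle_diag b c i m :
  fermion_coef b i (mtoggle i m) * fermion_coef c i m = ((b != c) && ((i \in val m) == c))%:R.
Proof.
rewrite /fermion_coef mem_toggle eqxx /=.
case: (i \in _); case: b; case: c; rewrite /= ?mulr0 ?mul0r //.
  by rewrite -sgnD sgn_odd oddD odd_count_below_toggle ?valP // ltnn addbb.
by rewrite -sgnD sgn_odd oddD odd_count_below_toggle ?valP // ltnn addbb.
Qed.

Lemma fermion_coef_anticomm b c i j m : i != j ->
  fermion_coef c j m * fermion_coef b i (mtoggle j m) =
  - (fermion_coef b i m * fermion_coef c j (mtoggle i m)).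
Proof.
move=> ij; have ji : j != i by rewrite eq_sym.
rewrite (fermion_coef_toggle _ _ ij) (fermion_coef_toggle _ _ ji) !sgn_odd !oddb.
by case: ltngtP ij => // _ _; ring.
Qed.

Lemma fermion_anticomm b c i j f : i != j ->
  fermion b i (fermion c j f) = - fermion c j (fermion b i f).
Proof.
move=> ij; pose M : End K := fermion b i \o fermion c j.
pose N : End K := -%R \o (fermion c j \o fermion b i).
suff E : M = N by exact: (congr1 (@^~ f) E).
apply: linear_eq => [||m]; try exact: linearP.
rewrite /M /N /= !fermion_basis !linearZ /= !fermion_basis !scalerA mtoggleC.
by rewrite -scaleNr scalerA mulrN (fermion_coef_anticomm _ _ _ ij).
Qed.

Lemma fermion_diag b c i m :
  fermion b i (fermion c i << m >>) = if (b != c) && ((i \in val m) == c) then << m >> else 0.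
Proof.
rewrite fermion_basis linearZ /= fermion_basis scalerA mulrC fermion_coef_toggle_diag mtoggleK.
by case: ifP; rewrite ?scale1r ?scale0r.
Qed.

Lemma fermion_nilp b i f : fermion b i (fermion b i f) = 0.
Proof.
pose M : End K := fermion b i \o fermion b i.
suff E : M = @ez K by exact: (congr1 (@^~ f) E).
apply: linear_eq => [||m]; try exact: linearP; first exact: linear_ez.
by rewrite /M /= fermion_diag eqxx.
Qed.

Lemma fermion_canonical i f :
  fermion true i (fermion false i f) = f - fermion false i (fermion true i f).
Proof.
pose M : End K := fermion true i \o fermion false i.
pose N : End K := idfun \- (fermion false i \o fermion true i).
suff E : M = N by exact: (congr1 (@^~ f) E).
apply: linear_eq => [||m]; try exact: linearP.
rewrite /M /N /= !fermion_diag /=.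
by case: (i \in _); rewrite /= ?subr0 ?subrr.
Qed.

End Fermions.

(** * The operators v_n *)

Section CliffordRelations.
Variables (K : fieldType) (V : lmodType K).
Variables (fermion : bool -> nat -> {linear V -> V}) (v : nat -> {linear V -> V}).
Local Notation x_ := (fermion false).
Local Notation d_ := (fermion true).
Hypothesis anticomm : forall b c i j f, i != j ->
  fermion b i (fermion c j f) = - fermion c j (fermion b i f).
Hypothesis nilp : forall b i f, fermion b i (fermion b i f) = 0.
Hypothesis canonical : forall i f, d_ i (x_ i f) = f - x_ i (d_ i f).
Hypothesis rec : forall n f, v n f = d_ n f + x_ n (x_ n.+1 (v (n + 3) f)).

Lemma clifford_anticomm_step b j n f : (j < n)%N ->
  fermion b j (v (n + 3) f) = - v (n + 3) (fermion b j f) ->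
  fermion b j (v n f) = - v n (fermion b j f).
Proof.
move=> jn IHn.
have anti c i g : (j < i)%N -> fermion b j (fermion c i g) = - fermion c i (fermion b j g).
  by move=> ji; apply: anticomm; rewrite ltn_eqF.
rewrite (rec n f) (rec n (fermion b j f)) linearD !anti //; last exact: leqW.
by rewrite IHn (linearN (x_ n.+1)) opprK opprD.
Qed.

Hypothesis v_anticomm : forall b j n f, (j < n)%N ->
  fermion b j (v n f) = - v n (fermion b j f).

Let anti_v b j n f : (j < n)%N -> v n (fermion b j f) = - fermion b j (v n f).
Proof. by move=> jn; rewrite v_anticomm ?opprK. Qed.

Let fermionN b j f : fermion b j (- f) = - fermion b j f.
Proof. exact: linearN. Qed.

Lemma clifford_sq n f : v n (v n f) = x_ n.+1 (v (n + 3) f).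
Proof.
have nn1 : n != n.+1 by rewrite ltn_eqF.
rewrite (rec n (v n f)) (rec n f) !linearD nilp add0r canonical.
rewrite !anti_v; try lia.
rewrite (anticomm true false _ nn1) !fermionN !opprK.
rewrite -(opprK (x_ n.+1 (x_ n _))) -(anticomm false false _ nn1) fermionN nilp oppr0 addr0.
by rewrite addrK.
Qed.

Lemma clifford_bracket n f :
  v n (v n (v n.+1 f)) - v n.+1 (v n (v n f)) = - v (n + 3) f.
Proof.
have n12 : n.+1 != n.+2 by rewrite ltn_eqF.
rewrite !clifford_sq (rec n.+1 f) (rec n.+1 (x_ n.+1 _)) !linearD canonical.
rewrite !anti_v; try lia.
rewrite !fermionN nilp !opprK addr0 -(opprK (x_ n.+2 (x_ n.+1 _))).
rewrite -(anticomm false false _ n12) fermionN nilp.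
by rewrite /= !oppr0 addr0 opprB addKr.
Qed.

End CliffordRelations.

Section Generators.
Variable K : fieldType.
Implicit Types (b : bool) (i j n : nat) (m : mono) (f : Lam K).
Local Notation x_ := (@fermion K false).
Local Notation d_ := (@fermion K true).

Lemma mk_val m : mk K (val m) = << m >>.
Proof. by rewrite /mk valK. Qed.

Lemma val_mtoggle_sort j m s : val m = sort leq s -> j \notin s -> uniq s ->
  val (mtoggle j m) = sort leq (j :: s).
Proof.
move=> mE js us; apply: sorted_ltn_eq; first exact: toggle_sorted.
  by apply: sort_leq_sorted_ltn; rewrite /= js.
move=> x; rewrite mem_toggle mE !mem_sort inE.
by case: eqP => // ->; rewrite (negbTE js).
Qed.

Lemma x_lmul j a s : sorted ltn (j :: a) -> sorted ltn s ->
  x_ j (lmul K a s) = lmul K (j :: a) s.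
Proof.
move=> sa ss; have aj := order_path_min ltn_trans sa.
have ja : j \notin a by apply/negP => /(allP aj) /=; rewrite ltnn.
rewrite /lmul /=; case: (boolP (has _ a)) => [_ | nas]; first by rewrite orbT linear0.
have us : uniq (a ++ s).
  by rewrite cat_uniq !sorted_ltn_uniq ?(path_sorted sa) //= andbT has_sym in nas *.
pose m : mono := exist _ (sort leq (a ++ s)) (sort_leq_sorted_ltn us).
have mem_m : (j \in val m) = (j \in s) by rewrite mem_sort mem_cat (negbTE ja).
rewrite orbF -[sort leq (a ++ s)]/(val m) mk_val linearZ /= fermion_basis /fermion_coef mem_m.
case: (boolP (j \in s)) => js; first by rewrite scale0r scaler0.
have <- : val (mtoggle j m) = sort leq (j :: a ++ s).
  by apply: val_mtoggle_sort; rewrite // mem_cat negb_or ja.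
rewrite mk_val scalerA inv_cons -sgnD addnC /count_below count_sort count_cat.
rewrite [X in (X + _ + _)%N](_ : _ = 0%N) //; apply/eqP; rewrite -leqn0 leqNgt -has_count.
by apply/hasPn => y /(allP aj) /= jy; rewrite -leqNgt ltnW.
Qed.

Lemma sorted_ltn_rem j s : sorted ltn s -> sorted ltn (rem j s).
Proof. by apply: subseq_sorted (rem_subseq j s); apply: ltn_trans. Qed.

Definition vterm i s k : Lam K := if (i + 3 * k)%N \in s
  then sgn K (index (i + 3 * k)%N s) *: lmul K (blk i k) (rem (i + 3 * k)%N s) else 0.

Lemma vterm0 i m : vterm i (val m) 0 = d_ i << m >>.
Proof.
have ss : sorted ltn (val m) := valP m.
rewrite fermion_basis /fermion_coef /vterm muln0 addn0.
case: (boolP (i \in val m)) => im; last by rewrite scale0r.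
rewrite (index_sorted_ltn ss im) /lmul /= /inv big_nil -[sgn K 0]/(1 : K) scale1r.
rewrite (sorted_ltn_sort (sorted_ltn_rem i ss)) -mk_val; congr (_ *: mk K _).
apply: sorted_ltn_eq; [exact: sorted_ltn_rem | exact: toggle_sorted | move=> x].
rewrite mem_rem_uniq ?sorted_ltn_uniq // inE mem_toggle.
by case: eqP => // ->; rewrite im.
Qed.

Lemma vtermS i s k : sorted ltn s -> vterm i s k.+1 = x_ i (x_ i.+1 (vterm (i + 3) s k)).
Proof.
move=> ss; rewrite /vterm (_ : i + 3 + 3 * k = i + 3 * k.+1)%N; last by lia.
case: (_ \in s); last by rewrite linear0 linear0.
have sb := blk_sorted i k.+1; rewrite blkS in sb *; have sr := sorted_ltn_rem (i + 3 * k.+1)%N ss.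
by rewrite !linearZ /= !x_lmul //; apply: path_sorted sb.
Qed.

Lemma v_basis i m : v i << m >> = \sum_(k <- iota 0 (maxl (val m)).+1) vterm i (val m) k.
Proof. exact: linear_ext_basis. Qed.

Lemma v_rec i f : v i f = d_ i f + x_ i (x_ i.+1 (v (i + 3) f)).
Proof.
pose N : End K := d_ i \+ (x_ i \o (x_ i.+1 \o v (i + 3))).
suff E : @v K i = N by exact: (congr1 (@^~ f) E).
apply: linear_eq => [||m]; try exact: linearP.
rewrite /N /= -vterm0 !v_basis.
rewrite [x_ i.+1 _](raddf_sum (fermion false i.+1)) [x_ i _](raddf_sum (fermion false i)) /=.
set s := val m; have ss : sorted ltn s := valP m.
have vterm_last : vterm i s (maxl s).+1 = 0.
  by rewrite /vterm; case: (boolP (_ \in s)) => // /leq_maxl_mem; lia.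
transitivity (\sum_(k <- iota 0 (maxl s).+2) vterm i s k).
  rewrite -[(maxl s).+2]addn1 iotaD big_cat big_seq1 add0n vterm_last.
  exact: esym (addr0 _).
have -> : iota 0 (maxl s).+2 = 0%N :: iota 1 (maxl s).+1 by [].
rewrite [LHS]big_cons (iotaDl 1 0) big_map; congr (_ + _).
by apply: eq_bigr => k _; rewrite add1n vtermS.
Qed.

Lemma v_above i m : (forall j, j \in val m -> j < i)%N -> v i << m >> = 0 :> Lam K.
Proof.
move=> mi; rewrite v_basis; apply: big1_seq => k _; rewrite /vterm.
by case: (boolP (_ \in _)) => // /mi; lia.
Qed.

Lemma mono_ind_above (Phi : nat -> Prop) m :
    (forall i, (forall j, j \in val m -> j < i)%N -> Phi i) ->
    (forall i, Phi (i + 3)%N -> Phi i) ->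
  forall i, Phi i.
Proof.
move=> above step i.
have [k] : exists k, forall j, j \in val m -> (j < i + 3 * k)%N.
  by exists (maxl (val m)).+1 => j /leq_maxl_mem; lia.
elim: k i => [|k IHk] i mk; first by apply: above => j /mk; rewrite addn0.
by apply/step/IHk => j /mk; lia.
Qed.

Lemma fermion_v b j n f : (j < n)%N -> fermion b j (v n f) = - v n (fermion b j f).
Proof.
move=> jn; pose M : End K := fermion b j \o v n.
pose N : End K := -%R \o (v n \o fermion b j).
suff E : M = N by exact: (congr1 (@^~ f) E).
apply: linear_eq => [||m]; try exact: linearP.
rewrite /M /N /=; move: n jn {M N}; apply: (@mono_ind_above _ m) => n IHn jn.
  rewrite v_above // linear0 fermion_basis linearZ /= v_above ?scaler0 ?oppr0 // => i.
  by rewrite mem_toggle; case: eqP => [-> | _ /= /IHn].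
apply: (clifford_anticomm_step (fermion := @fermion K) (v := @v K)) jn (IHn (ltn_addr 3 jn)).
  exact: fermion_anticomm.
exact: v_rec.
Qed.

Lemma v_sq_bracket n f :
  v n (v n (v n.+1 f)) - v n.+1 (v n (v n f)) = - v (n + 3) f.
Proof.
apply: (clifford_bracket (fermion := @fermion K) (v := @v K)).
- exact: fermion_anticomm.
- exact: fermion_nilp.
- exact: fermion_canonical.
- exact: v_rec.
- exact: fermion_v.
Qed.

Lemma fermion_supp b j m m' : esupp (@fermion K b j) (m, m') ->
  ((j \in val m) = b) /\ m' = mtoggle j m.
Proof.
rewrite /esupp /= fermion_basis mcoeffZ mulf_eq0 negb_or mcoeffU => /andP[c0 m'0].
split; last by apply/esym/eqP; apply: contraNT m'0 => /negbTE ->.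
by apply/eqP; apply: contraNT c0; rewrite /fermion_coef => /negbTE ->.
Qed.

Lemma mono_weight_toggle j m : mono_weight (mtoggle j m) =
  if j \in val m then mono_weight m - 'X^j else mono_weight m + 'X^j.
Proof.
have := perm_toggle j (valP m); rewrite /mono_weight.
case: (j \in val m) => /(perm_big _) ->; rewrite big_cons; first by rewrite addrC addKr.
exact: addrC.
Qed.

Lemma fermion_eweight b j e : esupp (@fermion K b j) e ->
  eweight e = (if b then 'X^j else - 'X^j) /\ mpar e.1 != mpar e.2.
Proof.
case: e => m m' /fermion_supp[mb ->]; rewrite /eweight /= mpar_toggle mono_weight_toggle mb.
split; last by case: (mpar m).
by case: b {mb}; rewrite opprD ?opprK addrA subrr add0r.
Qed.

Lemma v_recE i : @v K i = eadd (d_ i) (ecomp (x_ i) (ecomp (x_ i.+1) (v (i + 3)))).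
Proof. by apply/funext => f; apply: v_rec. Qed.

Lemma v_eweight i e : esupp (@v K i) e ->
  mpar e.1 != mpar e.2 /\ exists2 q, coef_ge0 q & eweight e = q * chi + 'X^i.
Proof.
case: e => m m' /=; move: i m'; apply: (@mono_ind_above _ m) => i IHi m'.
  by rewrite /esupp /= v_above // mcoeff0 eqxx.
have lx j : linear (x_ j) by apply: linearP.
rewrite v_recE => /eadd_supp[/fermion_eweight[-> ->] | ].
  by split=> //; exists 0; rewrite ?mul0r ?add0r // => j; rewrite coef0.
case/(ecomp_supp (lx i)) => m1 [/(ecomp_supp (lx i.+1))[m2 [/IHi[p2 [q q0 w2]] s1]] s2].
have [w1 p1] := fermion_eweight s1; have [w0 p0] := fermion_eweight s2.
split; first by move: p0 p1 p2; rewrite /=; case: (mpar m); case: (mpar m1); case: (mpar m2).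
exists (q + 'X^i) => [j|]; first by rewrite coefD addr_ge0 ?coef_ge0Xn.
have -> : eweight (m, m') = eweight (m, m2) + eweight (m2, m1) + eweight (m1, m').
  by rewrite /eweight /= !addrA !subrK.
rewrite w2 w1 w0 /chi exprD !exprS -[2]/(1 + 1) rmorphD; ring.
Qed.

Lemma v_odd n : epo (@v K n) = v n.
Proof. by apply: epo_odd => [|e /v_eweight[]]; first exact: linearP. Qed.

Lemma v_sq_even n : epe (ecomp (@v K n) (v n)) = ecomp (v n) (v n) /\
  epo (ecomp (@v K n) (v n)) = @ez K.
Proof.
have lv : linear (@v K n) by apply: linearP.
apply: epe_even => [|[m m'] /(ecomp_supp lv)[m1 [/v_eweight[p1 _] /v_eweight[p2 _]]]].
  exact: linear_ecomp.
by move: p1 p2 => /=; case: (mpar m); case: (mpar m1); case: (mpar m').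
Qed.

Lemma ebr_v_sq n : ebr (ecomp (@v K n) (v n)) (v n.+1) = escale (-1) (v (n + 3)).
Proof.
have [e o] := v_sq_even n; rewrite (ebr_even _ e o); last exact: linearP.
by apply/funext => f; rewrite /escale scaleN1r; apply: v_sq_bracket.
Qed.

Lemma v_Qalg n : Qalg K (v n).
Proof.
elim/ltn_ind: n => -[_|[_|[_|n IHn]]].
- by apply: gen_in; left.
- by apply: gen_in; right; left.
- by apply: gen_in; right; right; left.
have [Q0 Q1] : Qalg K (v n) /\ Qalg K (v n.+1) by split; apply: IHn; lia.
have -> : @v K n.+3 = escale (-1) (ebr (ecomp (v n) (v n)) (v n.+1)).
  by rewrite ebr_v_sq addn3; apply/funext => f; rewrite /escale !scaleN1r opprK.
apply: (gen_scale (A := LieEnd K)); apply: (gen_op (A := LieEnd K)) Q1; first by left.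
exact: (gen_sq (A := LieEnd K)) Q0 (v_odd n).
Qed.

Lemma v_Aalg n : Aalg K (v n).
Proof.
elim/ltn_ind: n => -[_|[_|[_|n IHn]]].
- by apply: gen_in; left.
- by apply: gen_in; right; left.
- by apply: gen_in; right; right; left.
have [A0 A1] : Aalg K (v n) /\ Aalg K (v n.+1) by split; apply: IHn; lia.
have -> : @v K n.+3 = eadd (ecomp (v n.+1) (ecomp (v n) (v n)))
    (escale (-1) (ecomp (ecomp (v n) (v n)) (v n.+1))).
  apply/funext => f; have := congr1 -%R (v_sq_bracket n f).
  by rewrite opprB opprK addn3 /eadd /escale scaleN1r => <-.
have comp M N : Aalg K M -> Aalg K N -> Aalg K (ecomp M N).
  by apply: (gen_op (A := AssEnd K)); left.
have A2 := comp _ _ A0 A0; apply: (gen_add (A := AssEnd K)); first exact: comp A1 A2.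
exact: (gen_scale (A := AssEnd K) (-1)) (comp _ _ A2 A1).
Qed.

Definition mono_nil : mono := exist _ [::] isT.
Definition mono1 n : mono := exist _ [:: n] isT.

Lemma esupp_v_mono1 n : esupp (@v K n) (mono1 n, mono_nil).
Proof.
have above j : j \in val (mono1 n) -> (j < n + 3)%N by rewrite inE => /eqP ->; lia.
have toggleE : mtoggle n (mono1 n) = mono_nil.
  apply/val_inj/sorted_ltn_eq; [exact: toggle_sorted | by [] | move=> x].
  by rewrite mem_toggle inE addbb.
rewrite /esupp v_rec (v_above above) !linear0 addr0 fermion_basis toggleE mcoeffZ mcoeffUU mulr1.
by rewrite /fermion_coef /= mem_head signr_eq0.
Qed.

End Generators.

Section OperatorDegrees.
Variables (K : fieldType) (R : realType).
Implicit Types (M : End K) (e : mono * mono).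

Definition edeg e : R * R[i] := degree R (eweight e).

Definition eproper e : Prop := effective (eweight e) /\ edeg e != 0.

Lemma edegD e1 e2 e : eweight_add e1 e2 e -> edeg e = edeg e1 + edeg e2.
Proof. by rewrite /edeg => ->; apply: degreeD. Qed.

Lemma eproper_add e1 e2 e : eweight_add e1 e2 e -> eproper e1 -> eproper e2 -> eproper e.
Proof.
move=> eE [f1 /eqP d1] [f2 _]; split; first by rewrite eE; apply: effectiveD.
by apply/eqP; rewrite /edeg eE => /(effective_degreeD_eq0 f1 f2)[/d1].
Qed.

Lemma mono_weight_coef m j : (mono_weight m)`_j = (j \in val m).
Proof.
rewrite /mono_weight coef_sum -(count_uniq_mem j (sorted_ltn_uniq (valP m))).
elim: (val m) => [|x s IHs]; first by rewrite big_nil.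
by rewrite big_cons IHs coefXn natz /= PoszD eq_sym.
Qed.

Lemma eproper_admissible e : eproper e -> admissible_degree (edeg e).
Proof.
move=> [fe _]; exists (eweight e) => //; split=> // j.
by rewrite coefB !mono_weight_coef; case: (_ \in _); case: (_ \in _).
Qed.

Lemma v_hom i : hom (A := LieEnd K) (@esupp K) edeg (degree R 'X^i) (v i).
Proof. by move=> e /v_eweight[_ [q _ eE]]; rewrite /edeg eE degree_mul_chi. Qed.

Lemma v_eproper i e : esupp (@v K i) e -> eproper e.
Proof.
move=> s; split; last by rewrite (v_hom s) degreeXn_neq0.
have [_ [q q0 ->]] := v_eweight s.
exact: effectiveD (effective_mul_chi q0) (effectiveXn i).
Qed.

Lemma v_gens M : InL M [:: @v K 0; @v K 1; @v K 2] -> exists i, M = v i.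
Proof. by case=> [<- | [<- | [<- | //]]]; eexists. Qed.

(* [LieEnd] and [AssEnd] share the underlying space of operators. *)
Section Generated.
Variables (pe po sq : End K -> End K) (ops : seq (End K -> End K -> End K)).
Let A : alg K := @Alg K (End K) (@ez K) (@eadd K) (@escale K) pe po ops sq.
Let VA : car A -> Prop := gen (A := A) [:: @v K 0; @v K 1; @v K 2].
Hypotheses (subA : is_subalg (A := A) (fun M => linear M))
           (gA : graded (A := A) (@esupp K) (fun M => linear M) (@eweight_add))
           (linA : linear_operations (A := A) (fun M => linear M)).

Lemma gen_v_linear M : VA M -> linear M.
Proof. by apply: (gen_ambient subA) => N /v_gens[i ->]; apply: linearP. Qed.

Lemma gen_v_eproper M e : VA M -> esupp M e -> eproper e.
Proof.
move=> VM; suff [_ /(_ e)] : supported (A := A) (@esupp K) (fun M => linear M) eproper M by [].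
move: VM; apply: gen_min => [|N /v_gens[i ->]].
  by apply: (supported_subalg gA subA); apply: eproper_add.
by split=> [|e']; [apply: linearP | apply: v_eproper].
Qed.

Lemma gen_v_hom_sum M : VA M -> hom_sum (A := A) (@esupp K) edeg VA M.
Proof.
apply: (gen_hom_sum linA subA gA edegD) => N /v_gens[i ->]; first exact: linearP.
by exists (degree R 'X^i); apply: v_hom.
Qed.

Lemma gen_v_continuum : (forall n, VA (v n)) -> continuum_ln_decompositions (A := A) VA.
Proof.
move=> Av; have subVA : is_subalg VA := gen_subalg _.
apply: (half_spaces_continuum (bar := fun _ => false) (adm := @admissible_degree R)
  _ subVA _ _ gen_v_hom_sum (aaddA linA) (aaddC linA) (aadd0 linA)
  (@direction_cone_half_space R) (@direction_cone_separated R)).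
- apply: graded_sub gA => [M | e1 e2 e /edegD eE]; [exact: gen_v_linear | by split].
- by move=> M e VM /(gen_v_eproper VM)/eproper_admissible.
- by move=> M e VM /(gen_v_eproper VM)[_ /eqP].
move=> n; exists (v n), (mono1 n, mono_nil).
by split; [apply: Av | apply: esupp_v_mono1 | apply: v_hom].
Qed.

End Generated.

Theorem Qalg_continuum : continuum_ln_decompositions (A := LieEnd K) (Qalg K).
Proof.
exact: gen_v_continuum (@linear_LieEnd_subalg K) (@LieEnd_graded K) (@LieEnd_linear K) (@v_Qalg K).
Qed.

Theorem Aalg_continuum : continuum_ln_decompositions (A := AssEnd K) (Aalg K).
Proof.
exact: gen_v_continuum (@linear_AssEnd_subalg K) (@AssEnd_graded K) (@AssEnd_linear K) (@v_Aalg K).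
Qed.

End OperatorDegrees.

(** * The Kantor double of the Poisson superalgebra *)

Section KantorDouble.
Variables (K : fieldType) (R : realType).
Implicit Types (f : Hf K) (u w : Jcar K) (t : seq nat) (i : bool * seq nat).

Definition jsupp u i : Prop := hsupp (if i.1 then u.2 else u.1) i.2.
Definition jdeg i : R * R[i] := hdeg R i.2.

Lemma hflip_supp f t : hsupp (hflip f) t -> hsupp f t.
Proof. by rewrite /hsupp mulf_eq0 negb_or => /andP[]. Qed.

Lemma hflip_Palg f : Palg K f -> Palg K (hflip f).
Proof.
move=> Pf; have -> : hflip f = hadd (hpe f) (hscale (-1) (hpo f)).
  apply/funext => t; rewrite /hflip /hadd /hscale /hpe /hpo sgn_odd.
  by case: (odd _); rewrite ?add0r // mulr0 addr0 mul1r.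
apply: (gen_add (A := Halg K)); first exact: (gen_pe (A := Halg K)).
by apply: (gen_scale (A := Halg K)); apply: (gen_po (A := Halg K)).
Qed.

Lemma jprod_Jo u w : Jo K u -> Jo K w -> Jo K (jprod u w).
Proof.
case: u w => [a b] [c d] [[/= Pa a0] Pb] [[/= Pc c0] Pd].
have hadd_Palg f g : Palg K f -> Palg K g -> Palg K (hadd f g) by exact: (gen_add (A := Halg K)).
have hmul_Palg f g : Palg K f -> Palg K g -> Palg K (hmul f g).
  by apply: (gen_op (A := Halg K)); left.
have hbr_Palg f g : Palg K f -> Palg K g -> Palg K (hbr f g).
  by apply: (gen_op (A := Halg K)); right; left.
have [Pc' Pd'] := (hflip_Palg Pc, hflip_Palg Pd); split=> /=; last first.
  by apply: hadd_Palg; apply: hmul_Palg.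
split; first by apply: hadd_Palg; [apply: hmul_Palg | apply: hbr_Palg].
by rewrite /hadd (hmul_const _ a0) (hbr_const R Pb Pd') addr0.
Qed.

Lemma jprod_supp u w i : Jo K u -> Jo K w -> jsupp (jprod u w) i ->
  exists i1 i2, [/\ jsupp u i1, jsupp w i2 & kantor_comp jdeg fst i1 i2 i].
Proof.
case: u w i => [a b] [c d] [[|] t] [_ /= Pb] [_ /= Pd]; rewrite /jsupp /=.
  case/hadd_supp => /hmul_supp[p [q [sp sq /(hdegM R) dt]]].
    by exists (false, p), (true, q).
  by exists (true, p), (false, q); split=> //; apply: hflip_supp.
case/hadd_supp => [/hmul_supp[p [q [sp sq /(hdegM R) dt]]] | ].
  by exists (false, p), (false, q).
case/hbr_supp => p [q [sp /hflip_supp sq ct]]; exists (true, p), (true, q); split=> //.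
split=> //; first exact/hdegM/contracted_composes.
have [p_neq0 q_neq0] := contracted_neq_nil ct => _ _.
have [_ _ p0] := Palg_proper R Pb sp; have [_ _ q0] := Palg_proper R Pd sq.
by split; [apply: contraNneq p_neq0 => /p0 -> | apply: contraNneq q_neq0 => /q0 ->].
Qed.

Lemma Jo_subalg : is_subalg (A := Jalg K) (Jo K).
Proof.
have [P0 PD PZ Pp _] := Po_subalg K R.
have [A0 AD AZ Ap _] := gen_subalg (A := Halg K) [:: hone K; VV K 0; VV K 1; VV K 2].
split.
- by split.
- by move=> u w [? ?] [? ?]; split; [apply: PD | apply: AD].
- by move=> c u [? ?]; split; [apply: PZ | apply: AZ].
- by move=> u [/Pp[? ?] /Ap[? ?]]; split; split.
- by split=> [f u w [<- | //] | u Ju _]; [apply: jprod_Jo | apply: jprod_Jo].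
Qed.

Lemma Jo_graded : graded (A := Jalg K) jsupp (Jo K) (kantor_comp jdeg fst).
Proof.
split.
- by case=> [[|] t]; rewrite /jsupp /hsupp eqxx.
- move=> [a b] _ u0; congr (_, _); apply/funext => t; apply/eqP/negPn/negP.
    exact: (u0 (false, t)).
  exact: (u0 (true, t)).
- by move=> u w [[|] t] _ _; apply: hadd_supp.
- by move=> c u [[|] t] _; apply: hscale_supp.
- by move=> u [[|] t] _; [apply: hpo_supp | apply: hpe_supp].
- by move=> u [[|] t] _; [apply: hpe_supp | apply: hpo_supp].
- by move=> f u w i [<- | //]; apply: jprod_supp.
- by move=> u i Ju _; apply: jprod_supp.
Qed.

Lemma jaddA u v w : aadd (Jalg K) u (aadd (Jalg K) v w) = aadd (Jalg K) (aadd (Jalg K) u v) w.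
Proof. by congr (_, _); apply: (aaddA (Halg_linear K)). Qed.

Lemma jaddC u w : aadd (Jalg K) u w = aadd (Jalg K) w u.
Proof. by congr (_, _); apply: (aaddC (Halg_linear K)). Qed.

Lemma jadd0 u : aadd (Jalg K) (hz K, hz K) u = u.
Proof. by case: u => f g; congr (_, _); apply: (aadd0 (Halg_linear K)). Qed.

Lemma Jo_hom_sum u : Jo K u -> hom_sum (A := Jalg K) jsupp jdeg (Jo K) u.
Proof.
case: u => f g [/= Pof Pg]; have linH := Halg_linear K.
have -> : (f, g) = aadd (Jalg K) (f, hz K) (hz K, g).
  congr (_, _); apply/esym; last exact: (aadd0 linH).
  exact: etrans (aaddC linH _ _) (aadd0 linH _).
apply: (hom_sum_add (A := Jalg K) jaddA jadd0).
  apply: (hom_sum_map (A := Halg K) (A' := Jalg K) (phi := fun h => (h, hz K))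
    _ _ _ _ (Po_hom_sum R Pof)) => //.
  - by move=> h h'; congr (_, _); apply/esym/(aadd0 linH).
  - by move=> h Ph; split=> //; apply: (gen_0 (A := Halg K)).
  - by move=> h [[|] t]; rewrite /jsupp /= => ht; [case/eqP: ht | exists t].
apply: (hom_sum_map (A := Halg K) (A' := Jalg K) (phi := fun h => (hz K, h))
  _ _ _ _ (Palg_hom_sum R Pg)) => //.
- by move=> h h'; congr (_, _); apply/esym/(aadd0 linH).
- by move=> h Ph; split=> //; split; first exact: (gen_0 (A := Halg K)).
- by move=> h [[|] t]; rewrite /jsupp /= => ht; [exists t | case/eqP: ht].
Qed.

Theorem Jo_continuum : continuum_ln_decompositions (A := Jalg K) (Jo K).
Proof.
apply: (half_spaces_continuum (adm := @admissible_degree R) Jo_graded Jo_subalg _ _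
  Jo_hom_sum jaddA jaddC jadd0
  (@direction_cone_half_space R) (@direction_cone_separated R)).
- by move=> u [[|] t] [[Pf _] Pg] s; [have := Palg_proper R Pg s | have := Palg_proper R Pf s];
    apply: proper_admissible.
- move=> u [[|] t] [Pof _] // s /eqP d0; have := Po_hdeg_neq0 R Pof s.
  by rewrite d0.
move=> n; exists (VV K n, hz K), (false, Lk n 0); split.
- by split; [apply: VV_Po | apply: (gen_0 (A := Halg K))].
- by rewrite /jsupp /hsupp /= VV_Lk oner_neq0.
- by move=> [[|] t]; rewrite /jsupp /= => s; [case/eqP: s | apply: (VV_hom R s)].
Qed.

End KantorDouble.

Section LieDouble.
Variables (K : fieldType) (R : realType).
Implicit Types (x y : End K) (u w : Kcar K) (e : mono * mono) (l m : K).
Implicit Types (i : option (bool * (mono * mono))).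

(* The index [None] is that of 1bar. *)
Definition ksupp u i : Prop :=
  let: (l, x, m, y) := u in
  if i is Some (b, e) then esupp (if b then y else x) e else m != 0.
Definition kdeg i : R * R[i] := if i is Some (_, e) then edeg R e else 0.
Definition kbar i : bool := if i is Some (b, _) then b else true.

Lemma Qalg_linear x : Qalg K x -> linear x.
Proof. exact: gen_v_linear (@linear_LieEnd_subalg K) _. Qed.

Lemma Qalg_eproper x e : Qalg K x -> esupp x e -> eproper R e.
Proof. exact: gen_v_eproper (@linear_LieEnd_subalg K) (@LieEnd_graded K) _ _. Qed.

Lemma Qalg_hom_sum x : Qalg K x -> hom_sum (A := LieEnd K) (@esupp K) (edeg R) (Qalg K) x.
Proof.
exact: gen_v_hom_sum (@linear_LieEnd_subalg K) (@LieEnd_graded K) (@LieEnd_linear K) _.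
Qed.

Lemma eflip_Qalg x : Qalg K x -> Qalg K (eflip x).
Proof.
move=> Qx; have -> : eflip x = eadd (epe x) (escale (-1) (epo x)).
  by apply/funext => f; congr (_ + _); apply/esym/scaleN1r.
apply: (gen_add (A := LieEnd K)); first exact: (gen_pe (A := LieEnd K)).
by apply: (gen_scale (A := LieEnd K)); apply: (gen_po (A := LieEnd K)).
Qed.

Lemma kprod_unitless x m y x' m' y' : kprod (0, x, m, y) (0, x', m', y') =
  (0, ebr y y', 0, eadd (escale m' x) (escale m (eflip x'))).
Proof.
have escale0 z : escale 0 z = @ez K by apply/funext => f; apply: scale0r.
by rewrite /= !escale0 !eadd0 !mul0r addr0.
Qed.

Lemma kprod_Ko u w : Ko K u -> Ko K w -> Ko K (kprod u w).
Proof.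
case: u => [[[l x] m] y]; case: w => [[[l' x'] m'] y'] [-> Qx Qy] [-> Qx' Qy'].
rewrite kprod_unitless; split=> //; first by apply: (gen_op (A := LieEnd K)) Qy Qy'; left.
apply: (gen_add (A := LieEnd K)); apply: (gen_scale (A := LieEnd K)) => //.
exact: eflip_Qalg.
Qed.

Lemma kprod_supp u w i : Ko K u -> Ko K w -> ksupp (kprod u w) i ->
  exists i1 i2, [/\ ksupp u i1, ksupp w i2 & kantor_comp kdeg kbar i1 i2 i].
Proof.
case: u => [[[l x] m] y]; case: w => [[[l' x'] m'] y'] [-> Qx Qy] [-> Qx' Qy'].
rewrite kprod_unitless; case: i => [[[|] e]|] /=; last by rewrite eqxx.
  case/eadd_supp => /escale_supp[c0 s].
    by exists (Some (false, e)), None; split=> //; split; rewrite ?addr0.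
  exists None, (Some (false, e)); split=> //; first exact: eflip_supp (Qalg_linear Qx') s.
  by split; rewrite ?add0r.
case/(ebr_weight (Qalg_linear Qy) (Qalg_linear Qy')) => e1 [e2 [s1 s2 eE]].
exists (Some (true, e1)), (Some (true, e2)); split=> //; split=> // [|_ _].
  exact: edegD.
by have [[_ ?] [_ ?]] := (Qalg_eproper Qy s1, Qalg_eproper Qy' s2).
Qed.

Lemma Ko_subalg : is_subalg (A := Kalg K) (Ko K).
Proof.
have [Q0 QD QZ Qp _] := gen_subalg (A := LieEnd K) [:: @v K 0; @v K 1; @v K 2].
split.
- by split.
- move=> [[[l x] m] y] [[[l' x'] m'] y'] [-> Qx Qy] [-> Qx' Qy'].
  by split; [exact: addr0 | exact: QD | exact: QD].
- move=> c [[[l x] m] y] [-> Qx Qy].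
  by split; [exact: mulr0 | exact: QZ | exact: QZ].
- move=> [[[l x] m] y] [-> /Qp[Qxe Qxo] /Qp[Qye Qyo]].
  by split; [exact: (And3 erefl Qxe Qyo) | exact: (And3 erefl Qxo Qye)].
- by split=> [f u w [<- | //] | u Ku _]; apply: kprod_Ko.
Qed.

Lemma Ko_graded : graded (A := Kalg K) ksupp (Ko K) (kantor_comp kdeg kbar).
Proof.
split.
- move=> [[[|] e] | ] /=; [exact: ez_supp | exact: ez_supp | by rewrite eqxx].
- move=> [[[l x] m] y] [-> /Qalg_linear lx /Qalg_linear ly] u0; congr (_, _, _, _).
  + by apply: (esupp_eq0 lx) => e; exact: (u0 (Some (false, e))).
  + by apply/eqP/negPn/negP; exact: (u0 None).
  + by apply: (esupp_eq0 ly) => e; exact: (u0 (Some (true, e))).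
- move=> [[[l x] m] y] [[[l' x'] m'] y'] [[[|] e] | ] _ _ /=; try exact: eadd_supp.
  by have [-> | _] := eqVneq m 0; [rewrite add0r; right | left].
- move=> c [[[l x] m] y] [[[|] e] | ] _ /=; try by case/escale_supp.
  by rewrite mulf_eq0 negb_or => /andP[].
- move=> [[[l x] m] y] [[[|] e] | ] [_ Qx Qy] /=; last by rewrite eqxx.
    exact: epo_supp (Qalg_linear Qy).
  exact: epe_supp (Qalg_linear Qx).
- move=> [[[l x] m] y] [[[|] e] | ] [_ Qx Qy] //=.
    exact: epe_supp (Qalg_linear Qy).
  exact: epo_supp (Qalg_linear Qx).
- by move=> f u w i [<- | //]; apply: kprod_supp.
- by move=> u i Ku _; apply: kprod_supp.
Qed.

Lemma kaddA u v w : aadd (Kalg K) u (aadd (Kalg K) v w) = aadd (Kalg K) (aadd (Kalg K) u v) w.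
Proof.
case: u v w => [[[l x] m] y] [[[l' x'] m'] y'] [[[l'' x''] m''] y''].
by congr (_, _, _, _); (exact: addrA || exact: eaddA).
Qed.

Lemma kaddC u w : aadd (Kalg K) u w = aadd (Kalg K) w u.
Proof.
case: u w => [[[l x] m] y] [[[l' x'] m'] y'].
by congr (_, _, _, _); (exact: addrC || exact: eaddC).
Qed.

Lemma kadd0 u : aadd (Kalg K) (az (Kalg K)) u = u.
Proof.
by case: u => [[[l x] m] y]; congr (_, _, _, _); (exact: add0r || exact: eadd0).
Qed.

Lemma Ko_hom_sum u : Ko K u -> hom_sum (A := Kalg K) ksupp kdeg (Ko K) u.
Proof.
case: u => [[[l x] m] y] [-> Qx Qy]; have Q0 := gen_0 (A := LieEnd K) [:: @v K 0; @v K 1; @v K 2].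
have -> : (0, x, m, y) = aadd (Kalg K) (0, x, 0, @ez K)
    (aadd (Kalg K) (0, @ez K, m, @ez K) (0, @ez K, 0, y)).
  by rewrite /= !add0r addr0 !eadd0 (eaddC x) eadd0.
do 2?apply: (hom_sum_add (A := Kalg K) kaddA kadd0).
- apply: (hom_sum_map (A := LieEnd K) (A' := Kalg K) (phi := fun z => (0, z, 0, @ez K))
    _ _ _ _ (Qalg_hom_sum Qx)) => // [z z' | z [[[|] e]|] /= s].
  + by rewrite /= addr0 eadd0.
  + by case: (ez_supp s).
  + by exists e.
  + by rewrite eqxx in s.
- apply: (hom_sum1 (A := Kalg K) kaddC kadd0 (d := 0)); first by split.
  by move=> [[[|] e]|] //= /ez_supp.
- apply: (hom_sum_map (A := LieEnd K) (A' := Kalg K) (phi := fun z => (0, @ez K, 0, z))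
    _ _ _ _ (Qalg_hom_sum Qy)) => // [z z' | z [[[|] e]|] /= s].
  + by rewrite /= addr0 eadd0.
  + by exists e.
  + by case: (ez_supp s).
  + by rewrite eqxx in s.
Qed.

Theorem Ko_continuum : continuum_ln_decompositions (A := Kalg K) (Ko K).
Proof.
apply: (half_spaces_continuum (adm := @admissible_degree R) Ko_graded Ko_subalg _ _
  Ko_hom_sum kaddA kaddC kadd0
  (@direction_cone_half_space R) (@direction_cone_separated R)).
- move=> [[[l x] m] y] [[[|] e] | ] [_ Qx Qy] /= s.
  + exact: eproper_admissible (Qalg_eproper Qy s).
  + exact: eproper_admissible (Qalg_eproper Qx s).
  + by rewrite -(hdeg_nil R); apply/proper_admissible/proper_nil.
- move=> [[[l x] m] y] [[[|] e] | ] [_ Qx Qy] //= s d0.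
  by have [_] := Qalg_eproper Qx s; rewrite d0 eqxx.
move=> n; exists (0, @v K n, 0, @ez K), (Some (false, (mono1 n, mono_nil))); split.
- by split; [| apply: v_Qalg | apply: (gen_0 (A := LieEnd K))].
- exact: esupp_v_mono1.
- by move=> [[[|] e] | ] /=; [move/ez_supp | apply: v_hom | rewrite eqxx].
Qed.

End LieDouble.

Theorem theorem14p2 (K : fieldType) :
  [/\ @continuum_ln_decompositions K (LieEnd K) (Qalg K),
      @continuum_ln_decompositions K (AssEnd K) (Aalg K),
      @continuum_ln_decompositions K (Halg K) (Po K) &
      ((2%:R : K) != 0 ->
         @continuum_ln_decompositions K (Jalg K) (Jo K) /\
         @continuum_ln_decompositions K (Kalg K) (Ko K))].
Proof.
pose R : realType := Rdefinitions.R.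
split; last move=> _; last split.
- exact: (Qalg_continuum K R).
- exact: (Aalg_continuum K R).
- exact: (Po_continuum K R).
- exact: (Jo_continuum K R).
- exact: (Ko_continuum K R).
Qed.
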